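(* If $\mathcal F$ admits query-weight exact-sum, then $\min_{S\in\mathcal F}\mathbb E[\mathrm{Top}_k(S)]$ admits a PTAS for every $k\ge 1$, i.e. one can return $S\in\mathcal F$ with $\mathbb E[\mathrm{Top}_k(S)]\le(1+O(\varepsilon))\,\mathrm{OPT}_{\min}$, with the following time bounds for an absolute constant $C$: for $k\le C/\varepsilon^2$ the running time is $n^{O(1/\varepsilon^6)}$ times a factor depending only on $\varepsilon$, times $\mathrm{poly}(\langle\mathcal F\rangle)$; for $k\ge C/\varepsilon^2$ it is $\mathrm{poly}(n,1/\varepsilon)$ query-weight exact-sum calls of magnitude $\mathrm{poly}(n,1/\varepsilon)$.
   Context: $X_1,\dots,X_n$ are independent nonnegative discrete random variables, each given by an explicit finite list of atoms and masses; $\mathcal F\subseteq 2^{[n]}$ is nonempty; $k\ge1$ is part of the input. $\mathrm{Top}_k(S)$ is the sum of the $k$ largest values among $(X_i)_{i\in S}$ (padded with zeros if $|S|<k$), and $\mathrm{OPT}_{\min}=\min_{S\in\mathcal F}\mathbb E[\mathrm{Top}_k(S)]$. Query-weight exact-sum: let $\langle\mathcal F\rangle$ be the bit length of the encoding of $\mathcal F$. Given integer query weights $w_i$ of magnitude $M=\max_i|w_i|$ and a target $t$, decide whether some $S\in\mathcal F$ satisfies $\sum_{i\in S}w_i=t$ and return one such $S$ if so (vector targets are encoded by mixed radix). $\mathcal F$ admits query-weight exact-sum if this can be done in time $\mathrm{poly}(\langle\mathcal F\rangle)\,M^{O(1)}$. The magnitude of a call is the $M$ of its query weights.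
   Formalization: For k ≤ C/ε² the running time carries an extra factor polynomial in the bit length of the listed atoms and masses, since no algorithm can run in time independent of the length of these lists; ε is a rational in (0,1], and atoms and masses are rational. *)

(* Defs.v *)
From mathcomp Require Import all_boot all_order all_algebra.

Set Implicit Arguments.
Unset Strict Implicit.
Unset Printing Implicit Defensive.

Import Order.TTheory GRing.Theory Num.Theory.

Local Open Scope ring_scope.

(** * Computation model

   A first-order language with recursion over binary trees with integer leaves,
   under the logarithmic cost criterion: each evaluated node costs at least 1,
   and an integer operation is charged according to the bit lengths of its
   operands.  Trees are shared (a variable access or a [Cons] is a pointer
   operation) and no instruction traverses a tree, so that this notion of time
   is polynomially equivalent to Turing machine time. *)

Inductive data := DInt of int | DPair of data & data.

Definition bitlen (z : int) : nat := (trunc_log 2 `|z|%N).+1.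

Fixpoint dsize (x : data) : nat :=
  match x with
  | DInt z => (bitlen z).+1
  | DPair x1 x2 => (dsize x1 + dsize x2).+1
  end.

Inductive binop := Add | Sub | Mul | Div | Leq.

Definition op_val (o : binop) (a b : int) : int :=
  match o with
  | Add => a + b
  | Sub => a - b
  | Mul => a * b
  | Div => (a %/ b)%Z
  | Leq => if a <= b then 1 else 0
  end.

(* Comparison only has to read as many bits as the shorter operand has: if the
   bit lengths differ, then the signs and the lengths decide. *)
Definition op_cost (o : binop) (a b : int) : nat :=
  match o with
  | Add | Sub => bitlen a + bitlen b
  | Mul | Div => bitlen a * bitlen b
  | Leq => minn (bitlen a) (bitlen b)
  end.

(* Variables are de Bruijn indices.  [Call f e] applies the f-th function of the
   program, whose body is run with the value of [e] as its only variable.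
   [Query e] calls an external procedure on the value of [e]. *)
Inductive expr :=
  | Var of nat
  | Cst of int
  | Op of binop & expr & expr
  | Cons of expr & expr
  | Fst of expr
  | Snd of expr
  | IsPair of expr
  | If of expr & expr & expr
  | Let of expr & expr
  | Call of nat & expr
  | Query of expr.

Definition program := seq expr.

(* [O q a c] : the external procedure answers [a] to [q] in time [c]. *)
Definition oracle := data -> data -> nat -> Prop.

Definition no_oracle : oracle := fun _ _ _ => False.

(* The external calls made, in order: argument and time of each call. *)
Definition trace := seq (data * nat).

(* [eval p O env e v t tr] : in the environment [env], [e] evaluates to [v], with
   [t] the time spent outside the external calls and [tr] the calls. *)
Inductive eval (p : program) (O : oracle) :
    seq data -> expr -> data -> nat -> trace -> Prop :=
  | EVar env i :
      (i < size env)%N ->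
      eval p O env (Var i) (nth (DInt 0) env i) 1 [::]
  | ECst env z :
      eval p O env (Cst z) (DInt z) (bitlen z).+1 [::]
  | EOp env o e1 e2 a b t1 t2 tr1 tr2 :
      eval p O env e1 (DInt a) t1 tr1 ->
      eval p O env e2 (DInt b) t2 tr2 ->
      eval p O env (Op o e1 e2) (DInt (op_val o a b))
        (t1 + t2 + op_cost o a b).+1 (tr1 ++ tr2)
  | ECons env e1 e2 v1 v2 t1 t2 tr1 tr2 :
      eval p O env e1 v1 t1 tr1 ->
      eval p O env e2 v2 t2 tr2 ->
      eval p O env (Cons e1 e2) (DPair v1 v2) (t1 + t2).+1 (tr1 ++ tr2)
  | EFst env e v1 v2 t tr :
      eval p O env e (DPair v1 v2) t tr ->
      eval p O env (Fst e) v1 t.+1 tr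
  | ESnd env e v1 v2 t tr :
      eval p O env e (DPair v1 v2) t tr ->
      eval p O env (Snd e) v2 t.+1 tr
  | EIsPair env e v t tr :
      eval p O env e v t tr ->
      eval p O env (IsPair e) (DInt (if v is DPair _ _ then 1 else 0)) t.+1 tr
  | EIf env e e1 e2 z v t1 t2 tr1 tr2 :
      eval p O env e (DInt z) t1 tr1 ->
      eval p O env (if z != 0 then e1 else e2) v t2 tr2 ->
      eval p O env (If e e1 e2) v (t1 + t2).+1 (tr1 ++ tr2)
  | ELet env e1 e2 v1 v2 t1 t2 tr1 tr2 :
      eval p O env e1 v1 t1 tr1 ->
      eval p O (v1 :: env) e2 v2 t2 tr2 ->
      eval p O env (Let e1 e2) v2 (t1 + t2).+1 (tr1 ++ tr2)
  | ECall env f e v1 v2 t1 t2 tr1 tr2 :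
      (f < size p)%N ->
      eval p O env e v1 t1 tr1 ->
      eval p O [:: v1] (nth (Cst 0) p f) v2 t2 tr2 ->
      eval p O env (Call f e) v2 (t1 + t2).+1 (tr1 ++ tr2)
  | EQuery env e q a c t tr :
      eval p O env e q t tr ->
      O q a c ->
      eval p O env (Query e) a t.+1 (rcons tr (q, c)).

(* Evaluation is deterministic as soon as the external procedure is, so that an
   existential statement about runs is a statement about the only run. *)
Lemma eval_det p O env e v t tr v' t' tr' :
  (forall q a c a' c', O q a c -> O q a' c' -> a = a' /\ c = c') ->
  eval p O env e v t tr -> eval p O env e v' t' tr' ->
  [/\ v = v', t = t' & tr = tr'].
Proof.
move=> HO H; move: v' t' tr'; elim: H => {env e v t tr}.
all: intros; match goal with H : eval _ _ _ _ ?v' _ _ |- context[_ = ?v'] => inversion H; subst; clear H end.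
all: repeat match goal with IH : (forall v t tr, eval _ _ ?env ?e v t tr -> _), H : eval _ _ ?env ?e _ _ _ |- _ => 
  let a := fresh in destruct (IH _ _ _ H) as [a ? ?]; clear IH H; try (injection a; clear a; intros); subst end.
all: try (by split). all: try by (match goal with H1 : O _ _ _, H2 : O _ _ _ |- _ => case: (HO _ _ _ _ _ H1 H2) => -> -> end).
by case: (HO _ _ _ _ _ H1 H6) => -> ->.
Qed.

Definition run (p : program) (O : oracle) (x v : data) (t : nat) (tr : trace) :=
  eval p O [:: x] (nth (Cst 0) p 0) v t tr.

Definition total_time (t : nat) (tr : trace) : nat :=
  (t + \sum_(qc <- tr) qc.2)%N.

(** * Encodings of inputs and outputs *)

Definition enc_list (s : seq data) : data := foldr DPair (DInt 0) s.

Definition enc_bits (b : bitseq) : data :=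
  enc_list [seq DInt (nat_of_bool x)%:Z | x <- b].

Definition enc_rat (q : rat) : data := DPair (DInt (numq q)) (DInt (denq q)).

Definition enc_set n (S : {set 'I_n}) : data :=
  enc_list [seq DInt (nat_of_bool (i \in S))%:Z | i <- enum 'I_n].

(** * Set families and query-weight exact-sum *)

Record set_system := SetSystem {
  ground : nat;
  ground_gt0 : (0 < ground)%N;
  feasible : {set {set 'I_ground}};
  feasible_neq0 : feasible != set0
}.

(* A class of set families, each represented by (at least) one bit string. *)
Definition encoding := bitseq -> option set_system.

Definition enc_query n (w : 'I_n -> int) (target : int) : data :=
  DPair (enc_list [seq DInt (w i) | i <- enum 'I_n]) (DInt target).

Definition magnitude n (w : 'I_n -> int) : nat := \max_(i < n) `|w i|%N.

Definition enc_answer n (r : option {set 'I_n}) : data :=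
  if r is Some T then DPair (DInt 1) (enc_set T) else DInt 0.

Definition exact_sum_answer (F : set_system) (w : 'I_(ground F) -> int)
    (target : int) (r : option {set 'I_(ground F)}) : Prop :=
  match r with
  | Some T => T \in feasible F /\ \sum_(i in T) w i = target
  | None => forall S, S \in feasible F -> \sum_(i in S) w i <> target
  end.

Definition exact_sum_input (code : bitseq) (query : data) : data :=
  DPair (enc_bits code) query.

(* [Q] solves query-weight exact-sum on the families encoded by [D] in time
   poly(length of the code) * M^O(1); [maxn 1 _] is there for zero weights. *)
Definition exact_sum_solver (D : encoding) (Q : program) : Prop :=
  exists c : nat,
  forall (code : bitseq) (F : set_system), D code = Some F ->
  forall (w : 'I_(ground F) -> int) (target : int),
  exists (r : option {set 'I_(ground F)}) (t : nat),
    [/\ run Q no_oracle (exact_sum_input code (enc_query w target))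
          (enc_answer r) t [::],
        exact_sum_answer w target r
      & (t <= c * (size code).+1 ^ c * maxn 1 (magnitude w) ^ c)%N].

(* A query runs [Q] on the family encoded by [code]. *)
Definition solver_oracle (Q : program) (code : bitseq) : oracle :=
  fun q a c => run Q no_oracle (exact_sum_input code q) a c [::].

(** * Independent discrete random variables and Top_k *)

(* The list of the pairs (atom, mass). *)
Definition law := seq (rat * rat).

Definition is_law (l : law) : Prop :=
  all (fun a => (0 <= a.1) && (0 <= a.2)) l /\ \sum_(a <- l) a.2 = 1.

Section TopK.
Variables (n : nat) (X : 'I_n -> law).

(* The X_i are realized on the product space, whose points choose one atom for
   each i and whose probability is the product of the masses. *)
Definition outcome := {dffun forall i : 'I_n, 'I_(size (X i))}.

Definition value (o : outcome) (i : 'I_n) : rat := (nth (0, 0) (X i) (o i)).1.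

Definition prob (o : outcome) : rat :=
  \prod_(i < n) (nth (0, 0) (X i) (o i)).2.

Definition expectation (f : outcome -> rat) : rat :=
  \sum_(o : outcome) prob o * f o.

Definition topk (k : nat) (S : {set 'I_n}) (o : outcome) : rat :=
  \sum_(x <- take k (sort >=%R [seq value o i | i in S])) x.

Definition ETop (k : nat) (S : {set 'I_n}) : rat := expectation (topk k S).

Definition enc_law (l : law) : data :=
  enc_list [seq DPair (enc_rat a.1) (enc_rat a.2) | a <- l].

Definition enc_laws : data := enc_list [seq enc_law (X i) | i <- enum 'I_n].

Definition enc_params (k : nat) (eps : rat) : data :=
  DPair enc_laws (DPair (DInt k%:Z) (enc_rat eps)).

End TopK.

(* The minimum is attained, as [feasible F] is nonempty; [set0] is a mere default. *)
Definition OPTmin (F : set_system) (X : 'I_(ground F) -> law) (k : nat) : rat :=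
  ETop X k [arg min_(S < odflt set0 [pick S in feasible F] in feasible F)
              ETop X k S]%O.

Definition ptas_input (code : bitseq) n (X : 'I_n -> law) (k : nat)
    (eps : rat) : data :=
  DPair (enc_bits code) (enc_params X k eps).

(* Main.v *)
(* Scale the atoms to integers.  By layer cake, E[Top_k(S)] is the sum over the layers c
   of E min(k, N_c), where N_c counts the i in S with X_i > c.  Let m be about 1/eps and
   let B be such that k m B is the optimum up to a factor 2; a multiple b E[X_i] with
   b <= n will do, so that the right scale is among n (n + 1) candidates.

   If k is at least of order m^2, then E min(k, N) is (1 - 1/m) min(k, E N) at least, so
   that for one of O(m) thresholds c = l B the optimum is almost
   k c + sum_{i in S} E (X_i - c)^+.  The sum is additive in S: round it to multiples of
   k B / n and query each of its O(n m) possible values.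

   If k = O(m^2), then the k m^2 thresholds l B suffice.  At each of them, E min(k, N) is
   determined, up to a small error, by the first O(m^2) power sums of the probabilities
   P(X_i > l B), i in S: it is a linear form in their elementary symmetric functions,
   whose tail is negligible unless E N is so large that E min(k, N) is almost k, and
   which are stable by Newton's identities.  The power sums are additive in S: round them
   and pack them in mixed radix with the sum of the E (X_i - c)^+, at the last threshold c,
   in O(k m^4) = O(m^6) digits.

   In both cases the answers are compared by an upper bound on E[Top_k] that holds for
   every set and that is almost tight for the right guess of B, of the threshold and of
   the target, so that no guess has to be certified. *)

Require Import Defs.
From Stdlib Require List.
From mathcomp Require Import all_boot all_order all_algebra.
From mathcomp Require Import zify ring lra.

Set Implicit Arguments.
Unset Strict Implicit.
Unset Printing Implicit Defensive.

Import Order.TTheory GRing.Theory Num.Theory.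

Local Open Scope ring_scope.

(** With [D] the product of all denominators, atoms and masses become integers, and the atoms are
    multiplied further by [D * k * m]. In these units the mean of an item is [k * m] times an
    integer, so that [k * m * B] can be made equal to a multiple of it with [B] an integer. A
    suitable multiple exists because the value of a set lies between the largest mean of its items
    and n times that mean.

    Errors are counted in units of [k * B], each at most [2 / m] of the optimum: at most three units
    are lost, besides one relative loss of [2 / m], whence the factor [1 + 8 / m].

    The solver may return any set with the requested sum, so the weights have to pin down everything
    on which the value depends. In mixed radix the digit sums never carry, and n enters only through
    the base [n * (n * gran m) + 1]: the granularity [gran m] depends on m alone and there are
    [O(m ^ 6)] digits. This is the origin of the exponent [1 / eps ^ 6] of n.

    All scores are integers with the common factor [D ^ n.+1], so that comparing them is exact. *)

Local Notation Cons := Defs.Cons.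
Local Notation Sub := Defs.Sub.

(** * Sums of independent Bernoulli variables *)

Section PoissonBinomial.
Variable R : realFieldType.
Implicit Types (ps : seq R) (f g : nat -> R).

(* E f(j + N) for N a sum of independent Bernoulli variables of parameters [ps]. *)
Fixpoint pbin ps f (j : nat) : R :=
  if ps is p :: ps' then p * pbin ps' f j.+1 + (1 - p) * pbin ps' f j else f j.

Definition psum (r : nat) ps : R := \sum_(p <- ps) p ^+ r.

Definition probs ps := all (fun p => (0 <= p) && (p <= 1)) ps.

Lemma pbin_cst ps (c : R) j : pbin ps (fun=> c) j = c.
Proof. by elim: ps j => //= p ps IH j; rewrite !IH; ring. Qed.

Lemma pbin_mono ps f g j : probs ps -> (forall x, f x <= g x) ->
  pbin ps f j <= pbin ps g j.
Proof.
move=> + fg; elim: ps j => //= p ps IH j /andP[/andP[p0 p1] /IH{}IH].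
by rewrite lerD // ler_wpM2l // subr_ge0.
Qed.

Lemma pbin_ext ps f g j : (forall x, f x = g x) -> pbin ps f j = pbin ps g j.
Proof. by move=> fg; elim: ps j => //= p ps IH j; rewrite !IH. Qed.

Lemma psum0 r : psum r [::] = 0.
Proof. by rewrite /psum big_nil. Qed.

Lemma psum_cons r p ps : psum r (p :: ps) = p ^+ r + psum r ps.
Proof. by rewrite /psum big_cons. Qed.

Lemma psum_ge0 r ps : probs ps -> 0 <= psum r ps.
Proof.
elim: ps => [|p ps IH]; rewrite ?psum0 // psum_cons => /= /andP[/andP[p0 _] /IH].
by have := exprn_ge0 r p0; lra.
Qed.

Lemma psum_le r ps : probs ps -> psum r.+1 ps <= psum 1 ps.
Proof.
elim: ps => [|p ps IH]; rewrite ?psum0 // !psum_cons => /= /andP[/andP[p0 p1] /IH].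
by move=> H; rewrite lerD // expr1 exprS ler_piMr // exprn_ile1.
Qed.

Lemma pbin_mean ps j : pbin ps (fun x => x%:R) j = j%:R + psum 1 ps.
Proof.
elim: ps j => /= [|p ps IH] j; rewrite ?psum0 ?psum_cons ?addr0 // !IH.
by rewrite -[j.+1]addn1 natrD; ring.
Qed.

(** Moments up to order three, through the mean, the variance [psum 1 - psum 2] and the third
    cumulant. They evaluate the polynomial minorants of [minn k] used below. *)
Lemma pbin_cubic ps (a b c d : R) j :
  pbin ps (fun x => a + b * x%:R + c * x%:R ^+ 2 + d * x%:R ^+ 3) j =
  a + b * (j%:R + psum 1 ps) + c * ((j%:R + psum 1 ps) ^+ 2 + psum 1 ps - psum 2 ps)
  + d * ((j%:R + psum 1 ps) ^+ 3 + 3 * (j%:R + psum 1 ps) * (psum 1 ps - psum 2 ps)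
  + (psum 1 ps - 3 * psum 2 ps + 2 * psum 3 ps)).
Proof.
elim: ps j => /= [|p ps IH] j; rewrite ?psum0 ?psum_cons; first by ring.
by rewrite !IH -[j.+1]addn1 natrD; ring.
Qed.

(** * Lower bounds on the expectation of min(k, N) *)

Definition emin k ps : R := pbin ps (fun x => (minn k x)%:R) 0.

Lemma emin_le k ps : probs ps -> emin k ps <= k%:R.
Proof.
move=> H; rewrite -[leRHS](pbin_cst ps _ 0); apply: pbin_mono => // x.
by rewrite ler_nat geq_minl.
Qed.

Lemma emin_ge0 k ps : probs ps -> 0 <= emin k ps.
Proof.
by move=> H; rewrite -(pbin_cst ps 0 0); apply: pbin_mono => // x.
Qed.

Lemma emin_le_mean k ps : probs ps -> emin k ps <= psum 1 ps.
Proof.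
move=> H; rewrite -[leRHS]add0r -(pbin_mean ps 0); apply: pbin_mono => // x.
by rewrite ler_nat geq_minr.
Qed.

(** With [u] the relative deficit of N from its mean, [minn k x] is at least [k * (1 - u)] when
    [x < k], and [u] is at most [u ^ 2 / (2 * d) + d / 2]. The expectation of [u ^ 2] is a variance
    over a squared mean, hence at most the inverse of the mean. *)
Lemma emin_gt_mean k ps (d : R) : probs ps -> k%:R <= psum 1 ps -> 0 < psum 1 ps -> 0 < d ->
  k%:R * (1 - ((psum 1 ps * d)^-1 + d) / 2) <= emin k ps.
Proof.
move=> H kl l0 d0; set l := psum 1 ps.
have Hpt (x : nat) : k%:R * (1 - ((l - x%:R) / l) ^+ 2 / (2 * d) - d / 2) <= (minn k x)%:R.
  set u := (l - x%:R) / l.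
  have Hu : u ^+ 2 / (2 * d) + d / 2 - u = (u - d) ^+ 2 / (2 * d).
    by field; rewrite gt_eqF.
  have Hu0 : 0 <= (u - d) ^+ 2 / (2 * d).
    by rewrite divr_ge0 ?sqr_ge0 // mulr_ge0 // ltW.
  have k0 : 0 <= k%:R :> R by [].
  have [kx|xk] := leqP k x.
    have : 0 <= u ^+ 2 / (2 * d) by rewrite divr_ge0 ?sqr_ge0 // mulr_ge0 // ltW.
    by move=> Hu2; rewrite ler_piMr //; lra.
  have : k%:R * (1 - u) <= x%:R :> R.
    have -> : 1 - u = x%:R / l by rewrite /u; field; rewrite gt_eqF.
    by rewrite mulrA ler_pdivrMr // mulrC ler_wpM2l.
  by apply: le_trans; rewrite ler_wpM2l //; lra.
apply: le_trans (pbin_mono 0 H Hpt).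
have E (x : nat) : k%:R * (1 - ((l - x%:R) / l) ^+ 2 / (2 * d) - d / 2) =
    k%:R * (1 - d / 2 - 1 / (2 * d)) + (k%:R / (d * l)) * x%:R
    + (- (k%:R / (2 * d * l ^+ 2))) * x%:R ^+ 2 + 0 * x%:R ^+ 3.
  by field; rewrite !gt_eqF.
rewrite (pbin_ext _ _ E) pbin_cubic add0r -/l.
rewrite -subr_ge0 [X in 0 <= X](_ : _ = k%:R * psum 2 ps / (2 * d * l ^+ 2)); last first.
  by field; rewrite !gt_eqF.
by rewrite divr_ge0 ?mulr_ge0 ?psum_ge0 ?sqr_ge0 // ltW.
Qed.

(** For [x >= k], the loss [x - k] is at most [x * (x - k) / k], and [x - k] is at most
    [((x - l) ^ 2 / a + a) / 2], as [l <= k]. Keeping the factor [x] costs a third moment, but makes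
    the error proportional to the mean, which may be tiny. *)
Lemma emin_lt_mean k ps (a : R) : probs ps -> psum 1 ps <= k%:R -> (0 < k)%N -> 0 < a ->
  psum 1 ps * (1 - ((k%:R + 1) / a + a) / (2 * k%:R)) <= emin k ps.
Proof.
move=> H lk k0 a0; set l := psum 1 ps in lk *.
have k0' : 0 < k%:R :> R by rewrite ltr0n.
have l0 : 0 <= l by apply: psum_ge0.
have Hpt (x : nat) : x%:R - x%:R * ((x%:R - l) ^+ 2 / a + a) / (2 * k%:R) <= (minn k x)%:R.
  have x0 : 0 <= x%:R :> R by [].
  have Hq : 0 <= (x%:R - l) ^+ 2 / a + a.
    by apply: addr_ge0; rewrite ?divr_ge0 ?sqr_ge0 // ltW.
  have [kx|xk] := leqP k x; last first.
    by rewrite gerBl; apply: divr_ge0; apply: mulr_ge0.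
  rewrite lerBlDr -lerBlDl.
  have kx' : k%:R <= x%:R :> R by rewrite ler_nat.
  apply: (@le_trans _ _ (x%:R * (x%:R - k%:R) / k%:R)).
    by rewrite ler_pdivlMr // mulrC ler_wpM2r // subr_ge0.
  have -> : x%:R * ((x%:R - l) ^+ 2 / a + a) / (2 * k%:R)
      = x%:R * (((x%:R - l) ^+ 2 / a + a) / 2) / k%:R by field; rewrite !gt_eqF.
  rewrite ler_wpM2r ?invr_ge0 ?(ltW k0') // ler_wpM2l // ler_pdivlMr //.
  have -> : (x%:R - l) ^+ 2 / a + a = ((x%:R - l - a) ^+ 2 / a) + 2 * (x%:R - l).
    by field; rewrite gt_eqF.
  have : 0 <= (x%:R - l - a) ^+ 2 / a by rewrite divr_ge0 ?sqr_ge0 // ltW.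
  lra.
apply: le_trans (pbin_mono 0 H Hpt).
have E (x : nat) : x%:R - x%:R * ((x%:R - l) ^+ 2 / a + a) / (2 * k%:R) =
    0 + (1 - (l ^+ 2 / a + a) / (2 * k%:R)) * x%:R
    + (l / (a * k%:R)) * x%:R ^+ 2 + (- (1 / (2 * a * k%:R))) * x%:R ^+ 3.
  by field; rewrite !gt_eqF.
rewrite (pbin_ext _ _ E) pbin_cubic !add0r -/l.
rewrite -subr_ge0 [X in 0 <= X](_ : _ =
  (l * (k%:R - l) + l * psum 2 ps + 3 * psum 2 ps - 2 * psum 3 ps) / (2 * a * k%:R)); last first.
  by field; rewrite !gt_eqF.
have s2 : 0 <= psum 2 ps by apply: psum_ge0.
have s32 : psum 3 ps <= psum 2 ps.
  elim: (ps) H => [|p q IH]; rewrite ?psum0 // !psum_cons => /= /andP[/andP[p0 p1] /IH].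
  by move=> ?; rewrite lerD // exprS ler_piMl ?exprn_ge0.
have h1 : 0 <= l * (k%:R - l) by rewrite mulr_ge0 // subr_ge0.
have h2 : 0 <= l * psum 2 ps by rewrite mulr_ge0.
by rewrite divr_ge0 ?mulr_ge0 //; first lra; rewrite ltW.
Qed.

(** The probability [q] of [N > 0] is at most [emin k ps], and [1 - q], a product of factors
    [1 - p], is at most [1 / (1 + psum 1 ps)]. Hence [q] alone reaches [psum 1 ps * (1 - q)]. *)
Lemma emin_ge_mean1 k ps (t : R) : probs ps -> (0 < k)%N -> emin k ps <= t ->
  psum 1 ps * (1 - t) <= emin k ps.
Proof.
move=> H k0 kt; set q := pbin ps (fun x => (0 < x)%:R) 0.
have q_emin : q <= emin k ps.
  by apply: pbin_mono => // x; rewrite ler_nat; case: x => //= x; rewrite leq_min k0.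
have [q0 ql] : 0 <= q <= 1 /\ (1 + psum 1 ps) * (1 - q) <= 1.
  rewrite /q {q_emin q kt}.
  have H1 ps' j : pbin ps' (fun x => (0 < x)%:R) j.+1 = 1.
    by elim: ps' j => //= p ps' IH j; rewrite !IH; ring.
  elim: ps H => [|p ps IH] /=; first by rewrite psum0; split; lra.
  case/andP=> /andP[p0 p1] /[dup] Hps /IH[/andP[q0 q1] Hq].
  rewrite H1 psum_cons expr1; set q := pbin _ _ _ in Hq q0 q1 *.
  have s0 := psum_ge0 1 Hps; split; first by apply/andP; split; nra.
  apply: le_trans Hq.
  have -> : 1 - (p * 1 + (1 - p) * q) = (1 - p) * (1 - q) by ring.
  rewrite mulrA ler_wpM2r ?subr_ge0 //.
  by have := mulr_ge0 p0 s0; have := sqr_ge0 p; nra.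
have s0 := psum_ge0 1 H.
have : psum 1 ps * (1 - t) <= psum 1 ps * (1 - q) by rewrite ler_wpM2l //; lra.
lra.
Qed.

(** The free parameters of the two bounds are [d = 1 / m] when the mean is at least k and
    [a = k / m] otherwise; the terms in [m / k] are then at most [1 / (4 * m)]. *)
Lemma emin_frac m k ps : probs ps -> (0 < m)%N -> (4 * m ^ 2 <= k)%N ->
  (1 - m%:R^-1) * Num.min k%:R (psum 1 ps) <= emin k ps.
Proof.
move=> H m0 mk; have s0 := psum_ge0 1 H.
have m0' : 0 < m%:R :> R by rewrite ltr0n.
have m1 : 1 <= m%:R :> R by rewrite ler1n.
have k0 : (0 < k)%N by apply: leq_trans mk; rewrite muln_gt0 expn_gt0 m0.
have k0' : 0 < k%:R :> R by rewrite ltr0n.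
have mk' : 4 * m%:R ^+ 2 <= k%:R :> R by rewrite -natrX -natrM ler_nat.
have mk1 : m%:R / k%:R <= m%:R^-1 / 4 :> R.
  rewrite ler_pdivrMr // (_ : m%:R^-1 / 4 * k%:R = k%:R / (4 * m%:R)); last by field; rewrite gt_eqF.
  by rewrite ler_pdivlMr ?mulr_gt0 //; move: mk'; rewrite expr2; lra.
have mi : 0 < m%:R^-1 :> R by rewrite invr_gt0.
case: (lerP k%:R (psum 1 ps)) => kl.
  have l0 : 0 < psum 1 ps by lra.
  apply: le_trans (emin_gt_mean H kl l0 mi); rewrite mulrC ler_wpM2l ?(ltW k0') //.
  have -> : (psum 1 ps * m%:R^-1)^-1 = m%:R / psum 1 ps by field; rewrite !gt_eqF.
  have : m%:R / psum 1 ps <= m%:R / k%:R by rewrite ler_wpM2l ?(ltW m0') // lef_pV2.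
  lra.
have a0 : 0 < k%:R / m%:R :> R by rewrite divr_gt0.
apply: le_trans (emin_lt_mean H (ltW kl) k0 a0); rewrite mulrC ler_wpM2l //.
have -> : ((k%:R + 1) / (k%:R / m%:R) + k%:R / m%:R) / (2 * k%:R) =
   m%:R / k%:R / 2 + m%:R / k%:R * k%:R^-1 / 2 + m%:R^-1 / 2 :> R by field; rewrite !gt_eqF.
have : m%:R / k%:R * k%:R^-1 <= m%:R / k%:R :> R.
  by rewrite ler_piMr ?divr_ge0 // invf_le1 // ler1n.
lra.
Qed.

(** Here k may be small: concentration comes from a mean of at least [m ^ 2], again with
    [d = 1 / m]. *)
Lemma emin_sat m k ps : probs ps -> (0 < m)%N -> k%:R <= psum 1 ps ->
  (m ^ 2)%:R <= psum 1 ps -> (1 - m%:R^-1) * k%:R <= emin k ps.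
Proof.
move=> H m0 kl ml.
have m0' : 0 < m%:R :> R by rewrite ltr0n.
have mi : 0 < m%:R^-1 :> R by rewrite invr_gt0.
have l0 : 0 < psum 1 ps by apply: lt_le_trans ml; rewrite ltr0n expn_gt0 m0.
apply: le_trans (emin_gt_mean H kl l0 mi); rewrite mulrC ler_wpM2l //.
have -> : (psum 1 ps * m%:R^-1)^-1 = m%:R / psum 1 ps by field; rewrite !gt_eqF.
have : m%:R / psum 1 ps <= m%:R^-1.
  rewrite ler_pdivrMr // mulrC ler_pdivlMr //; move: ml; rewrite natrX expr2; lra.
lra.
Qed.

(** * Elementary symmetric functions, power sums and stability *)

Fixpoint elem_sym ps (r : nat) : R :=
  match ps, r with
  | _, 0 => 1
  | [::], _.+1 => 0
  | p :: ps', r'.+1 => elem_sym ps' r'.+1 + p * elem_sym ps' r'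
  end.

Fixpoint fdiff (r : nat) f (j : nat) : R :=
  if r is r'.+1 then fdiff r' f j.+1 - fdiff r' f j else f j.

Lemma fdiffSr r f j : fdiff r (fdiff 1 f) j = fdiff r.+1 f j.
Proof. by elim: r j => //= r IH j; rewrite !IH. Qed.

Lemma elem_sym0 ps : elem_sym ps 0 = 1.
Proof. by case: ps. Qed.

(** Newton's forward difference expansion: [elem_sym ps r] is the binomial moment of order r of N.
    One more variable of parameter p adds p times the expectation of the first difference of [f]. *)
Lemma pbin_fdiff ps f j N : (size ps <= N)%N ->
  pbin ps f j = \sum_(r < N.+1) elem_sym ps r * fdiff r f j.
Proof.
elim: ps N f j => [|p ps IH] N f j /= HN.
  rewrite big_ord_recl /= big1 ?addr0 ?mul1r // => i _.
  by rewrite mul0r.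
case: N HN => // N HN.
have -> : p * pbin ps f j.+1 + (1 - p) * pbin ps f j
   = pbin ps f j + p * pbin ps (fdiff 1 f) j.
  have -> : pbin ps (fdiff 1 f) j = pbin ps f j.+1 - pbin ps f j; last by ring.
  clear; elim: ps j => //= p ps IH j; rewrite !IH; ring.
rewrite (IH N.+1 f) ?leqW // (IH N (fdiff 1 f)) //.
rewrite big_ord_recl [in RHS]big_ord_recl /= !elem_sym0 -addrA; congr (_ + _).
rewrite mulr_sumr -big_split /=; apply: eq_bigr => i _.
rewrite /bump /= add1n mulrDl -mulrA; congr (_ + _ * (_ * _)).
exact: (fdiffSr i f j).
Qed.

Lemma fdiff_bound f (K : R) : (forall x, 0 <= f x <= K) ->
  forall r j, `|fdiff r f j| <= 2 ^+ r * K.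
Proof.
move=> H; elim=> [|r IH] j /=.
  by have /andP[? ?] := H j; rewrite ger0_norm // mul1r.
rewrite exprS (le_trans (ler_normB _ _)) //.
by have := IH j; have := IH j.+1; lra.
Qed.

Lemma elem_sym_ge0 ps r : probs ps -> 0 <= elem_sym ps r.
Proof.
elim: ps r => [|p ps IH] [|r] //= /andP[/andP[p0 p1] H].
by rewrite addr_ge0 ?mulr_ge0 ?IH.
Qed.

(** The product [psum 1 ps * elem_sym ps r] contains each product of [r.+1] distinct entries [r.+1]
    times; the other terms repeat an entry and are nonnegative. *)
Lemma elem_symS_le ps r : probs ps -> r.+1%:R * elem_sym ps r.+1 <= psum 1 ps * elem_sym ps r.
Proof.
elim: ps r => [|p ps IH] r; first by rewrite psum0 /= mulr0 mul0r.
rewrite [probs _]/= => /andP[/andP[p0 p1] H].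
rewrite psum_cons expr1; case: r => [|r].
  have := IH 0 H; rewrite /= !elem_sym0 !mulr1 !mul1r; lra.
have h1 := IH r.+1 H; have h2 := IH r H.
have e1 := elem_sym_ge0 r H; rewrite /=.
have : p * (r.+1%:R * elem_sym ps r.+1) <= p * (psum 1 ps * elem_sym ps r) by rewrite ler_wpM2l.
move: h1; rewrite -[r.+2]addn1 natrD.
have : 0 <= p * (p * elem_sym ps r) by rewrite !mulr_ge0.
by lra.
Qed.

Lemma elem_sym_le ps r : probs ps -> elem_sym ps r <= psum 1 ps ^+ r / r`!%:R.
Proof.
move=> H; elim: r => [|r IH]; first by rewrite elem_sym0 expr0 fact0 divr1.
rewrite ler_pdivlMr ?ltr0n ?fact_gt0 // factS natrM mulrCA mulrA exprS.
have := elem_symS_le r H; have e0 := psum_ge0 1 H.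
have f0 : 0 < r`!%:R :> R by rewrite ltr0n fact_gt0.
move: IH; rewrite ler_pdivlMr // => IH.
have := ler_wpM2l e0 IH.
move=> h1 h2; apply: le_trans h1; rewrite mulrA.
by rewrite [leLHS](_ : _ = r.+1%:R * elem_sym ps r.+1 * r`!%:R) ?ler_wpM2r // ?ltW //; ring.
Qed.

(** Newton's identities. A new entry [p] contributes p times the identity one degree below and a sum
    in the powers of [p] that telescopes to one term. *)
Lemma newton ps r :
  r%:R * elem_sym ps r = \sum_(i < r) (-1) ^+ i * elem_sym ps (r - i.+1) * psum i.+1 ps.
Proof.
elim: ps r => [|p ps IH] [|r].
- by rewrite big_ord0 mul0r.
- by rewrite mulr0 big1 // => i _; rewrite psum0 mulr0.
- by rewrite big_ord0 mul0r.
(* The elementary symmetric functions shifted by one degree, with value 0 in degree -1. *)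
pose em j := if j is j'.+1 then elem_sym ps j' else 0.
have eE j : elem_sym (p :: ps) j = elem_sym ps j + p * em j.
  by case: j => [|j] //=; rewrite elem_sym0 mulr0 addr0.
have tele q : \sum_(i < q.+1) (-1) ^+ i * p ^+ i.+1 * (elem_sym ps (q - i) + p * em (q - i)%N)
   = p * elem_sym ps q.
  elim: q => [|q IHq]; first by rewrite big_ord_recl big_ord0 /= elem_sym0; ring.
  rewrite big_ord_recl subn0 (eq_bigr (fun i : 'I_q.+1 => (- p) * ((-1) ^+ i * p ^+ i.+1 *
     (elem_sym ps (q - i) + p * em (q - i)%N)))); last first.
    by move=> i _; rewrite /= /bump /= add1n subSS !exprS; ring.
  by rewrite -mulr_sumr IHq /=; ring.
have E2 : \sum_(i < r.+1) (-1) ^+ i * em (r - i)%N * psum i.+1 ps = r%:R * elem_sym ps r.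
  rewrite big_ord_recr /= subnn /= mulr0 mul0r addr0 IH.
  apply: eq_bigr => i _; congr (_ * _ * _).
  by rewrite /em subnS; have := ltn_ord i; rewrite -subn_gt0; case: (r - i)%N.
rewrite (eq_bigr (fun i : 'I_r.+1 => (-1) ^+ i * elem_sym ps (r.+1 - i.+1) * psum i.+1 ps
   + (p * ((-1) ^+ i * em (r - i)%N * psum i.+1 ps)
   + (-1) ^+ i * p ^+ i.+1 * (elem_sym ps (r - i) + p * em (r - i)%N)))); last first.
  by move=> i _; rewrite subSS eE psum_cons; ring.
rewrite !big_split /= -mulr_sumr E2 tele -IH -[r.+1]addn1 natrD.
by rewrite addn1 /=; ring.
Qed.

(** Induction through Newton's identities: in each term an earlier error is multiplied by a power
    sum of at most L, and an error d by an elementary function of at most [L ^ j]. The factor [r.+1]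
    on the left pays for the number of terms. *)
Lemma elem_sym_stable ps qs (L d : R) N : probs ps -> probs qs -> 1 <= L ->
  psum 1 ps <= L -> psum 1 qs <= L -> 0 <= d ->
  (forall r, (0 < r <= N)%N -> `|psum r ps - psum r qs| <= d) ->
  forall r, (r <= N)%N -> `|elem_sym ps r - elem_sym qs r| <= (2 * L) ^+ r * d.
Proof.
move=> Hp Hq L1 pL qL d0 Hd; elim/ltn_ind=> -[|r] IH rN.
  by rewrite !elem_sym0 subrr normr0 mulr_ge0 // exprn_ge0 // mulr_ge0 // (le_trans ler01).
have L0 : 0 < L by lra.
have r0 : 0 < r.+1%:R :> R by [].
have eL j : elem_sym qs j <= L ^+ j.
  apply: le_trans (elem_sym_le j Hq) _; rewrite ler_pdivrMr ?ltr0n ?fact_gt0 //.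
  rewrite -[leLHS]mulr1; apply: ler_pM; rewrite ?exprn_ge0 ?psum_ge0 ?ler1n ?fact_gt0 //.
  by apply: lerXn2r; rewrite ?nnegrE ?psum_ge0 ?(ltW L0).
rewrite -(ler_pM2l r0) -[X in X * `|_|]ger0_norm ?(ltW r0) // -normrM mulrBr !newton -sumrB.
apply: le_trans (ler_norm_sum _ _ _) _.
have -> : r.+1%:R * ((2 * L) ^+ r.+1 * d) = \sum_(i < r.+1) (2 * L) ^+ r.+1 * d.
  by rewrite big_const_ord iter_addr_0 mulr_natl.
apply: ler_sum => i _.
rewrite -!mulrA -mulrBr normrM normrX normrN1 expr1n mul1r.
have jr : (r.+1 - i.+1 <= r)%N by rewrite subSS leq_subr.
set j := (r.+1 - i.+1)%N in jr *.
have -> : elem_sym ps j * psum i.+1 ps - elem_sym qs j * psum i.+1 qs =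
  (elem_sym ps j - elem_sym qs j) * psum i.+1 ps + elem_sym qs j * (psum i.+1 ps - psum i.+1 qs) by ring.
apply: le_trans (ler_normD _ _) _; rewrite !normrM.
have h1 : `|elem_sym ps j - elem_sym qs j| <= (2 * L) ^+ j * d by apply: IH => //; lia.
have h2 : `|psum i.+1 ps| <= L.
  by rewrite ger0_norm ?psum_ge0 // (le_trans (psum_le i Hp)).
have h3 : `|elem_sym qs j| <= (2 * L) ^+ j.
  rewrite ger0_norm ?elem_sym_ge0 // (le_trans (eL j)) //; apply: lerXn2r; rewrite ?nnegrE; lra.
have h4 : `|psum i.+1 ps - psum i.+1 qs| <= d by apply: Hd; rewrite /= (leq_trans (ltn_ord i)).
have h5 : (2 * L) ^+ j.+1 <= (2 * L) ^+ r.+1 by apply: ler_weXn2l => //; lra.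
have h6 : 0 <= (2 * L) ^+ j by apply: exprn_ge0; lra.
apply: (@le_trans _ _ ((2 * L) ^+ j * d * L + (2 * L) ^+ j * d)).
  by apply: lerD; apply: ler_pM.
apply: (@le_trans _ _ ((2 * L) ^+ j.+1 * d)); last by rewrite ler_wpM2r.
rewrite exprS; have : 0 <= (2 * L) ^+ j * d * (L - 1) by rewrite !mulr_ge0 //; lra.
lra.
Qed.

(** The falling factorial of [r + r] of length r dominates [r ^ r] and equals a binomial coefficient
    of row [2 * r], at most [4 ^ r], times [r!]. *)
Lemma expnn_le_fact r : (r ^ r <= 4 ^ r * r`!)%N.
Proof.
apply: (@leq_trans ((r + r) ^_ r)).
  have H q : (q <= r)%N -> (r ^ q <= (r + r) ^_ q)%N.
    elim: q => [|q IH] qr; first by rewrite ffactn0.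
    by rewrite ffactnSr expnSr leq_mul ?IH ?(ltnW qr) // -addnBA ?leq_addr // ltnW.
  exact: H.
rewrite -bin_ffact leq_mul2r; apply/orP; right.
have -> : (4 ^ r = 2 ^ (r + r))%N by rewrite expnD -expnMn.
rewrite -[2%N]/(1 + 1)%N expnDn.
have rr : (r < (r + r).+1)%N by lia.
by rewrite (bigD1 (Ordinal rr)) //= !exp1n !muln1 leq_addr.
Qed.

(** By [L ^ r / r!] and the bound on factorials, the left side is at most [(8 * L / r) ^ r]; the
    constant 32 makes this base at most 1/4. *)
Lemma elem_sym_tail ps (L r : nat) : probs ps -> psum 1 ps <= L%:R -> (32 * L <= r)%N -> (0 < r)%N ->
  2 ^+ r * elem_sym ps r <= (4^-1) ^+ r.
Proof.
move=> H pL Lr r0.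
have rr : 0 < (r%:R : R) ^+ r by rewrite exprn_gt0 // ltr0n.
apply: (@le_trans _ _ (2 ^+ r * (L%:R ^+ r / r`!%:R))).
  rewrite ler_wpM2l ?exprn_ge0 //; apply: le_trans (elem_sym_le _ H) _.
  rewrite ler_wpM2r ?invr_ge0 //; apply: lerXn2r; rewrite ?nnegrE ?psum_ge0 //.
apply: (@le_trans _ _ (2 ^+ r * (L%:R ^+ r * (4 ^+ r / r%:R ^+ r)))).
  rewrite ler_wpM2l ?exprn_ge0 // ler_wpM2l ?exprn_ge0 //.
  rewrite ler_pdivlMr // ler_pdivrMl ?ltr0n ?fact_gt0 // mulrC.
  by rewrite -!natrX -natrM ler_nat expnn_le_fact.
have -> : 2 ^+ r * (L%:R ^+ r * (4 ^+ r / r%:R ^+ r)) = (2 * L%:R * 4 / r%:R) ^+ r :> R.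
  by rewrite expr_div_n !exprMn !mulrA.
apply: lerXn2r; rewrite ?nnegrE ?invr_ge0 ?divr_ge0 ?mulr_ge0 //.
rewrite ler_pdivrMr ?ltr0n //.
have : (32 * L)%:R <= r%:R :> R by rewrite ler_nat.
by rewrite natrM; lra.
Qed.

Let quarter_ge0 n : 0 <= (4^-1 : R) ^+ n.
Proof. by apply: exprn_ge0; rewrite invr_ge0. Qed.

Lemma geom_tail N M : \sum_(N <= r < M) (4^-1 : R) ^+ r <= 2 * 4^-1 ^+ N.
Proof.
have [NM|/ltnW MN] := leqP N M; last by rewrite big_geq // mulr_ge0 // quarter_ge0.
suff : \sum_(N <= r < M) (4^-1 : R) ^+ r <= 2 * 4^-1 ^+ N - 2 * 4^-1 ^+ M.
  by move/le_trans; apply; rewrite gerBl mulr_ge0 // quarter_ge0.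
elim: M NM => [|M IH]; first by rewrite leqn0 => /eqP->; rewrite big_geq //; lra.
rewrite leq_eqVlt => /orP[/eqP->|NM].
  by rewrite big_geq //; have := quarter_ge0 M.+1; lra.
rewrite big_nat_recr //=; have := IH NM; rewrite [_ ^+ M.+1]exprS.
have : 0 <= (4^-1 : R) ^+ M by apply: quarter_ge0.
lra.
Qed.

(** The difference expansions are cut at order [32 * L]. Up to there the size [2 ^ r] of the
    differences and the stability factor [(2 * L) ^ r] combine into [(4 * L) ^ r]; beyond, both
    expansions have geometric tails, whatever their higher power sums. *)
Lemma pbin_stable ps qs f (K d : R) (L : nat) : probs ps -> probs qs -> (0 < L)%N ->
  psum 1 ps <= L%:R -> psum 1 qs <= L%:R -> 0 <= d ->
  (forall r, (0 < r <= 32 * L)%N -> `|psum r ps - psum r qs| <= d) ->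
  (forall x, 0 <= f x <= K) ->
  `|pbin ps f 0 - pbin qs f 0| <=
     K * ((32 * L).+1%:R * (4 * L%:R) ^+ (32 * L) * d + 4 * 4^-1 ^+ (32 * L)).
Proof.
move=> Hp Hq L0 pL qL d0 Hd Hf.
have K0 : 0 <= K by have /andP[] := Hf 0; apply: le_trans.
set N := (32 * L)%N in Hd *.
set M := (maxn (size ps) (size qs) + N)%N.
have L1 : 1 <= L%:R :> R by rewrite ler1n.
rewrite (@pbin_fdiff ps _ _ M) ?(@pbin_fdiff qs _ _ M); try by rewrite /M; lia.
rewrite -sumrB; apply: le_trans (ler_norm_sum _ _ _) _.
rewrite -(big_mkord xpredT (fun i => `|elem_sym ps i * fdiff i f 0 - elem_sym qs i * fdiff i f 0|)).
rewrite (big_cat_nat (n := N.+1)) //=; last by rewrite /M; lia.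
have Ht r : `|elem_sym ps r * fdiff r f 0 - elem_sym qs r * fdiff r f 0| <=
    `|elem_sym ps r - elem_sym qs r| * (2 ^+ r * K).
  by rewrite -mulrBl normrM ler_wpM2l // fdiff_bound.
rewrite mulrDr; apply: lerD.
  have -> : K * (N.+1%:R * (4 * L%:R) ^+ N * d) = \sum_(0 <= r < N.+1) K * ((4 * L%:R) ^+ N * d).
    by rewrite sumr_const_nat subn0 -mulr_natl; ring.
  apply: ler_sum_nat => r /andP[_ rN]; apply: le_trans (Ht r) _.
  have := elem_sym_stable Hp Hq L1 pL qL d0 Hd rN => h.
  apply: (@le_trans _ _ ((2 * L%:R) ^+ r * d * (2 ^+ r * K))).
    by rewrite ler_wpM2r // mulr_ge0 // exprn_ge0.
  have -> : (2 * L%:R) ^+ r * d * (2 ^+ r * K) = K * ((4 * L%:R) ^+ r * d).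
    rewrite [X in X * d * _]exprMn (_ : 4 = 2 * 2) ?[X in _ * (X * d)]exprMn ?[X in _ * (X * _ * d)]exprMn; last by ring.
    by ring.
  rewrite ler_wpM2l // ler_wpM2r //; apply: ler_weXn2l => //; lra.
apply: (@le_trans _ _ (\sum_(N.+1 <= r < M.+1) (2 * K) * 4^-1 ^+ r)).
  apply: ler_sum_nat => r /andP[rN _]; apply: le_trans (Ht r) _.
  have Nr : (N <= r)%N by apply: ltnW.
  have r0 : (0 < r)%N by apply: leq_trans rN.
  have h1 := elem_sym_tail Hp pL Nr r0; have h2 := elem_sym_tail Hq qL Nr r0.
  have h3 : `|elem_sym ps r - elem_sym qs r| <= elem_sym ps r + elem_sym qs r.
    by apply: le_trans (ler_normB _ _) _; rewrite !ger0_norm ?elem_sym_ge0.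
  have h4 : 0 <= (2 : R) ^+ r by rewrite exprn_ge0.
  have h5 : 2 ^+ r * `|elem_sym ps r - elem_sym qs r| <= 2 * 4^-1 ^+ r.
    by have := ler_wpM2l h4 h3; lra.
  rewrite [leLHS](_ : _ = K * (2 ^+ r * `|elem_sym ps r - elem_sym qs r|)); last by ring.
  by rewrite [leRHS](_ : _ = K * (2 * 4^-1 ^+ r)) ?ler_wpM2l //; ring.
rewrite -mulr_sumr.
have K2 : 0 <= 2 * K by rewrite mulr_ge0.
apply: le_trans (ler_wpM2l K2 (geom_tail _ _)) _.
have : 0 <= (4^-1 : R) ^+ N by apply: quarter_ge0.
rewrite exprS => h; have := mulr_ge0 K0 h; lra.
Qed.

End PoissonBinomial.

(** * Thresholds on a grid *)

Section Layers.
Variables (R : realFieldType) (n : nat) (p : 'I_n -> nat -> R) (J k : nat).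
Hypothesis p01 : forall i j, 0 <= p i j <= 1.
Hypothesis p_anti : forall i j j', (j <= j')%N -> p i j' <= p i j.
Hypothesis p_J : forall i j, (J <= j)%N -> p i j = 0.
Hypothesis k_gt0 : (0 < k)%N.
Implicit Types S T : {set 'I_n}.

(* [p i j] stands for P(X_i > j), so that [lval S] is E[Top_k(S)] by layer cake and
   [excess i c] is E[(X_i - c)^+]. *)
Definition layer S j := [seq p i j | i <- enum S].
Definition lemin S j := emin k (layer S j).
Definition lval S := \sum_(0 <= j < J) lemin S j.
Definition excess i c := \sum_(c <= j < J) p i j.
Definition tail S c := \sum_(i in S) excess i c.
(* Layers are decreasing: below [l * B], bound each block of [B] layers by its first
   one if that is listed in [Ls], and by [k] otherwise. *)
Definition upper S (B l : nat) (Ls : seq nat) : R :=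
  tail S (l * B) + (k * l * B)%:R - B%:R * \sum_(l' <- Ls) (k%:R - lemin S (l' * B)).

Lemma tail_excess S c : tail S c = \sum_(i in S) excess i c. Proof. by []. Qed.
Lemma upperE S B l Ls : upper S B l Ls =
  tail S (l * B) + (k * l * B)%:R - B%:R * \sum_(l' <- Ls) (k%:R - lemin S (l' * B)).
Proof. by []. Qed.

Lemma probs_layer S j : probs (layer S j).
Proof. by rewrite /probs all_map; apply/allP => i _ /=; apply: p01. Qed.

Lemma psum_layer S r j : psum r (layer S j) = \sum_(i in S) p i j ^+ r.
Proof. by rewrite /psum big_map big_enum. Qed.

Lemma pbin_nondec (ps : seq R) f j : probs ps -> {homo f : x y / (x <= y)%N >-> x <= y} ->
  pbin ps f j <= pbin ps f j.+1.
Proof.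
move=> + fm; elim: ps j => [|q ps IH] j /=; first by move=> _; apply: fm.
by case/andP=> /andP[q0 q1] H; rewrite lerD // ler_wpM2l ?IH ?subr_ge0.
Qed.

(** The expectation is nondecreasing in each parameter, since the averaged function is
    nondecreasing; the parameters are lowered one by one, which replaces a coupling. *)
Lemma lemin_anti S j j' : (j <= j')%N -> lemin S j' <= lemin S j.
Proof.
move=> jj'; rewrite /lemin /layer /emin; move: 0%N => i0.
have fm : {homo (fun x => (minn k x)%:R : R) : x y / (x <= y)%N >-> x <= y}.
  by move=> x y xy; rewrite ler_nat; lia.
elim: (enum S) i0 => //= i s IH j0.
have Hs : probs [seq p i j | i <- s] by rewrite /probs all_map; apply/allP => ? _ /=; apply: p01.
have h1 := IH j0; have h2 := IH j0.+1; have h3 := pbin_nondec j0 Hs fm.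
have /andP[a0 a1] := p01 i j; have /andP[b0 b1] := p01 i j'; have ab := p_anti i jj'.
have h4 : p i j' * pbin [seq p i j' | i <- s] (fun x => (minn k x)%:R) j0.+1 <=
   p i j' * pbin [seq p i j | i <- s] (fun x => (minn k x)%:R) j0.+1 by rewrite ler_wpM2l.
have h5 : (1 - p i j') * pbin [seq p i j' | i <- s] (fun x => (minn k x)%:R) j0 <=
   (1 - p i j') * pbin [seq p i j | i <- s] (fun x => (minn k x)%:R) j0.
  by rewrite ler_wpM2l // subr_ge0.
have h6 : 0 <= (p i j - p i j') * (pbin [seq p i j | i <- s] (fun x => (minn k x)%:R) j0.+1 -
   pbin [seq p i j | i <- s] (fun x => (minn k x)%:R) j0) by rewrite mulr_ge0 // subr_ge0.
lra.
Qed.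

Lemma lemin_ge0 S j : 0 <= lemin S j.
Proof. exact/emin_ge0/probs_layer. Qed.

Lemma lemin_le S j : lemin S j <= k%:R.
Proof. exact/emin_le/probs_layer. Qed.

Lemma lemin_mean S j : lemin S j <= \sum_(i in S) p i j.
Proof.
have := emin_le_mean k (probs_layer S j); rewrite psum_layer => /le_trans; apply.
by apply: ler_sum => i _; rewrite expr1.
Qed.

Lemma lemin_J S j : (J <= j)%N -> lemin S j = 0.
Proof.
move=> Jj; apply: le_anti; rewrite lemin_ge0 andbT (le_trans (lemin_mean _ _)) //.
by rewrite big1 // => i _; apply: p_J.
Qed.

Lemma excess_ge0 i c : 0 <= excess i c.
Proof. by apply: sumr_ge0 => j _; have /andP[] := p01 i j. Qed.

Lemma tail_ge0 S c : 0 <= tail S c.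
Proof. by apply: sumr_ge0 => i _; apply: excess_ge0. Qed.

Lemma excess_anti i c c' : (c <= c')%N -> excess i c' <= excess i c.
Proof.
move=> cc'; rewrite /excess; have [c'J|/ltnW Jc'] := leqP c' J; last first.
  by rewrite big_geq ?excess_ge0.
rewrite [leRHS](big_cat_nat (n := c')) //= lerDr.
by apply: sumr_ge0 => j _; have /andP[] := p01 i j.
Qed.

Lemma tail_anti S c c' : (c <= c')%N -> tail S c' <= tail S c.
Proof. by move=> cc'; apply: ler_sum => i _; apply: excess_anti. Qed.

Lemma tailE S c : tail S c = \sum_(c <= j < J) \sum_(i in S) p i j.
Proof. by rewrite /tail /excess exchange_big. Qed.

Lemma lval_ext S J' : (J <= J')%N -> lval S = \sum_(0 <= j < J') lemin S j.
Proof.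
move=> JJ'; rewrite (big_cat_nat (n := J)) //= [X in _ + X]big_nat_cond.
by rewrite [X in _ + X]big1 ?addr0 // => j /andP[/andP[? _] _]; apply: lemin_J.
Qed.

Lemma lval_ge0 S : 0 <= lval S.
Proof. by apply: sumr_ge0 => j _; apply: lemin_ge0. Qed.

Lemma sum_tail_le S c J' : (J <= J')%N -> \sum_(c <= j < J') lemin S j <= tail S c.
Proof.
move=> JJ'; have [cJ|/ltnW Jc] := leqP c J; last first.
  rewrite big_nat_cond big1 ?tail_ge0 // => j /andP[/andP[? _] _]; apply: lemin_J; lia.
rewrite (big_cat_nat (n := J)) //= [X in _ + X]big_nat_cond [X in _ + X]big1 ?addr0 ?tailE.
  by apply: ler_sum => j _; apply: lemin_mean.
by move=> j /andP[/andP[? _] _]; apply: lemin_J.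
Qed.

Lemma sum_grid_ge S B l :
  \sum_(0 <= j < l * B) lemin S j <= B%:R * \sum_(0 <= l' < l) lemin S (l' * B).
Proof.
elim: l => [|l IH]; first by rewrite mul0n !big_geq // mulr0.
rewrite mulSn addnC (big_cat_nat (n := (l * B)%N)) ?leq_addr //= big_nat_recr //= mulrDr.
apply: lerD => //; rewrite -{1}[(l * B)%N]add0n big_addn addKn.
apply: (@le_trans _ _ (\sum_(0 <= j < B) lemin S (l * B))).
  by apply: ler_sum => j _; apply: lemin_anti; rewrite leq_addl.
by rewrite sumr_const_nat subn0 mulr_natl.
Qed.

(** Each block is bounded below by the first layer of the next block. Compared with [sum_grid_ge],
    this shift by one block is what a grid loses, at most [k * B]. *)
Lemma sum_grid_le S B l :
  B%:R * \sum_(1 <= l' < l.+1) lemin S (l' * B) <= \sum_(0 <= j < l * B) lemin S j.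
Proof.
elim: l => [|l IH]; first by rewrite mul0n !big_geq // mulr0.
rewrite mulSn addnC [leRHS](big_cat_nat (n := (l * B)%N)) ?leq_addr //= big_nat_recr //= mulrDr.
apply: lerD => //; rewrite -{1}[(l * B)%N]add0n big_addn addKn.
apply: (@le_trans _ _ (\sum_(0 <= j < B) lemin S (l.+1 * B))).
  by rewrite sumr_const_nat subn0 mulr_natl.
by apply: ler_sum_nat => j /andP[_ jB]; apply: lemin_anti; lia.
Qed.

Lemma lval_upper S B l Ls : uniq Ls -> all (fun l' => (l' < l)%N) Ls ->
  lval S <= upper S B l Ls.
Proof.
move=> uL lL; rewrite (lval_ext S (leq_addr (l * B) J)).
rewrite (big_cat_nat (n := (l * B)%N)) //= ?leq_addl //.
rewrite [leLHS]addrC /upper -addrA; apply: lerD; first by apply: sum_tail_le; rewrite leq_addr.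
apply: le_trans (sum_grid_ge _ _ _) _.
rewrite [(k * l * B)%N](mulnC _ B) natrM -mulrBr ler_wpM2l //.
have -> : (k * l)%:R = \sum_(0 <= l' < l) k%:R :> R.
  by rewrite sumr_const_nat subn0 natrM mulr_natr.
rewrite lerBrDl -lerBrDr -sumrB.
rewrite [leRHS](bigID [pred l' | l' \in Ls]) /= -[leLHS]addr0; apply: lerD; last first.
  by apply: sumr_ge0 => i _; rewrite subr_ge0 lemin_le.
rewrite -[leRHS]big_filter le_eqVlt; apply/orP; left; apply/eqP/perm_big/uniq_perm => //.
  by rewrite filter_uniq // iota_uniq.
move=> x; rewrite mem_filter mem_index_iota leq0n /=.
by case: (boolP (x \in Ls)) => //= /(allP lL) ->.
Qed.

(* Beyond [c] the layers are at most [lval S / c <= 1 / m], by monotonicity, and a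
   layer that small is almost its mean. *)
Lemma tail_tight S c m : (0 < m)%N -> m%:R * lval S <= c%:R -> (0 < c)%N ->
  (1 - m%:R^-1) * tail S c <= \sum_(c <= j < J) lemin S j.
Proof.
move=> m0 mc c0; rewrite tailE mulr_sumr.
have [cJ|/ltnW Jc] := leqP c J; last by rewrite !big_geq.
apply: ler_sum_nat => j /andP[cj _].
have c0' : 0 < c%:R :> R by rewrite ltr0n.
have m0' : 0 < m%:R :> R by rewrite ltr0n.
have : lemin S j <= m%:R^-1.
  apply: le_trans (lemin_anti _ cj) _.
  have : c%:R * lemin S c <= lval S.
    rewrite /lval (big_cat_nat (n := c)) //= -[leLHS]addr0; apply: lerD; last first.
      by apply: sumr_ge0 => *; apply: lemin_ge0.
    apply: (@le_trans _ _ (\sum_(0 <= j < c) lemin S c)).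
      by rewrite sumr_const_nat subn0 mulr_natl.
    apply: ler_sum_nat => i /andP[_ ic].
    by apply: lemin_anti; apply: ltnW.
  move=> h; have : m%:R * (c%:R * lemin S c) <= c%:R * 1.
    by rewrite mulr1; apply: le_trans mc; rewrite ler_wpM2l // ltW.
  rewrite mulrCA ler_pM2l // => h2.
  by rewrite -[_^-1]mul1r ler_pdivlMr // mulrC.
move=> h; have := emin_ge_mean1 (probs_layer S j) k_gt0 h.
by rewrite psum_layer mulrC; under eq_bigr do rewrite expr1.
Qed.

(** * Large k: one threshold *)

Section Large.
Variables (m B : nat) (S : {set 'I_n}).
Hypotheses (m_gt1 : (1 < m)%N) (km : (4 * m ^ 2 <= k)%N) (B_gt0 : (0 < B)%N).
Hypothesis OB : lval S <= (k * m * B)%:R.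

Let m0 : 0 < m%:R :> R. Proof. by rewrite ltr0n ltnW. Qed.
Let m2 : 2 <= m%:R :> R. Proof. by rewrite ler_nat. Qed.
Let k0 : 0 < k%:R :> R. Proof. by rewrite ltr0n. Qed.
Let B0 : 0 < B%:R :> R. Proof. by rewrite ltr0n. Qed.
Let mi0 : 0 < m%:R^-1 :> R. Proof. by rewrite invr_gt0. Qed.
Let mi2 : m%:R^-1 <= 2^-1 :> R. Proof. by rewrite lef_pV2 // posrE. Qed.

(** Let t be the first layer whose mean count is at most k. Then [k * t + tail S t] is the sum over
    all layers of min(k, mean), which [emin_frac] compares with [lval S]. Rounding t up to a
    multiple of B lowers the tail and costs at most [k * B]. As [m >= 2], the inverse of [1 - 1 / m]
    is at most [1 + 2 / m]. *)
Lemma large_grid : exists l, [/\ (l <= 2 * m + 1)%N,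
  tail S (l * B) <= (2 * k * m * B)%:R &
  (k * l * B)%:R + tail S (l * B) <= (1 + 2 / m%:R) * lval S + (k * B)%:R].
Proof.
pose lam j := \sum_(i in S) p i j.
have lamJ : lam J <= k%:R.
  by rewrite /lam big1 // => i _; apply: p_J.
have [t ltk tmin] := ex_minnP (ex_intro (fun j => lam j <= k%:R) J lamJ).
have tJ : (t <= J)%N by apply: tmin.
have lam_anti j j' : (j <= j')%N -> lam j' <= lam j.
  by move=> jj'; apply: ler_sum => i _; apply: p_anti.
have tE : k%:R * t%:R + tail S t = \sum_(0 <= j < J) Num.min k%:R (lam j).
  rewrite (big_cat_nat (n := t)) //= tailE; congr (_ + _).
    rewrite (eq_big_nat _ _ (F2 := fun=> k%:R)); first by rewrite sumr_const_nat subn0 mulr_natr.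
    move=> j /andP[_ jt]; apply: min_l; case: (lerP k%:R (lam j)) => // /ltW /tmin; lia.
  apply: eq_big_nat => j /andP[tj _]; rewrite min_r //.
  by apply: le_trans (lam_anti _ _ tj) ltk.
have H1 : (1 - m%:R^-1) * (k%:R * t%:R + tail S t) <= lval S.
  rewrite tE mulr_sumr; apply: ler_sum => j _.
  have := emin_frac (probs_layer S j) (ltnW m_gt1) km.
  by rewrite psum_layer (eq_bigr (p^~ j)) // => i _; rewrite expr1.
have X0 : 0 <= k%:R * t%:R + tail S t by rewrite addr_ge0 ?mulr_ge0 ?tail_ge0.
have H2 : k%:R * t%:R + tail S t <= (1 + 2 / m%:R) * lval S.
  have h : 0 <= 1 + 2 / m%:R :> R by rewrite addr_ge0 // divr_ge0.
  apply: le_trans (ler_wpM2l h H1); rewrite mulrA ler_peMl //.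
  by have : 0 <= m%:R^-1 * (1 - 2 * m%:R^-1) :> R; [rewrite mulr_ge0 ?(ltW mi0) // subr_ge0; have := mi2; lra | lra].
have V0 := lval_ge0 S.
have H3 : k%:R * t%:R + tail S t <= 2 * lval S.
  by apply: le_trans H2 _; rewrite ler_wpM2r //; have := mi2; lra.
exists (t %/ B).+1.
have tB : (t <= (t %/ B).+1 * B)%N by rewrite ltnW // ltn_ceil.
have tB' : (t %/ B * B <= t)%N by apply: leq_trunc_div.
have Ht := tail_anti S tB.
have T0 := tail_ge0 S t.
have kt0 : 0 <= k%:R * t%:R :> R by rewrite mulr_ge0.
have E : (2 * k * m * B)%:R = 2 * (k * m * B)%:R :> R by rewrite -!mulnA natrM.
split.
- have : (k * t)%:R <= (2 * k * m * B)%:R :> R by rewrite E [(k * t)%:R]natrM; move: OB; lra.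
  rewrite ler_nat -!mulnA mulnCA leq_pmul2l // => h.
  have : (t %/ B * B <= (2 * m) * B)%N by rewrite -mulnA; apply: leq_trans h.
  by rewrite leq_pmul2r // addn1 ltnS.
- by rewrite E; move: OB; lra.
- have : (k * (t %/ B).+1 * B)%:R <= k%:R * t%:R + (k * B)%:R :> R.
    rewrite -natrM -natrD ler_nat -mulnA mulSn mulnDr addnC leq_add2r leq_pmul2l //.
  lra.
Qed.

(** Two units [k * B] are spent, one on rounding the threshold and one on rounding the tail. *)
Lemma large_upper l T : (k * m * B)%:R <= 2 * lval S ->
  (k * l * B)%:R + tail S (l * B) <= (1 + 2 / m%:R) * lval S + (k * B)%:R ->
  tail T (l * B) <= tail S (l * B) + (k * B)%:R ->
  upper T B l [::] <= (1 + 8 / m%:R) * lval S.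
Proof.
move=> BO h1 h2; rewrite /upper big_nil mulr0 subr0.
have kB : (k * B)%:R <= 2 / m%:R * lval S.
  rewrite mulrAC ler_pdivlMr // -natrM mulnAC; lra.
have V0 := lval_ge0 S.
have := mulr_ge0 (ltW mi0) V0.
lra.
Qed.

End Large.

(** * Small k: matching power sums at all thresholds *)

Section Small.
Variables (m B : nat) (S : {set 'I_n}).
Hypotheses (m_gt1 : (1 < m)%N) (km : (k <= 16 * m ^ 2)%N) (B_gt0 : (0 < B)%N).
Hypothesis OB : lval S <= (k * m * B)%:R.

Let m0 : 0 < m%:R :> R. Proof. by rewrite ltr0n ltnW. Qed.
Let m2 : 2 <= m%:R :> R. Proof. by rewrite ler_nat. Qed.
Let k0 : 0 < k%:R :> R. Proof. by rewrite ltr0n. Qed.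
Let B0 : 0 < B%:R :> R. Proof. by rewrite ltr0n. Qed.
Let mi0 : 0 < m%:R^-1 :> R. Proof. by rewrite invr_gt0. Qed.
Let mi2 : m%:R^-1 <= 2^-1 :> R. Proof. by rewrite lef_pV2 // posrE. Qed.
(** Since [lval S <= k * m * B], the cutoff [h * B] is at least m times the value, as [tail_tight]
    demands. *)
Let h := (k * m ^ 2)%N.

Let tight : (1 - m%:R^-1) * tail S (h * B) <= \sum_(h * B <= j < J) lemin S j.
Proof.
apply: tail_tight; first exact: ltnW.
  apply: le_trans (ler_wpM2l (ltW m0) OB) _; rewrite -natrM ler_nat /h; lia.
by rewrite /h !muln_gt0 k_gt0 B_gt0 !(ltnW m_gt1).
Qed.

Let split_lval : \sum_(0 <= j < h * B) lemin S j + \sum_(h * B <= j < J) lemin S j <= lval S.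
Proof.
have [c|/ltnW c] := leqP (h * B) J; first by rewrite -big_cat_nat.
by rewrite [X in _ + X]big_geq // addr0 -lval_ext.
Qed.

Lemma small_tail : tail S (h * B) <= (2 * k * m * B)%:R.
Proof.
have h1 : 0 <= \sum_(0 <= j < h * B) lemin S j by apply: sumr_ge0 => *; apply: lemin_ge0.
have := split_lval; have := tight; have T0 := tail_ge0 S (h * B).
have : 2^-1 * tail S (h * B) <= (1 - m%:R^-1) * tail S (h * B) by rewrite ler_wpM2r //; have := mi2; lra.
have -> : (2 * k * m * B)%:R = 2 * (k * m * B)%:R :> R by rewrite -!mulnA natrM.
move: OB; lra.
Qed.

(** When the mean of S is below [16 * m ^ 2], that of T exceeds it by at most the rounding error,
    which is at most 1: [17 * m ^ 2] bounds both. *)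
Let L := (17 * m ^ 2)%N.

(** If the mean of S is at least [16 * m ^ 2], hence at least k, the layer of S is saturated and no
    T can exceed it by much. Otherwise [pbin_stable] applies to a function with values in [[0, k]]:
    G makes each of its two error terms at most [1 / (32 * m ^ 4)], and [k <= 16 * m ^ 2] turns
    their sum into [1 / m ^ 2]. *)
Lemma small_stable T j (G : nat) :
  (32 * m ^ 4 * (32 * L).+1 * (4 * L) ^ (32 * L) <= G)%N ->
  (forall r, (0 < r <= 32 * L)%N ->
    `|\sum_(i in S) p i j ^+ r - \sum_(i in T) p i j ^+ r| <= G%:R^-1) ->
  lemin T j <= (1 + 2 / m%:R) * lemin S j + (m ^ 2)%:R^-1.
Proof.
move=> HG HP; have P0 := lemin_ge0 S j.
have mm : 0 < (m ^ 2)%:R^-1 :> R by rewrite invr_gt0 ltr0n expn_gt0 ltnW.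
have kP : 0 < 1 + 2 / m%:R :> R by rewrite addr_gt0 // divr_gt0.
have m4 : (0 < m ^ 4)%N by rewrite expn_gt0 ltnW.
have L0 : (0 < L)%N by rewrite /L !muln_gt0 !(ltnW m_gt1).
have G0 : 0 < G%:R :> R.
  rewrite ltr0n; apply: leq_trans HG.
  have pw : (0 < (4 * L) ^ (32 * L))%N by rewrite expn_gt0 muln_gt0 L0.
  by move: (_ ^ (32 * L))%N (m ^ 4)%N pw m4 => u v u0 v0; rewrite !muln_gt0 u0 v0.
have HP1 := HP 1%N ltac:(by rewrite muln_gt0).
have [big|small] := lerP (16 * m ^ 2)%:R (\sum_(i in S) p i j ^+ 1).
  have mn : (m ^ 2 <= 16 * m ^ 2)%N by rewrite leq_pmull.
  have a1 : k%:R <= psum 1 (layer S j) by rewrite psum_layer; apply: le_trans big; rewrite ler_nat.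
  have a2 : (m ^ 2)%:R <= psum 1 (layer S j) by rewrite psum_layer; apply: le_trans big; rewrite ler_nat.
  have := emin_sat (probs_layer S j) (ltnW m_gt1) a1 a2; rewrite -/(lemin S j) => a3.
  have := lemin_le T j; have := ler_wpM2l (ltW kP) a3.
  have : 0 <= k%:R * (m%:R^-1 * (1 - 2 * m%:R^-1)) :> R.
    by rewrite mulr_ge0 // mulr_ge0 ?(ltW mi0) // subr_ge0; have := mi2; lra.
  lra.
have G1 : G%:R^-1 <= 1 :> R by rewrite invf_le1 // ler1n -(ltr0n R).
have m21 : 1 <= (m ^ 2)%:R :> R by rewrite ler1n expn_gt0 ltnW.
have EL : L%:R = 17 * (m ^ 2)%:R :> R by rewrite /L natrM.
have E16 : (16 * m ^ 2)%:R = 16 * (m ^ 2)%:R :> R by rewrite natrM.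
rewrite E16 in small.
have b1 : psum 1 (layer S j) <= L%:R by rewrite psum_layer EL; lra.
have b2 : psum 1 (layer T j) <= L%:R.
  rewrite psum_layer EL; move: HP1; rewrite ler_norml => /andP[]; lra.
have dd : 0 <= G%:R^-1 :> R by rewrite invr_ge0 ltW.
have hf (x : nat) : 0 <= ((minn k x)%:R : R) <= k%:R by rewrite ler0n ler_nat geq_minl.
have HP2 r : (0 < r <= 32 * L)%N -> `|psum r (layer S j) - psum r (layer T j)| <= G%:R^-1.
  by rewrite !psum_layer; apply: HP.
have := pbin_stable (probs_layer S j) (probs_layer T j) L0 b1 b2 dd HP2 hf.
rewrite -[pbin (layer S j) _ _]/(lemin S j) -[pbin (layer T j) _ _]/(lemin T j).
set bnd := (X in _ <= X); suff Hb : bnd <= (m ^ 2)%:R^-1.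
  rewrite ler_norml => /andP[c1 _]; have := mulr_ge0 (ltW mi0) P0; lra.
have k16 : k%:R <= 16 * (m ^ 2)%:R :> R by rewrite -E16 ler_nat.
have c0 : 0 < (32 * m ^ 4)%:R :> R by rewrite ltr0n; case: (m ^ 4)%N m4.
have e1 : (32 * L).+1%:R * (4 * L%:R) ^+ (32 * L) * G%:R^-1 <= (32 * m ^ 4)%:R^-1 :> R.
  rewrite ler_pdivrMr // ler_pdivlMl //.
  by rewrite -natrM -natrX -!natrM ler_nat mulnA.
have e2 : 4 * 4^-1 ^+ (32 * L) <= (32 * m ^ 4)%:R^-1 :> R.
  rewrite exprVn ler_pdivrMr ?exprn_gt0 // ler_pdivlMl //.
  rewrite -natrX -natrM ler_nat.
  have : (m ^ 4 <= 4 ^ (2 * m ^ 2))%N.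
    have Hz z : (z * z <= 4 ^ (2 * z))%N.
      by rewrite mul2n -addnn expnD; apply: leq_mul; apply/ltnW/ltn_expl.
    by rewrite (_ : m ^ 4 = m ^ 2 * m ^ 2)%N ?Hz // -expnD.
  have Hz z : (0 < z)%N -> (2 * z + 4 <= 32 * (17 * z))%N by clear; lia.
  have : (2 * m ^ 2 + 4 <= 32 * L)%N by apply: Hz; rewrite expn_gt0 ltnW.
  move: (32 * L)%N (m ^ 2)%N (m ^ 4)%N => N z v zN vz.
  have -> : N = (2 * z + 4 + (N - (2 * z + 4)))%N by rewrite subnKC.
  rewrite expnD (expnD 4 (2 * z)%N 4); apply: (@leq_trans (4 ^ (2 * z) * 4 ^ 4)).
    by rewrite mulnAC mulnC; apply: leq_mul.
  by apply: leq_pmulr; rewrite expn_gt0.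
have e3 : (32 * m ^ 4)%:R^-1 + (32 * m ^ 4)%:R^-1 = (16 * (m ^ 2)%:R)^-1 * (m ^ 2)%:R^-1 :> R.
  by rewrite natrM !natrX; field; rewrite gt_eqF.
have k00 := ltW k0.
apply: (@le_trans _ _ (k%:R * ((16 * (m ^ 2)%:R)^-1 * (m ^ 2)%:R^-1))).
  by rewrite -e3 ler_wpM2l // lerD.
rewrite mulrA ler_piMl // ?(ltW mm) // ler_pdivrMr ?mul1r //; lra.
Qed.

(** Three units [k * B] are lost: block 0 is not listed, as no block before it could pay for its
    first layer; the additive errors [1 / m ^ 2] of fewer than [k * m ^ 2] layers add up to at most
    k; the tail is rounded. The factor [q] gives the remaining [2 / m]. *)
Lemma small_upper T : (k * m * B)%:R <= 2 * lval S ->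
  tail T (h * B) <= tail S (h * B) + (k * B)%:R ->
  (forall l, (0 < l < h)%N ->
     lemin T (l * B) <= (1 + 2 / m%:R) * lemin S (l * B) + (m ^ 2)%:R^-1) ->
  upper T B h (iota 1 h.-1) <= (1 + 8 / m%:R) * lval S.
Proof.
move=> BO h2 h3; rewrite /upper.
have h0 : (0 < h)%N by rewrite !muln_gt0 k_gt0 ltnW.
have -> : iota 1 h.-1 = index_iota 1 h by rewrite /index_iota subn1.
set q : R := 1 + 2 / m%:R.
have q0 : 0 <= q by rewrite addr_ge0 // divr_ge0.
have h4 : \sum_(1 <= l < h) lemin T (l * B) <=
   q * \sum_(1 <= l < h) lemin S (l * B) + k%:R.
  apply: (@le_trans _ _ (\sum_(1 <= l < h) (q * lemin S (l * B) + (m ^ 2)%:R^-1))).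
    exact: ler_sum_nat.
  rewrite big_split /= -mulr_sumr lerD2l sumr_const_nat -[_ *+ (h - 1)]mulr_natl.
  by rewrite ler_pdivrMr ?ltr0n ?expn_gt0 ?(ltnW m_gt1) // -natrM ler_nat leq_subr.
rewrite sumrB sumr_const_nat.
have h5 := sum_grid_le S B h.
have h6 : \sum_(1 <= l < h) lemin S (l * B) <= \sum_(1 <= l < h.+1) lemin S (l * B).
  by rewrite [leRHS]big_nat_recr //= lerDl lemin_ge0.
set s1 := \sum_(1 <= l < h) lemin T (l * B) in h4 *.
set s2 := \sum_(1 <= l < h) lemin S (l * B) in h4 h6.
set s3 := \sum_(1 <= l < h.+1) _ in h5 h6.
have h7 := tight; have h8 := split_lval.
have g1 : B%:R * s1 <= q * (B%:R * s3) + (k * B)%:R.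
  have : B%:R * s1 <= B%:R * (q * s3 + k%:R).
    rewrite ler_wpM2l // (le_trans h4) // lerD2r ler_wpM2l //.
  by rewrite natrM; lra.
have g2 : q * (B%:R * s3) <= q * (lval S - \sum_(h * B <= j < J) lemin S j).
  by rewrite ler_wpM2l //; lra.
have g3 : tail S (h * B) <= q * \sum_(h * B <= j < J) lemin S j.
  apply: le_trans (ler_wpM2l q0 h7); rewrite mulrA ler_peMl ?tail_ge0 //.
  have : 0 <= m%:R^-1 * (1 - 2 * m%:R^-1) :> R; last by rewrite /q; lra.
  by rewrite mulr_ge0 ?(ltW mi0) // subr_ge0; have := mi2; lra.
have kB : (k * B)%:R <= 2 / m%:R * lval S.
  rewrite mulrAC ler_pdivlMr // -natrM mulnAC; lra.
have E : (k * h * B)%:R - B%:R * (k%:R *+ (h - 1)) = (k * B)%:R :> R.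
  have -> : k%:R *+ (h - 1) = k%:R * (h%:R - 1) :> R by rewrite -[LHS]mulr_natr natrB.
  by rewrite !natrM; ring.
have V0 := lval_ge0 S.
have := mulr_ge0 (ltW mi0) V0.
rewrite /q in g1 g2 g3; rewrite mulrBr.
move=> h9; lra.
Qed.

End Small.
End Layers.

(** * Layer cake for the sum of the k largest values *)

Lemma count_take_sorted (T : eqType) (leT : rel T) (P : pred T) (t : seq T) k :
  transitive leT -> sorted leT t -> {in t & t, forall x y, leT x y -> P y -> P x} ->
  count P (take k t) = minn k (count P t).
Proof.
move=> leT_tr; elim: t k => [|a t IH] [|k] //= st HP; first by rewrite !min0n.
have lea : all (leT a) t by apply: order_path_min st.
have st' := path_sorted st.
have HP' : {in t & t, forall x y, leT x y -> P y -> P x}.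
  by move=> x y xt yt; apply: HP; rewrite inE ?xt ?yt orbT.
rewrite IH //; case Pa: (P a); first by rewrite !add1n minnSS.
suff -> : count P t = 0%N by rewrite !minn0.
apply/eqP; rewrite -leqn0 leqNgt -has_count; apply/hasPn => y yt.
apply: contraFN Pa => Py; apply: HP Py; rewrite ?inE ?eqxx ?yt ?orbT //.
by move/allP: lea => /(_ _ yt).
Qed.

(** A scaled value z is the number of layers below it. In decreasing order the values above a given
    layer come first, so that min(k, count) of them are among the first k. *)
Lemma sum_top_layers (s : seq rat) (al : rat) k J : 0 < al ->
  {in s, forall x, exists2 z : nat, al * x = z%:R & (z <= J)%N} ->
  al * \sum_(x <- take k (sort >=%R s)) x =
  \sum_(0 <= j < J) (minn k (count (fun x => j%:R < al * x) s))%:R.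
Proof.
move=> al0 Hs.
have Ht : {in take k (sort >=%R s), forall x, exists2 z : nat, al * x = z%:R & (z <= J)%N}.
  by move=> x /mem_take; rewrite mem_sort; apply: Hs.
have st : sorted >=%R (sort >=%R s) by apply: sort_sorted => x y; apply: le_total.
transitivity (\sum_(0 <= j < J) (count (fun x => j%:R < al * x) (take k (sort >=%R s)))%:R : rat).
  elim: (take _ _) Ht => [|x t IH] Ht; first by rewrite big_nil mulr0 big1.
  rewrite big_cons mulrDr IH; last by move=> y yt; apply: Ht; rewrite inE yt orbT.
  under [RHS]eq_bigr do rewrite /= natrD.
  rewrite big_split /=; congr (_ + _).
  have [|z -> zJ] := Ht x; first by rewrite inE eqxx.
  under eq_bigr do rewrite ltr_nat.
  rewrite (big_cat_nat (n := z)) //= -[LHS]addr0; congr (_ + _).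
    rewrite (eq_big_nat _ _ (F2 := fun=> 1)) ?sumr_const_nat ?subn0 //.
    by move=> j /andP[_ ->].
  by rewrite big_nat_cond big1 // => j /andP[/andP[]]; rewrite leqNgt => /negbTE->.
apply: eq_bigr => j _; congr (_%:R).
rewrite (@count_take_sorted _ >=%R) ?count_sort // => [y x z xy yz|x y _ _ /= xy h].
  exact: le_trans yz xy.
by apply: lt_le_trans h _; rewrite ler_pM2l.
Qed.

(** * Counting independent events on the product space *)

Section Independent.
Variables (n : nat) (X : 'I_n -> law).

Definition mass i (x : 'I_(size (X i))) : rat := (nth (0, 0) (X i) x).2.

(** Distributivity of product over sum, available for [fprod], to which the dependent functions are
    transported. *)
Lemma expect_prod (G : forall i, 'I_(size (X i)) -> rat) :
  \sum_(o : outcome X) \prod_i G i (o i) = \prod_i \sum_x G i x.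
Proof.
pose P i : {ffun 'I_(size (X i)) -> rat} := [ffun x => G i x].
rewrite (reindex (@dffun_of_fprod _ _)) /=; last exact/onW_bij/dffun_of_fprod_bij.
transitivity (\sum_t \prod_(i in 'I_n) P i ((t : fprod (fun i => 'I_(size (X i)))) i)).
  by apply: eq_bigr => t _; apply: eq_bigr => i _; rewrite !ffunE.
rewrite (big_fprod 1 +%R) -(bigA_distr_big_dep (fun i => tagged_with (fun i => 'I_(size (X i))) i)
   (fun i => untag 0 (P i))) /=.
apply: eq_bigr => i _; transitivity (\sum_x P i x); last by apply: eq_bigr => x _; rewrite ffunE.
by rewrite (big_tag (fun i x => P i x) i).
Qed.

Hypothesis X1 : forall i, \sum_x mass (i := i) x = 1.
Variable ev : forall i, 'I_(size (X i)) -> bool.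
Definition pev i := \sum_x mass (i := i) x * (ev x)%:R.

(** The weights [F] make the induction possible: splitting on the event of the head [i] puts an
    indicator into the factor of [i], while the factors of the items still to be counted remain
    1. *)
Lemma expect_count_gen (s : seq 'I_n) (F : forall i, 'I_(size (X i)) -> rat) f j :
  uniq s -> {in s, forall i x, F i x = 1} ->
  \sum_(o : outcome X) prob o * \prod_i F i (o i) * f (count (fun i => ev (o i)) s + j)%N =
  (\prod_i \sum_x mass (i := i) x * F i x) * pbin [seq pev i | i <- s] f j.
Proof.
elim: s F j => [|i s IH] F j /=.
  move=> _ _; rewrite -mulr_suml -expect_prod; congr (_ * _).
  by apply: eq_bigr => o _; rewrite /prob -big_split.
case/andP=> nis us HF.
pose F1 (b : bool) i' (x : 'I_(size (X i'))) := if i' == i then (ev x == b)%:R else F i' x.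
have HF1 b : {in s, forall i' x, F1 b i' x = 1}.
  move=> i' i's x; rewrite /F1; case: eqP => [E|_]; first by rewrite E (negbTE nis) in i's.
  by apply: HF; rewrite inE i's orbT.
have FE b (o : outcome X) : \prod_i' F1 b i' (o i') = (ev (o i) == b)%:R * \prod_i' F i' (o i').
  rewrite (bigD1 i) //= [in RHS](bigD1 i) //= /F1 eqxx HF ?inE ?eqxx // mul1r; congr (_ * _).
  by apply: eq_bigr => i' /negbTE ->.
pose PF := \prod_i' (\sum_x mass (i := i') x * F i' x).
have SE b : \prod_i' (\sum_x mass (i := i') x * F1 b i' x) =
    (\sum_x mass (i := i) x * (ev x == b)%:R) * \prod_i' (\sum_x mass (i := i') x * F i' x).
  rewrite (bigD1 i) //= [in RHS](bigD1 i) //= /F1 eqxx; congr (_ * _).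
  rewrite [X in _ = X * _](_ : _ = 1) ?mul1r; last first.
    by rewrite -(X1 i); apply: eq_bigr => x _; rewrite HF ?mulr1 ?inE ?eqxx.
  by apply: eq_bigr => i' /negbTE ->.
rewrite (eq_bigr (fun o : outcome X =>
   prob o * \prod_i' F1 true i' (o i') * f (count (fun i => ev (o i)) s + j.+1)%N +
   prob o * \prod_i' F1 false i' (o i') * f (count (fun i => ev (o i)) s + j)%N)); last first.
  move=> o _; rewrite !FE; case: (ev (o i)) => /=.
    by rewrite mul1r mul0r mulr0 mul0r addr0 add1n addSnnS.
  by rewrite mul1r mul0r mulr0 mul0r !add0r.
rewrite big_split /= !IH // !SE.
have -> : \sum_x mass (i := i) x * (ev x == true)%:R = pev i.
  by apply: eq_bigr => x _; rewrite eqb_id.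
have -> : \sum_x mass (i := i) x * (ev x == false)%:R = 1 - pev i.
  rewrite -[X in X - _](X1 i) -sumrB; apply: eq_bigr => x _; case: (ev x); rewrite /= ?mulr1 ?mulr0 ?subrr ?subr0 //.
rewrite -/PF; ring.
Qed.

Lemma expect_count (s : seq 'I_n) f : uniq s ->
  expectation (fun o : outcome X => f (count (fun i => ev (o i)) s)) =
  pbin [seq pev i | i <- s] f 0.
Proof.
move=> us; have := expect_count_gen (F := fun _ _ => 1) f 0 us (fun _ _ _ => erefl).
rewrite [X in _ = X * _]big1 ?mul1r => [<-|i _]; last first.
  by rewrite -[RHS](X1 i); apply: eq_bigr => x _; rewrite mulr1.
by apply: eq_bigr => o _; rewrite big1 // mulr1 addn0.
Qed.
End Independent.

(** * Exceedance probabilities of scaled variables *)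

Section Exceedance.
Variables (n : nat) (X : 'I_n -> law) (al : rat) (J k : nat).
Hypothesis lawX : forall i, is_law (X i).
Hypothesis al_gt0 : 0 < al.
Hypothesis alJ : forall i a, a \in X i -> exists2 z : nat, al * a.1 = z%:R & (z <= J)%N.

Definition pexc i (j : nat) : rat := \sum_(a <- X i) a.2 * (j%:R < al * a.1)%R%:R.

Lemma mass_sum i : \sum_x mass (X := X) (i := i) x = 1.
Proof.
by have [_ <-] := lawX i; rewrite (big_nth (0, 0)) big_mkord.
Qed.

Lemma pexc01 i j : 0 <= pexc i j <= 1.
Proof.
have [/allP H <-] := lawX i; apply/andP; split.
  rewrite /pexc big_seq_cond; apply: sumr_ge0 => a /andP[/H /andP[_ a2] _].
  by rewrite mulr_ge0.
rewrite /pexc big_seq_cond [leRHS]big_seq_cond; apply: ler_sum => a /andP[/H /andP[_ a2] _].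
by case: (_ < _) => /=; rewrite ?mulr1 ?mulr0.
Qed.

Lemma pexc_anti i j j' : (j <= j')%N -> pexc i j' <= pexc i j.
Proof.
move=> jj'; have [/allP H _] := lawX i.
rewrite /pexc big_seq_cond [leRHS]big_seq_cond; apply: ler_sum => a /andP[/H /andP[_ a2] _].
rewrite ler_wpM2l // ler_nat; case: (ltP j'%:R) => //= h.
by rewrite (@le_lt_trans _ _ j'%:R) // ler_nat.
Qed.

Lemma pexc_J i j : (J <= j)%N -> pexc i j = 0.
Proof.
move=> Jj; rewrite /pexc big_seq_cond big1 // => a /andP[/alJ[z -> zJ] _].
by rewrite ltr_nat ltnNge (leq_trans zJ Jj) mulr0.
Qed.

Lemma ETop_layers (S : {set 'I_n}) : al * ETop X k S = lval pexc J k S.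
Proof.
rewrite /ETop /expectation mulr_sumr /lval.
transitivity (\sum_(o : outcome X) \sum_(0 <= j < J)
   prob o * (minn k (count (fun i => j%:R < al * value o i) (enum S)))%:R).
  apply: eq_bigr => o _; rewrite mulrCA /topk (@sum_top_layers _ al k J) //; last first.
    move=> x /mapP[i _ ->]; apply: alJ (mem_nth _ _) => //.
  rewrite mulr_sumr; apply: eq_bigr => j _.
  by rewrite count_map.
rewrite exchange_big /=; apply: eq_bigr => j _.
pose ev i (x : 'I_(size (X i))) := (j%:R < al * (nth (0, 0) (X i) x).1)%R.
have := @expect_count n X mass_sum ev (enum S) (fun x => (minn k x)%:R) (enum_uniq _).
rewrite /expectation /value => ->.
rewrite /lemin /emin /layer; congr (pbin _ _ _); apply: eq_map => i.
by rewrite /pev /pexc (big_nth (0, 0)) big_mkord.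
Qed.

(** An atom of integral scaled value z exceeds exactly [z - c] of the layers from c on, or none:
    integrality makes the sum over the layers an exact mean. *)
Lemma excess_pexc i c : excess pexc J i c =
  \sum_(a <- X i) a.2 * Num.max 0 (al * a.1 - c%:R).
Proof.
rewrite /excess /pexc exchange_big /= big_seq_cond [RHS]big_seq_cond.
apply: eq_bigr => a /andP[/alJ[z -> zJ] _]; rewrite -mulr_sumr; congr (_ * _).
under eq_bigr do rewrite ltr_nat.
have [zc|cz] := leqP z c.
  rewrite max_l; last by rewrite subr_le0 ler_nat.
  by rewrite big_nat_cond big1 // => j /andP[/andP[cj _] _]; rewrite ltnNge (leq_trans zc cj).
rewrite max_r; last by rewrite subr_ge0 ler_nat ltnW.
rewrite (big_cat_nat (n := z)) ?(ltnW cz) //= [X in _ + X]big_nat_cond [X in _ + X]big1 ?addr0.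
  transitivity (\sum_(c <= j < z) 1 : rat); first by apply: eq_big_nat => j /andP[_ ->].
  by rewrite sumr_const_nat natrB // ltnW.
by move=> j /andP[/andP[zj _] _]; rewrite ltnNge zj.
Qed.

End Exceedance.

(** * Running times *)

Definition sz (z : int) (e : nat) : Prop := (`|z|%N < 2 ^ e)%N.

Lemma sz_le z e e' : sz z e -> (e <= e')%N -> sz z e'.
Proof. by rewrite /sz => h ee; apply: leq_trans h _; rewrite leq_exp2l. Qed.

Lemma sz_bitlen z e L : sz z e -> (e < L)%N -> (bitlen z <= L)%N.
Proof.
rewrite /sz /bitlen => h eL; apply: leq_trans eL; rewrite ltnS.
case: (posnP `|z|%N) => [->|z0]; first by [].
have := trunc_logP (isT : (1 < 2)%N) z0 => h2.
by rewrite -ltnS -(ltn_exp2l _ _ (isT : (1 < 2)%N)) (leq_ltn_trans h2) // (leq_trans h) // leq_exp2l.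
Qed.

Lemma sz_mul a b e1 e2 : sz a e1 -> sz b e2 -> sz (a * b) (e1 + e2).
Proof. by rewrite /sz abszM expnD; apply: ltn_mul. Qed.

Lemma sz_add a b e1 e2 : sz a e1 -> sz b e2 -> sz (a + b) (e1 + e2).+1.
Proof.
rewrite /sz => h1 h2; have h : (`|(a + b)%R| <= `|a| + `|b|)%N by lia.
apply: leq_ltn_trans h _; rewrite expnS expnD.
have p1 : (0 < 2 ^ e1)%N by rewrite expn_gt0.
have p2 : (0 < 2 ^ e2)%N by rewrite expn_gt0.
move: h1 h2 p1 p2; move: (2 ^ e1)%N (2 ^ e2)%N (absz a) (absz b) => u v x y; nia.
Qed.

(** Along a sum over a list the exponents of [sz_add] would add up; this form costs one bit per
    term. *)
Lemma sz_add_max a b e : sz a e -> sz b e -> sz (a + b) e.+1.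
Proof. by rewrite /sz expnS; lia. Qed.

Lemma sz_opp a e : sz a e -> sz (- a) e.
Proof. by rewrite /sz abszN. Qed.

Lemma sz_sub a b e1 e2 : sz a e1 -> sz b e2 -> sz (a - b) (e1 + e2).+1.
Proof. by move=> h1 h2; apply: sz_add => //; apply: sz_opp. Qed.

Lemma sz_div a b e : sz a e -> sz (a %/ b)%Z e.
Proof.
by rewrite /sz => h; apply: leq_ltn_trans h; have := lez_div a b; lia.
Qed.

Lemma sz_small (z : int) e : (`|z|%N <= 1)%N -> (0 < e)%N -> sz z e.
Proof. by rewrite /sz => h; case: e => // e _; rewrite expnS; have : (0 < 2 ^ e)%N by [rewrite expn_gt0]; lia. Qed.

Lemma sz0 e : sz 0 e.
Proof. by rewrite /sz absz0 expn_gt0. Qed.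

Lemma sz_cst (z : int) : sz z `|z|%N.
Proof. by rewrite /sz ltn_expl. Qed.

Section Runs.
Variables (p : program) (O : oracle) (L : nat).

(* [s] steps on integers of at most [L] bits. *)
Definition runs env e v s tr :=
  exists2 t, eval p O env e v t tr & (t <= s * (L.+1 * L.+1))%N.

Lemma runs_le env e v s s' tr : runs env e v s tr -> (s <= s')%N -> runs env e v s' tr.
Proof. by case=> t h ts ss; exists t => //; apply: leq_trans ts _; rewrite leq_mul2r ss orbT. Qed.

Lemma runs_var env i v : (i < size env)%N -> nth (DInt 0) env i = v -> runs env (Var i) v 1 [::].
Proof. by move=> h <-; exists 1%N; [apply: EVar | lia]. Qed.

Lemma runs_cst env z : (bitlen z <= L)%N -> runs env (Cst z) (DInt z) 1 [::].
Proof. by move=> h; exists (bitlen z).+1; [apply: ECst | rewrite mul1n; nia]. Qed.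

Lemma runs_op env o e1 e2 a b s1 s2 tr1 tr2 :
  runs env e1 (DInt a) s1 tr1 -> runs env e2 (DInt b) s2 tr2 ->
  (bitlen a <= L)%N -> (bitlen b <= L)%N ->
  runs env (Op o e1 e2) (DInt (op_val o a b)) (s1 + s2 + 1) (tr1 ++ tr2).
Proof.
case=> t1 h1 l1 [t2 h2 l2] la lb; exists (t1 + t2 + op_cost o a b).+1; first exact: EOp.
rewrite !mulnDl mul1n; have : (op_cost o a b < L.+1 * L.+1)%N.
  case: o => /=; move: (bitlen a) (bitlen b) la lb => x y; nia.
lia.
Qed.

Lemma runs_cons env e1 e2 v1 v2 s1 s2 tr1 tr2 :
  runs env e1 v1 s1 tr1 -> runs env e2 v2 s2 tr2 ->
  runs env (Cons e1 e2) (DPair v1 v2) (s1 + s2 + 1) (tr1 ++ tr2).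
Proof.
case=> t1 h1 l1 [t2 h2 l2]; exists (t1 + t2).+1; first exact: ECons.
rewrite !mulnDl mul1n; lia.
Qed.

Lemma runs_fst env e v1 v2 s tr : runs env e (DPair v1 v2) s tr -> runs env (Fst e) v1 (s + 1) tr.
Proof. by case=> t h l; exists t.+1; [apply: EFst h | rewrite mulnDl mul1n; lia]. Qed.

Lemma runs_snd env e v1 v2 s tr : runs env e (DPair v1 v2) s tr -> runs env (Snd e) v2 (s + 1) tr.
Proof. by case=> t h l; exists t.+1; [apply: ESnd h | rewrite mulnDl mul1n; lia]. Qed.

Lemma runs_ispair env e v s tr : runs env e v s tr ->
  runs env (IsPair e) (DInt (if v is DPair _ _ then 1 else 0)) (s + 1) tr.
Proof. by case=> t h l; exists t.+1; [apply: EIsPair h | rewrite mulnDl mul1n; lia]. Qed.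

Lemma runs_if env e e1 e2 z v s1 s2 tr1 tr2 :
  runs env e (DInt z) s1 tr1 -> runs env (if z != 0 then e1 else e2) v s2 tr2 ->
  runs env (If e e1 e2) v (s1 + s2 + 1) (tr1 ++ tr2).
Proof.
case=> t1 h1 l1 [t2 h2 l2]; exists (t1 + t2).+1; first exact: (EIf h1).
rewrite !mulnDl mul1n; lia.
Qed.

Lemma runs_let env e1 e2 v1 v2 s1 s2 tr1 tr2 :
  runs env e1 v1 s1 tr1 -> runs (v1 :: env) e2 v2 s2 tr2 ->
  runs env (Let e1 e2) v2 (s1 + s2 + 1) (tr1 ++ tr2).
Proof.
case=> t1 h1 l1 [t2 h2 l2]; exists (t1 + t2).+1; first exact: (ELet h1).
rewrite !mulnDl mul1n; lia.
Qed.

Lemma runs_call env f e v1 v2 s1 s2 tr1 tr2 : (f < size p)%N ->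
  runs env e v1 s1 tr1 -> runs [:: v1] (nth (Cst 0) p f) v2 s2 tr2 ->
  runs env (Call f e) v2 (s1 + s2 + 1) (tr1 ++ tr2).
Proof.
move=> fp [t1 h1 l1] [t2 h2 l2]; exists (t1 + t2).+1; first exact: (ECall fp h1).
rewrite !mulnDl mul1n; lia.
Qed.

Lemma runs_query env e q a c s tr : runs env e q s tr -> O q a c ->
  runs env (Query e) a (s + 1) (rcons tr (q, c)).
Proof. by case=> t h l o; exists t.+1; [apply: EQuery h o | rewrite mulnDl mul1n; lia]. Qed.

Definition prun env e v s := runs env e v s [::].

Lemma prun_le env e v s s' : prun env e v s -> (s <= s')%N -> prun env e v s'.
Proof. exact: runs_le. Qed.

Lemma prun_var env i v : (i < size env)%N -> nth (DInt 0) env i = v -> prun env (Var i) v 1.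
Proof. exact: runs_var. Qed.

Lemma prun_cst env z : (bitlen z <= L)%N -> prun env (Cst z) (DInt z) 1.
Proof. exact: runs_cst. Qed.

Lemma prun_fst env e v1 v2 s : prun env e (DPair v1 v2) s -> prun env (Fst e) v1 (s + 1).
Proof. exact: runs_fst. Qed.

Lemma prun_snd env e v1 v2 s : prun env e (DPair v1 v2) s -> prun env (Snd e) v2 (s + 1).
Proof. exact: runs_snd. Qed.

Lemma prun_ispair env e v s : prun env e v s ->
  prun env (IsPair e) (DInt (if v is DPair _ _ then 1 else 0)) (s + 1).
Proof. exact: runs_ispair. Qed.

Lemma prun_op env o e1 e2 a b s1 s2 : prun env e1 (DInt a) s1 -> prun env e2 (DInt b) s2 ->
  (bitlen a <= L)%N -> (bitlen b <= L)%N ->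
  prun env (Op o e1 e2) (DInt (op_val o a b)) (s1 + s2 + 1).
Proof. exact: runs_op. Qed.

Lemma prun_opE env o e1 e2 a b v s1 s2 : prun env e1 (DInt a) s1 -> prun env e2 (DInt b) s2 ->
  DInt (op_val o a b) = v ->
  (bitlen a <= L)%N -> (bitlen b <= L)%N ->
  prun env (Op o e1 e2) v (s1 + s2 + 1).
Proof. by move=> h1 h2 <-; apply: prun_op. Qed.

Lemma prun_cons env e1 e2 v1 v2 s1 s2 : prun env e1 v1 s1 -> prun env e2 v2 s2 ->
  prun env (Cons e1 e2) (DPair v1 v2) (s1 + s2 + 1).
Proof. exact: runs_cons. Qed.

Lemma prun_let env e1 e2 v1 v2 s1 s2 : prun env e1 v1 s1 -> prun (v1 :: env) e2 v2 s2 ->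
  prun env (Let e1 e2) v2 (s1 + s2 + 1).
Proof. exact: runs_let. Qed.

Lemma prun_if env e e1 e2 z v s1 s2 : prun env e (DInt z) s1 ->
  prun env (if z != 0 then e1 else e2) v s2 -> prun env (If e e1 e2) v (s1 + s2 + 1).
Proof. exact: runs_if. Qed.

Lemma prun_ifpair env e e1 e2 a b v s1 s2 : prun env e (DPair a b) s1 ->
  prun env e1 v s2 -> prun env (If (IsPair e) e1 e2) v (s1 + 1 + s2 + 1).
Proof. by move=> h1 h2; apply: (@prun_if _ _ _ _ 1) => //; apply: prun_ispair h1. Qed.

Lemma prun_ifint env e e1 e2 z v s1 s2 : prun env e (DInt z) s1 ->
  prun env e2 v s2 -> prun env (If (IsPair e) e1 e2) v (s1 + 1 + s2 + 1).
Proof. by move=> h1 h2; apply: (@prun_if _ _ _ _ 0) => //; apply: prun_ispair h1. Qed.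

Lemma prun_call env f e v1 v2 s1 s2 : (f < size p)%N ->
  prun env e v1 s1 -> prun [:: v1] (nth (Cst 0) p f) v2 s2 ->
  prun env (Call f e) v2 (s1 + s2 + 1).
Proof. exact: runs_call. Qed.

Lemma prun_ifle env ea eb e1 e2 a b v1 v2 sa sb s1 s2 :
  prun env ea (DInt a) sa -> prun env eb (DInt b) sb ->
  (bitlen a <= L)%N -> (bitlen b <= L)%N ->
  (a <= b -> prun env e1 v1 s1) -> (b < a -> prun env e2 v2 s2) ->
  prun env (If (Op Leq ea eb) e1 e2) (if a <= b then v1 else v2) (sa + sb + s1 + s2 + 2).
Proof.
move=> h1 h2 la lb h3 h4; apply: (@prun_le _ _ _ (sa + sb + 1 + (s1 + s2) + 1)); last by lia.
apply: prun_if (prun_op Leq h1 h2 la lb) _.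
rewrite /=; case: (leP a b) => ab /=.
- by apply: prun_le (h3 ab) _; rewrite leq_addr.
- by apply: prun_le (h4 ab) _; rewrite leq_addl.
Qed.

(* Structural recursion on the list in a pair (list, context).  In [consE], [Var 0] is
   the result of the recursive call and [Var 1] the argument of the current one. *)
Definition rec_body (f : nat) (nilE consE : expr) : expr :=
  If (IsPair (Fst (Var 0)))
     (Let (Call f (Cons (Snd (Fst (Var 0))) (Snd (Var 0)))) consE) nilE.

(** As the recursive call comes first, the invariant [I] is about suffixes, and the calls made for
    the tail precede those of the head in the trace. The prefix [pre] records that the suffix
    belongs to [ys], which yields bounds on its length and its entries. *)
Lemma runs_rec (T : Type) (enc : T -> data) f nilE consE ctx (ys : seq T)
    (I : seq T -> data -> trace -> Prop) s0 s1 a0 :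
  (f < size p)%N -> nth (Cst 0) p f = rec_body f nilE consE ->
  prun [:: DPair (DInt 0) ctx] nilE a0 s0 -> I [::] a0 [::] ->
  (forall pre y ys' a tr, ys = pre ++ y :: ys' -> I ys' a tr ->
    exists a' tr', runs [:: a; DPair (DPair (enc y) (enc_list (map enc ys'))) ctx] consE a' s1 tr'
      /\ I (y :: ys') a' (tr ++ tr')) ->
  forall env e s, prun env e (DPair (enc_list (map enc ys)) ctx) s ->
  exists a tr, runs env (Call f e) a (s + s0 + size ys * (s1 + 20) + 10) tr /\ I ys a tr.
Proof.
move=> fp Ef Hnil I0 Hcons.
have H : forall pre zs, ys = pre ++ zs -> forall env e s, prun env e (DPair (enc_list (map enc zs)) ctx) s ->
  exists a tr, runs env (Call f e) a (s + s0 + size zs * (s1 + 20) + 10) tr /\ I zs a tr.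
  move=> pre zs; elim: zs pre => [|z zs IH] pre E env e s he.
    exists a0, [::]; split=> //.
    apply: (@runs_le _ _ _ (s + (3 + s0 + 1) + 1)); last by rewrite /=; lia.
    apply: prun_call he _ => //; rewrite Ef; apply: (@prun_if _ _ _ _ 0) => //.
    apply: (@runs_ispair _ _ (DInt 0) 2).
    by apply: (@runs_fst _ _ _ ctx 1); apply: runs_var.
  have E' : ys = rcons pre z ++ zs by rewrite cat_rcons.
  set x := DPair (enc_list (map enc (z :: zs))) ctx in he *.
  have rx : prun [:: x] (Var 0) x 1 by apply: runs_var.
  have r1 : prun [:: x] (Cons (Snd (Fst (Var 0))) (Snd (Var 0))) (DPair (enc_list (map enc zs)) ctx) 6.
    apply: (@prun_cons _ _ _ _ _ 3 2).
      by apply: (@runs_snd _ _ (enc z) _ 2); apply: (@runs_fst _ _ _ ctx 1).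
    exact: (@runs_snd _ _ _ _ 1) rx.
  have [a [tr [ra Ia]]] := IH _ E' _ _ _ r1.
  have [a' [tr' [ra' Ia']]] := Hcons _ _ _ _ _ E Ia.
  exists a', (tr ++ tr'); split=> //.
  have rb : runs [:: x] (nth (Cst 0) p f) a' (3 + ((6 + s0 + size zs * (s1 + 20) + 10) + s1 + 1) + 1) ([::] ++ (tr ++ tr')).
    rewrite Ef; apply: (@runs_if _ _ _ _ 1) => /=.
      apply: (@runs_ispair _ _ (enc_list (map enc (z :: zs))) 2).
      exact: (@runs_fst _ _ _ ctx 1).
    exact: (runs_let ra).
  apply: (runs_le (runs_call fp he rb)).
  rewrite /=; lia.
by move=> env e s; apply: (H [::]).
Qed.

Lemma prun_rec (T : Type) (enc : T -> data) f nilE consE ctx (ys : seq T)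
    (acc : seq T -> data) s0 s1 :
  (f < size p)%N -> nth (Cst 0) p f = rec_body f nilE consE ->
  prun [:: DPair (DInt 0) ctx] nilE (acc [::]) s0 ->
  (forall pre y ys', ys = pre ++ y :: ys' ->
    prun [:: acc ys'; DPair (DPair (enc y) (enc_list (map enc ys'))) ctx] consE (acc (y :: ys')) s1) ->
  forall env e s, prun env e (DPair (enc_list (map enc ys)) ctx) s ->
  prun env (Call f e) (acc ys) (s + s0 + size ys * (s1 + 20) + 10).
Proof.
move=> fp Ef Hnil Hcons env e s he.
have [||a [tr []]] := @runs_rec T enc f nilE consE ctx ys
  (fun zs a tr => a = acc zs /\ tr = [::]) s0 s1 _ fp Ef Hnil _ _ env e s he => //.
  by move=> pre y ys' a tr E [-> ->]; exists (acc (y :: ys')), [::]; split=> //; apply: Hcons E.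
by move=> ra [Ea Et]; rewrite -Ea; move: ra; rewrite Et.
Qed.

End Runs.

(** * The program *)

Definition hd (i : nat) := Fst (Fst (Var i)).
Definition tl (i : nat) := Snd (Fst (Var i)).
Definition cx (i : nat) := Snd (Var i).
(** Fields of an instance, in the order of [enc_inst]: 0 laws, 1 [D], 2 layer scale, 3 n, 4 k, 5
    [D ^ n], 6 cap, 7 multiples b, 8 radix, 9 rounding scale, 10 powers, 11 thresholds, 12 initial
    vector of the dynamic program, 13 targets, 14 cutoffs. *)
Definition fld (i : nat) (e : expr) := Fst (iter i Snd e).

Definition pow_e b e := Call 2 (Cons (Call 1 e) b).
Definition exc_e l a c := Call 8 (Cons l (Cons a c)).
(** The excess at an integer c sums P(X > j) over [j >= c], so that a difference of consecutive
    excesses is P(X > c), times [D]. *)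
Definition pn_e l c K :=
  Op Sub (exc_e l (fld 2 K) c) (exc_e l (fld 2 K) (Op Add c (Cst 1))).

(* Loops run over the list N, ..., 1; a loop on l >= 0 uses l - 1 for l in such a list. *)
Definition f_down :=
  If (Op Leq (Cst 1) (Var 0)) (Cons (Var 0) (Call 1 (Op Sub (Var 0) (Cst 1)))) (Cst 0).
Definition f_pow := rec_body 2 (Cst 1) (Op Mul (Var 0) (cx 1)).
Definition f_len := rec_body 3 (Cst 0) (Op Add (Var 0) (Cst 1)).
Definition f_den_law := rec_body 4 (Cst 1)
  (Op Mul (Var 0) (Op Mul (Snd (Fst (hd 1))) (Snd (Snd (hd 1))))).
Definition f_den := rec_body 5 (Cst 1) (Op Mul (Var 0) (Call 4 (Cons (hd 1) (Cst 0)))).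
Definition f_scale_law := rec_body 6 (Cst 0)
  (Cons (Cons (Op Mul (Fst (Fst (hd 1))) (Op Div (cx 1) (Snd (Fst (hd 1)))))
              (Op Mul (Fst (Snd (hd 1))) (Op Div (cx 1) (Snd (Snd (hd 1)))))) (Var 0)).
Definition f_scale := rec_body 7 (Cst 0) (Cons (Call 6 (Cons (hd 1) (cx 1))) (Var 0)).
Definition y_e := Op Sub (Op Mul (Fst (cx 1)) (Fst (hd 1))) (Snd (cx 1)).
Definition f_exc := rec_body 8 (Cst 0)
  (If (Op Leq (Cst 0) y_e) (Op Add (Var 0) (Op Mul (Snd (hd 1)) y_e)) (Var 0)).
(** Each digit is appended below the number packed so far. The initial value is thus the most
    significant part; in the end this is the tail digit. *)
Definition f_dig := let K := Snd (Snd (cx 1)) in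
  rec_body 9 (Fst (Snd (cx 0)))
  (Op Add (Op Mul (Var 0) (fld 8 K))
     (Op Div (Op Mul (fld 9 K) (pow_e (Fst (cx 1)) (hd 1))) (pow_e (fld 1 K) (hd 1)))).
Definition f_thr := let B := Fst (Snd (Snd (cx 1))) in let K := Snd (Snd (Snd (cx 1))) in
  rec_body 10 (Fst (Snd (cx 0)))
  (Call 9 (Cons (fld 10 K) (Cons (pn_e (Fst (cx 1)) (Op Mul (hd 1) B) K) (Cons (Var 0) K)))).
(** The tail digit [tw] counts units of [k * B / n]. Beyond the cap it is replaced by [cap + 1],
    which keeps the magnitude small and still excludes the item from every sum of tail digits up to
    the cap. *)
Definition f_weights :=
  let B := Fst (cx 1) in let l := Fst (Snd (cx 1)) in let K := Snd (Snd (cx 1)) in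
  let en := Op Mul (exc_e (hd 1) (fld 2 K) (Op Mul l B)) (fld 3 K) in
  let Dkb := Op Mul (Op Mul (fld 1 K) (fld 4 K)) B in
  let tw := If (Op Leq en (Op Mul (fld 6 K) Dkb)) (Op Div en Dkb) (Op Add (fld 6 K) (Cst 1)) in
  rec_body 11 (Cst 0)
  (Cons (Call 10 (Cons (fld 11 K) (Cons (hd 1) (Cons tw (Cons B K))))) (Var 0)).
(** An unselected item keeps its place with an empty law, of exceedance 0, so that the scores of all
    sets carry the same power of [D]. *)
Definition f_sel :=
  If (IsPair (Fst (Var 0)))
     (Cons (If (Fst (Snd (Var 0))) (Fst (Fst (Var 0))) (Cst 0))
           (Call 12 (Cons (Snd (Fst (Var 0))) (Snd (Snd (Var 0))))))
     (Cst 0).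
Definition f_sum_exc := rec_body 13 (Cst 0)
  (Op Add (Var 0) (exc_e (hd 1) (Fst (cx 1)) (Snd (cx 1)))).
(** The vector holds, for [j < k], the deficit [k - E min(k, j + N)] times a power of [D]. The
    deficit vanishes from k on: a missing entry is 0, k entries suffice, and the vector of the empty
    sum is k, ..., 1. *)
Definition f_step := rec_body 14 (Cst 0)
  (Cons (Op Add (Op Mul (Fst (cx 1)) (If (IsPair (tl 1)) (Fst (tl 1)) (Cst 0)))
                (Op Mul (Op Sub (Snd (cx 1)) (Fst (cx 1))) (hd 1))) (Var 0)).
Definition f_dp := rec_body 15 (fld 12 (Snd (cx 0)))
  (Call 14 (Cons (Var 0) (Cons (pn_e (hd 1) (Fst (cx 1)) (Snd (cx 1))) (fld 1 (Snd (cx 1)))))).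
Definition f_sum_dp := rec_body 16 (Cst 0)
  (Op Add (Var 0) (Fst (Call 15 (Cons (Fst (cx 1))
     (Cons (Op Mul (hd 1) (Fst (Snd (cx 1)))) (Snd (Snd (cx 1)))))))).
Definition f_targets :=
  let w := Fst (Snd (cx 1)) in
  rec_body 17 (Fst (cx 0))
  (Let (Query (Cons w (Op Sub (hd 1) (Cst 1))))
   (If (IsPair (Var 0))
     (Let (Call 12 (Cons (fld 0 (Snd (Snd (Snd (Snd (cx 2)))))) (Snd (Var 0))))
     (let B := Fst (Snd (Snd (cx 3))) in let l := Fst (Snd (Snd (Snd (cx 3)))) in
      let K := Snd (Snd (Snd (Snd (cx 3)))) in
      (Let (Op Add (Op Mul (fld 5 K) (Call 13 (Cons (Var 0) (Cons (fld 2 K) (Op Mul l B)))))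
                   (Op Mul (fld 1 K) (Op Sub (Op Mul (Op Mul (Op Mul (fld 4 K) l) B) (fld 5 K))
                      (Op Mul B (Call 16 (Cons (fld 11 K) (Cons (Var 0) (Cons B K))))))))
      (If (IsPair (Var 3))
          (If (Op Leq (Fst (Var 3)) (Var 0)) (Var 3) (Cons (Var 0) (Snd (Var 2))))
          (Cons (Var 0) (Snd (Var 2)))))))
     (Var 1))).
Definition f_cutoffs := let l := Op Sub (hd 1) (Cst 1) in
  let B := Fst (Snd (cx 1)) in let K := Snd (Snd (cx 1)) in
  rec_body 18 (Fst (cx 0))
  (Call 17 (Cons (fld 13 K) (Cons (Var 0)
     (Cons (Call 11 (Cons (fld 0 K) (Cons B (Cons l K)))) (Cons B (Cons l K)))))).
Definition f_scales := let K := Snd (Snd (cx 1)) in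
  rec_body 19 (Fst (cx 0))
  (Call 18 (Cons (fld 14 K) (Cons (Var 0)
     (Cons (Op Mul (Op Sub (hd 1) (Cst 1)) (Fst (Snd (cx 1)))) K)))).
(** At scale 1 and cutoff 0 the excess is [D ^ 2] times the mean of the item, the base of the
    candidates for B. *)
Definition f_items := rec_body 20 (Cst 0)
  (Call 19 (Cons (fld 7 (cx 1)) (Cons (Var 0) (Cons (exc_e (hd 1) (Cst 1) (Cst 0)) (cx 1))))).

(* The rounding resolution and the radix of [gran] and [small_base] below. *)
Definition f_small :=
  let k := Fst (Var 0) in let m := Fst (Snd (Var 0)) in
  Let (Op Mul m m)
  (Let (Op Mul (Cst 544) (Var 0))
  (Let (Op Mul (Fst (Var 2)) (Var 1))
  (Let (Op Mul (Snd (Snd (Var 3)))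
     (Op Mul (Op Mul (Op Mul (Cst 32) (Op Mul (Var 2) (Var 2))) (Op Add (Var 1) (Cst 1)))
             (pow_e (Op Mul (Cst 68) (Var 2)) (Var 1))))
  (Let (Op Add (Op Mul (Snd (Snd (Var 4))) (Var 0)) (Cst 1))
  (Cons (Var 0) (Cons (Var 1) (Cons (Call 1 (Var 3)) (Cons (Call 1 (Op Sub (Var 2) (Cst 1)))
  (Cons (Call 1 (Fst (Var 5)))
  (Cons (Call 1 (pow_e (Var 0) (Op Add (Op Mul (Op Sub (Var 2) (Cst 1)) (Var 3)) (Cst 1))))
  (Cons (Cons (Op Add (Var 2) (Cst 1)) (Cst 0)) (Cst 0)))))))))))).
Definition f_main :=
  let laws i := Fst (Snd (Var i)) in let k i := Fst (Snd (Snd (Var i))) in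
  let num i := Fst (Snd (Snd (Snd (Var i)))) in let den i := Snd (Snd (Snd (Snd (Var i)))) in
  Let (Op Add (Op Div (den 0) (num 0)) (Cst 1))
  (Let (Call 3 (Cons (laws 1) (Cst 0)))
  (Let (Call 5 (Cons (laws 2) (Cst 0)))
  (let cap := Op Mul (Op Mul (Cst 2) (Var 1)) (Var 2) in
  (Let (If (Op Leq (Op Mul (Cst 16) (Op Mul (den 3) (den 3))) (Op Mul (k 3) (Op Mul (num 3) (num 3))))
     (Cons (Cst 1) (Cons (Cst 1) (Cons (Cst 0) (Cons (Cst 0) (Cons (Cst 0)
       (Cons (Call 1 (Op Add cap (Cst 1)))
       (Cons (Call 1 (Op Add (Op Mul (Cst 2) (Var 2)) (Cst 2))) (Cst 0))))))))
     (Call 21 (Cons (k 3) (Cons (Var 2) (Var 1)))))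
  (Let (Call 7 (Cons (laws 4) (Var 1)))
  (Snd (Call 20 (Cons (Var 0)
    (Cons (Var 0) (Cons (Var 2) (Cons (Op Mul (Op Mul (Var 2) (k 5)) (Var 4)) (Cons (Var 3)
    (Cons (k 5) (Cons (pow_e (Var 2) (Var 3)) (Cons (Op Mul (Op Mul (Cst 2) (Var 3)) (Var 4))
    (Cons (Call 1 (Op Add (Var 3) (Cst 1))) (Var 1))))))))))))))))).

Definition prog : program :=
  [:: f_main; f_down; f_pow; f_len; f_den_law; f_den; f_scale_law; f_scale; f_exc;
      f_dig; f_thr; f_weights; f_sel; f_sum_exc; f_step; f_dp; f_sum_dp;
      f_targets; f_cutoffs; f_scales; f_items; f_small].

(** * Integer values computed by the program *)

Fixpoint down (N : nat) : seq nat := if N is N'.+1 then N :: down N' else [::].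

Definition enc_nat (x : nat) := DInt x%:Z.
Definition enc_atom (a : int * int) := DPair (DInt a.1) (DInt a.2).
Definition enc_il (l : seq (int * int)) := enc_list (map enc_atom l).

Fixpoint excz (l : seq (int * int)) (al c : int) : int :=
  if l is a :: l' then
    if 0 <= al * a.1 - c then excz l' al c + a.2 * (al * a.1 - c) else excz l' al c
  else 0.

Definition atoms_sz e (l : seq (int * int)) :=
  all (fun a => (`|a.1| < 2 ^ e)%N && (`|a.2| < 2 ^ e)%N) l.

Lemma sz_excz l al c e ec : atoms_sz e l -> sz al e -> sz c ec ->
  sz (excz l al c) (3 * e + ec + 2 + size l).
Proof.
move=> + sza szc; elim: l => [|[x q] l IH] /=; first by move=> _; apply: sz0.
move=> /andP[/andP[szx szq] /IH{}IH].
have szx' : sz x e by []. have szq' : sz q e by [].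
case: ifP => _; last by apply: sz_le IH _; lia.
rewrite addnS; apply: sz_add_max => //.
by apply: sz_le; [apply: sz_mul szq' (sz_sub (sz_mul sza szx') szc) | lia].
Qed.

Lemma size_down N : size (down N) = N.
Proof. by elim: N => //= N ->. Qed.

Ltac ev_call := fail.
Ltac ev :=
  lazymatch goal with
  | |- prun _ _ _ _ (Var _) _ _ => apply: prun_var; [done | reflexivity]
  | |- prun _ _ _ _ (Cst _) _ _ => apply: prun_cst
  | |- prun _ _ _ _ (Fst _) _ _ => eapply prun_fst; ev
  | |- prun _ _ _ _ (Snd _) _ _ => eapply prun_snd; ev
  | |- prun _ _ _ _ (Op _ _ _) _ _ => eapply prun_opE; [ev | ev | cbn [op_val]; reflexivity | idtac | idtac]
  | |- prun _ _ _ _ (Defs.Cons _ _) _ _ => eapply prun_cons; ev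
  | |- prun _ _ _ _ (Let _ _) _ _ => eapply prun_let; ev
  | |- prun _ _ _ _ (IsPair _) _ _ => eapply prun_ispair; ev
  | |- prun _ _ _ _ (hd _) _ _ => rewrite /hd; ev
  | |- prun _ _ _ _ (tl _) _ _ => rewrite /tl; ev
  | |- prun _ _ _ _ (cx _) _ _ => rewrite /cx; ev
  | |- prun _ _ _ _ (fld _ _) _ _ => rewrite /fld /=; ev
  | |- prun _ _ _ _ (Call _ _) _ _ => ev_call
  | _ => idtac
  end.

Ltac bits :=
  match goal with
  | |- is_true (bitlen _ <= _)%N => cbn [fst snd]; eapply sz_bitlen; [bits | idtac]
  | H : sz ?z _ |- sz ?z _ => exact H
  | |- sz (_ * _)%R _ => eapply sz_mul; bits
  | |- sz (_ + _)%R _ => eapply sz_add; bits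
  | |- sz (- _)%R _ => eapply sz_opp; bits
  | |- sz (divz _ _) _ => eapply sz_div; bits
  | |- sz (op_val _ _ _) _ => rewrite /op_val; bits
  | |- sz 0 _ => exact: (sz0 0)
  | |- sz _ _ => exact: sz_cst
  end.

Section Functions.
Variables (O : oracle) (L : nat).
Local Notation prun := (prun prog O L).
Local Notation p := prog.
Hypothesis L_ge : (20 <= L)%N.

Lemma bit0 : (bitlen 0 <= L)%N. Proof. exact: leq_trans L_ge. Qed.
Lemma bit1 : (bitlen 1 <= L)%N. Proof. exact: leq_trans L_ge. Qed.
Local Hint Resolve bit0 bit1 : core.

Lemma prun_down N e env x s : sz N%:Z e -> (e < L)%N -> prun env x (DInt N%:Z) s ->
  prun env (Call 1 x) (enc_list (map enc_nat (down N))) (s + 12 * N.+1).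
Proof.
have p1 : (1 < size prog)%N by []. have E1 : nth (Cst 0) prog 1 = f_down by [].
move=> szN eL; elim: N szN env x s => [|N IH] szN env x s hx.
  have h : prun [:: DInt 0%:Z] (nth (Cst 0) p 1) (DInt 0) 6.
    rewrite E1 /f_down; apply: (@prun_le p O L _ _ _ ((1 + 1 + 1) + 1 + 1)) => //.
    apply: (@prun_if _ _ _ _ _ _ _ 0) => /=; last exact: prun_cst.
    apply: (@prun_op _ _ _ _ Leq _ _ 1 0); [apply: prun_cst | apply: prun_var | ..] => //; lia.
  by apply: prun_le (prun_call p1 hx h) _; lia.
have szN' : sz N%:Z e by move: szN; rewrite /sz; lia.
have bN : (bitlen N.+1%:Z <= L)%N by apply: sz_bitlen szN eL.
have h : prun [:: DInt N.+1%:Z] (nth (Cst 0) p 1) (enc_list (map enc_nat (down N.+1))) (11 + 12 * N.+1).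
  rewrite E1 /f_down.
  apply: (@prun_le p O L _ _ _ ((1 + 1 + 1) + (1 + ((1 + 1 + 1) + 12 * N.+1) + 1) + 1)); last by lia.
  apply: (@prun_if _ _ _ _ _ _ _ 1) => /=.
    by apply: (@prun_op _ _ _ _ Leq _ _ 1 N.+1%:Z); [apply: prun_cst | apply: prun_var | ..] => //; lia.
  apply: prun_cons; first by apply: prun_var.
  apply: (IH szN'); have -> : N%:Z = op_val Sub N.+1%:Z 1 by rewrite /=; lia.
  by apply: (prun_op Sub); [apply: prun_var | apply: prun_cst | ..] => //; lia.
by apply: prun_le (prun_call p1 hx h) _; lia.
Qed.

Lemma prun_pow (b : int) N e eN env xb xN s1 s2 : sz b e -> sz N%:Z eN ->
  (eN < L)%N -> (N * e + e + 1 < L)%N ->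
  prun env xb (DInt b) s1 -> prun env xN (DInt N%:Z) s2 ->
  prun env (pow_e xb xN) (DInt (b ^+ N)) (s1 + s2 + 40 * N.+1).
Proof.
have p2 : (2 < size prog)%N by []. have E2 : nth (Cst 0) prog 2 = f_pow by [].
move=> szb szN eNL eL hb hN; rewrite /pow_e.
have h1 := prun_cons (prun_down szN eNL hN) hb.
have := prun_rec (acc := fun s : seq nat => DInt (b ^+ size s)) (s0 := 1) (s1 := 5) p2 E2 _ _ h1.
rewrite size_down => H; apply: prun_le (H _ _) _.
- by apply: prun_cst.
- move=> pre y ys E; rewrite -[5%N]/(1 + 2 + 1 + 1)%N; apply: prun_le.
    rewrite [size _]/= exprSr; apply: (prun_op Mul); ev.
    - have szp : sz (b ^+ size ys) (size ys * e).+1.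
        elim: (size ys) => [|q IHq]; first exact: sz_small.
        by rewrite exprS; apply: sz_le (sz_mul szb IHq) _; lia.
      apply: sz_bitlen szp _.
      have : (size ys < N)%N by rewrite -(size_down N) E size_cat /=; lia.
      by nia.
    - by apply: sz_bitlen szb _; lia.
  by [].
- lia.
Qed.

Lemma prun_exc (l : seq (int * int)) (al c : int) e ec env xl xa xc s1 s2 s3 :
  (size l <= e)%N -> atoms_sz e l ->
  sz al e -> sz c ec -> (4 * e + ec + 10 < L)%N ->
  prun env xl (enc_il l) s1 -> prun env xa (DInt al) s2 -> prun env xc (DInt c) s3 ->
  prun env (exc_e xl xa xc) (DInt (excz l al c)) (s1 + s2 + s3 + 100 * e.+1).
Proof.
have p8 : (8 < size prog)%N by []. have E8 : nth (Cst 0) prog 8 = f_exc by [].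
move=> le_e al_e sza szc eL hl ha hc; rewrite /exc_e.
have h1 := prun_cons hl (prun_cons ha hc).
have := prun_rec (acc := fun s => DInt (excz s al c)) (s0 := 1) (s1 := 60) p8 E8 _ _ h1.
move=> H; apply: prun_le (H _ _) _; last by nia.
- exact: prun_cst.
- move=> pre [x q] ys E.
  have := al_e; rewrite /atoms_sz E all_cat /= => /andP[_ /andP[/andP[szx szq] ysz]].
  have ys_e : (size ys <= e)%N by move: le_e; rewrite E size_cat /=; lia.
  have -> : DInt (excz ((x, q) :: ys) al c) = if 0 <= al * x - c
     then DInt (excz ys al c + q * (al * x - c)) else DInt (excz ys al c) by rewrite /=; case: ifP.
  have sze := sz_excz ysz sza szc.
  have szx' : sz x e by []. have szq' : sz q e by [].
  rewrite /y_e; apply: prun_le; first apply: prun_ifle.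
  + exact: prun_cst.
  + by ev; first [done | bits; lia].
  + by [].
  + by bits; lia.
  + by move=> _; ev; bits; lia.
  + by move=> _; ev.
  + by rewrite /=.
Qed.

End Functions.

(* [i_il] lists the laws and [i_al] is the layer scale; [i_cap] truncates the tail
   digit; [i_Bs] is the radix; [i_nG] is the scale at which the [i_R] first power sums
   are rounded at each of the [i_Ls] thresholds; [i_T] bounds the targets; [i_Ll] lists
   the candidates for [l], shifted by one. *)
Record inst := Inst {
  i_il : seq (seq (int * int));
  i_D : int; i_al : int; i_n : int; i_k : int; i_Dn : int; i_cap : int;
  i_bl : nat;
  i_Bs : int; i_nG : int;
  i_R : nat; i_Ls : nat; i_kn : nat; i_T : nat;
  i_Ll : seq nat }.

Definition enc_ils ls := enc_list (map enc_il ls).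
Definition enc_down N := enc_list (map enc_nat (down N)).

Definition enc_params_of (K : inst) : data :=
  DPair (DInt (i_Bs K)) (DPair (DInt (i_nG K)) (DPair (enc_down (i_R K))
  (DPair (enc_down (i_Ls K)) (DPair (enc_down (i_kn K)) (DPair (enc_down (i_T K))
  (DPair (enc_list (map enc_nat (i_Ll K))) (DInt 0))))))).

Definition enc_inst (K : inst) : data :=
  DPair (enc_ils (i_il K)) (DPair (DInt (i_D K)) (DPair (DInt (i_al K))
  (DPair (DInt (i_n K)) (DPair (DInt (i_k K)) (DPair (DInt (i_Dn K)) (DPair (DInt (i_cap K))
  (DPair (enc_down (i_bl K)) (enc_params_of K)))))))).

Section Specs.
Variable K : inst.

Definition pnz l c := excz l (i_al K) c - excz l (i_al K) (c + 1).

Definition digz pn rs init : int := foldr (fun r acc =>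
  acc * i_Bs K + ((i_nG K * pn ^+ r) %/ (i_D K ^+ r))%Z) init rs.

Definition thrz l (B : int) (ls : seq nat) init : int := foldr (fun l' acc =>
  digz (pnz l (l'%:Z * B)) (down (i_R K)) acc) init ls.

Definition twz l (B lt : int) : int :=
  let en := excz l (i_al K) (lt * B) * i_n K in let q := i_D K * i_k K * B in
  if en <= i_cap K * q then (en %/ q)%Z else i_cap K + 1.

Definition wz B lt l : int := thrz l B (down (i_Ls K)) (twz l B lt).

Fixpoint selz (ls : seq (seq (int * int))) (bs : seq bool) : seq (seq (int * int)) :=
  match ls, bs with
  | l :: ls', b :: bs' => (if b then l else [::]) :: selz ls' bs'
  | _, _ => [::]
  end.

Definition sumez (ls : seq (seq (int * int))) (c : int) : int :=
  foldr (fun l acc => acc + excz l (i_al K) c) 0 ls.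

Fixpoint stepz (a : int) (v : seq int) : seq int :=
  if v is x :: v' then (a * head 0 v' + (i_D K - a) * x) :: stepz a v' else [::].

Definition dpz (c : int) (ls : seq (seq (int * int))) : seq int :=
  foldr (fun l v => stepz (pnz l c) v) [seq x%:Z | x <- down (i_kn K)] ls.

Definition sumdz ls (B : int) (js : seq nat) : int :=
  foldr (fun j acc => acc + head 0 (dpz (j%:Z * B) ls)) 0 js.

Definition scorez ls (B lt : int) : int :=
  i_Dn K * sumez ls (lt * B) +
  i_D K * (i_k K * lt * B * i_Dn K - B * sumdz ls B (down (i_Ls K))).

End Specs.

(** One exponent for all entries, except for the number of targets, which is a power of the radix
    and gets [e ^ 4]. The alternative on [i_Ls] and [i_kn] ensures that the vector of the dynamic
    program is nonempty whenever its head is read. *)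
Record bounded (e : nat) (K : inst) : Prop := Bounded {
  b_il : (size (i_il K) <= e)%N;
  b_laws : all (fun l => (size l <= e)%N && atoms_sz e l) (i_il K);
  b_D : sz (i_D K) e; b_al : sz (i_al K) e; b_n : sz (i_n K) e; b_k : sz (i_k K) e;
  b_Dn : sz (i_Dn K) e; b_cap : sz (i_cap K) e; b_bl : (i_bl K <= e)%N;
  b_Bs : sz (i_Bs K) e; b_nG : sz (i_nG K) e;
  b_R : (i_R K <= e)%N; b_Ls : (i_Ls K <= e)%N; b_kn : (i_kn K <= e)%N;
  b_Ls_kn : i_Ls K = 0%N \/ (0 < i_kn K)%N;
  b_T : sz (i_T K)%:Z (e * e * e * e);
  b_Ll : (size (i_Ll K) <= e)%N; b_Ll_sz : all (fun l => (l < 2 ^ e)%N && (0 < l)%N) (i_Ll K) }.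

Lemma mem_down N x : x \in down N -> (0 < x <= N)%N.
Proof. by elim: N => //= N IH; rewrite inE => /orP[/eqP->|/IH]; lia. Qed.

Lemma sz_exp b e r : sz b e -> sz (b ^+ r) (r * e).+1.
Proof.
move=> szb; elim: r => [|r IH]; first exact: sz_small.
by rewrite exprS; apply: sz_le (sz_mul szb IH) _; lia.
Qed.

Lemma nat_sz N e : (N <= e)%N -> sz N%:Z e.
Proof. by rewrite /sz absz_nat => h; apply: leq_ltn_trans h _; apply: ltn_expl. Qed.

Ltac split_pre E := rewrite E ?all_cat ?size_cat /=.

(** * Cost of the functions that make no external call *)

Section PureFunctions.
Variables (O : oracle) (L e : nat) (K : inst).
Local Notation prun := (prun prog O L).
Hypothesis e_gt0 : (0 < e)%N.
Hypothesis HK : bounded e K.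
Hypothesis HL : (1000 * (e * e * e * e) < L)%N.

Let L_ge : (20 <= L)%N.
Proof. by have : (1 <= e * e * e * e)%N by [rewrite !muln_gt0 e_gt0]; lia. Qed.

Let epow : [/\ e <= e * e, e * e <= e * e * e & e * e * e <= e * e * e * e]%N.
Proof. by split; rewrite leq_pmulr. Qed.

Let bit0 : (bitlen 0 <= L)%N. Proof. exact: leq_trans L_ge. Qed.
Let bit1 : (bitlen 1 <= L)%N. Proof. exact: leq_trans L_ge. Qed.

Lemma sz_pnz l c : (size l <= e)%N -> atoms_sz e l -> sz c (2 * e) ->
  sz (pnz K l c) (20 * e).
Proof.
move=> sl al sc; have sc1 : sz (c + 1) (2 * e + 1 + 1).
  by apply: sz_le (sz_add sc (sz_cst 1)) _; lia.
apply: sz_le (sz_sub (sz_excz al (b_al HK) sc) (sz_excz al (b_al HK) sc1)) _; lia.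
Qed.

Lemma prun_pn l c env xl xc xK s1 s2 s3 : (size l <= e)%N -> atoms_sz e l -> sz c (2 * e) ->
  prun env xl (enc_il l) s1 -> prun env xc (DInt c) s2 -> prun env xK (enc_inst K) s3 ->
  prun env (pn_e xl xc xK) (DInt (pnz K l c)) (2 * (s1 + s2 + s3) + 450 * e).
Proof.
move=> sl al sc hl hc hK; have [h1 h2 h3] := epow.
have sc1 : sz (c + 1) (2 * e + 2).
  by apply: sz_le (sz_add sc (sz_cst 1)) _; lia.
have sza := b_al HK.
have q1 : sz (excz l (i_al K) c) (3 * e + 2 * e + 2 + size l) by apply: sz_excz.
have q2 : sz (excz l (i_al K) (c + 1)) (3 * e + (2 * e + 2) + 2 + size l) by apply: sz_excz.
have ha : prun env (fld 2 xK) (DInt (i_al K)) (s3 + 3).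
  by apply: prun_le; [rewrite /fld /=; repeat (first [eapply prun_fst | eapply prun_snd]); exact: hK | lia].
have hc1 : prun env (Op Add xc (Cst 1)) (DInt (c + 1)) (s2 + 1 + 1).
  by eapply prun_opE; [exact: hc | exact: prun_cst | by [] | bits; lia | exact: bit1].
rewrite /pn_e /pnz; apply: prun_le.
  eapply prun_opE.
  - eapply (@prun_exc O L L_ge l (i_al K) c e (2 * e)) => //; [lia | exact: hl | exact: ha | exact: hc].
  - eapply (@prun_exc O L L_ge l (i_al K) (c + 1) e (2 * e + 2)) => //; [lia | exact: hl | exact: ha | exact: hc1].
  - by [].
  - by bits; lia.
  - by bits; lia.
lia.
Qed.

Lemma sz_digz pn rs init s : sz pn (20 * e) -> all (fun r => (r <= e)%N) rs -> sz init s ->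
  sz (digz K pn rs init) (s + size rs * (24 * (e * e))).
Proof.
move=> szp + si; elim: rs => [|r rs IH] /=; first by rewrite mul0n addn0.
case/andP=> re /IH{}IH.
have szn := b_nG HK; have szB := b_Bs HK.
apply: sz_le (sz_add (sz_mul IH szB) (sz_div _ (sz_mul szn (sz_exp r szp)))) _.
have [h1 h2 h3] := epow.
have : (r * (20 * e) <= e * (20 * e))%N by rewrite leq_mul2r re orbT.
lia.
Qed.

Lemma prun_dig pn init s env x s1 : sz pn (20 * e) -> sz init s ->
  (s + 30 * (e * e * e) < L)%N ->
  prun env x (DPair (enc_down (i_R K)) (DPair (DInt pn) (DPair (DInt init) (enc_inst K)))) s1 ->
  prun env (Call 9 x) (DInt (digz K pn (down (i_R K)) init)) (s1 + 500 * (e * e)).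
Proof.
move=> szp si sL hx; have [h1 h2 h3] := epow.
have := prun_rec (acc := fun rs => DInt (digz K pn rs init)) (s0 := 4) (s1 := 80 * e + 150)
  (isT : (9 < size prog)%N) erefl _ _ hx.
have szD := b_D HK; have szn := b_nG HK; have szB := b_Bs HK.
rewrite size_down => H; apply: prun_le (H _ _) _.
- by apply: prun_le; [ev | ].
- move=> pre r rs E.
  have re : all (fun r => (r <= e)%N) (down (i_R K)).
    by apply/allP => y /mem_down /andP[_ ye]; apply: leq_trans ye (b_R HK).
  have rsR : (size (r :: rs) <= i_R K)%N by rewrite -(size_down (i_R K)) E size_cat leq_addl.
  have bR := b_R HK.
  move: re; split_pre E => /andP[_ /andP[re rse]].
  have szr : sz r%:Z e by apply: nat_sz.
  have szd := sz_digz szp rse si.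
  have q : (size rs * (24 * (e * e)) <= e * (24 * (e * e)))%N.
    by rewrite leq_mul2r; apply/orP; right; move: rsR => /=; lia.
  have q2 : (r * (20 * e) <= e * (20 * e))%N by rewrite leq_mul2r re orbT.
  have q3 : (r * e <= e * e)%N by rewrite leq_mul2r re orbT.
  have szp' := sz_exp r szp; have szD' := sz_exp r szD.
  apply: prun_le; first (eapply prun_opE; [ev | eapply prun_opE; [ev | | cbn [op_val]; reflexivity | idtac | idtac] | cbn [op_val]; reflexivity | idtac | idtac]).
  + by bits; lia.
  + by bits; lia.
  + eapply (prun_pow L_ge szp szr); [lia | lia | ev | ev].
  + by bits; lia.
  + by bits; lia.
  + eapply (prun_pow L_ge szD szr); [lia | lia | ev | ev].
  + by bits; lia.
  + by bits; lia.
  + by bits; lia.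
  + by bits; lia.
  + rewrite /=; lia.
- have bR := b_R HK.
  have q : (i_R K * (80 * e + 150 + 20) <= e * (80 * e + 150 + 20))%N by rewrite leq_mul2r bR orbT.
  lia.
Qed.

Lemma sz_thrz l B ls init s : (size l <= e)%N -> atoms_sz e l -> sz B e ->
  all (fun j => (j <= e)%N) ls -> sz init s ->
  sz (thrz K l B ls init) (s + size ls * (24 * (e * e * e))).
Proof.
move=> sl al szB + si; elim: ls => [|j ls IH] /=; first by rewrite mul0n addn0.
case/andP=> je /IH{}IH.
have szj : sz j%:Z e by apply: nat_sz.
have szc : sz (j%:Z * B) (2 * e) by apply: sz_le (sz_mul szj szB) _; lia.
have bR := b_R HK.
have re : all (fun r => (r <= e)%N) (down (i_R K)).
  by apply/allP => y /mem_down /andP[_ ye]; apply: leq_trans ye bR.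
apply: sz_le (sz_digz (sz_pnz sl al szc) re IH) _; rewrite size_down.
have : (i_R K * (24 * (e * e)) <= e * (24 * (e * e)))%N by rewrite leq_mul2r bR orbT.
lia.
Qed.

Lemma prun_thr l B init s env x s1 : (size l <= e)%N -> atoms_sz e l -> sz B e -> sz init s ->
  (s + 100 * (e * e * e * e) < L)%N ->
  prun env x (DPair (enc_down (i_Ls K)) (DPair (enc_il l) (DPair (DInt init)
    (DPair (DInt B) (enc_inst K))))) s1 ->
  prun env (Call 10 x) (DInt (thrz K l B (down (i_Ls K)) init)) (s1 + 1200 * (e * e * e)).
Proof.
move=> sl al szB si sL hx; have [h1 h2 h3] := epow; have bLs := b_Ls HK.
have := prun_rec (acc := fun ls => DInt (thrz K l B ls init)) (s0 := 4) (s1 := 500 * (e * e) + 450 * e + 150)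
  (isT : (10 < size prog)%N) erefl _ _ hx.
rewrite size_down => H; apply: prun_le (H _ _) _.
- by apply: prun_le; [ev | ].
- move=> pre j ls E.
  have re : all (fun r => (r <= e)%N) (down (i_Ls K)).
    by apply/allP => y /mem_down /andP[_ ye]; apply: leq_trans ye bLs.
  have lsR : (size (j :: ls) <= i_Ls K)%N by rewrite -(size_down (i_Ls K)) E size_cat leq_addl.
  move: re; split_pre E => /andP[_ /andP[je lse]].
  have szj : sz j%:Z e by apply: nat_sz.
  have szc : sz (j%:Z * B) (2 * e) by apply: sz_le (sz_mul szj szB) _; lia.
  have szt := sz_thrz sl al szB lse si.
  have q : (size ls * (24 * (e * e * e)) <= e * (24 * (e * e * e)))%N.
    by rewrite leq_mul2r; apply/orP; right; move: lsR => /=; lia.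
  apply: prun_le.
    eapply (prun_dig (sz_pnz sl al szc) szt); first by lia.
    eapply prun_cons; first by ev.
    eapply prun_cons; last by ev.
    eapply (prun_pn sl al szc); [ev | ev | ev].
    + by bits; lia.
    + by bits; lia.
  rewrite /=; lia.
- have q : (i_Ls K * (500 * (e * e) + 450 * e + 150 + 20) <= e * (500 * (e * e) + 450 * e + 150 + 20))%N.
    by rewrite leq_mul2r bLs orbT.
  lia.
Qed.

Lemma sz_twz l B lt : (size l <= e)%N -> atoms_sz e l -> sz B e -> sz lt e ->
  sz (twz K l B lt) (10 * e).
Proof.
move=> sl al szB szl; have szc : sz (lt * B) (2 * e) by apply: sz_le (sz_mul szl szB) _; lia.
have sze := sz_excz al (b_al HK) szc; have szn := b_n HK; have szcap := b_cap HK.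
rewrite /twz; case: ifP => _.
  by apply: sz_le (sz_div _ (sz_mul sze szn)) _; lia.
by apply: sz_le (sz_add szcap (sz_cst 1)) _; lia.
Qed.

Lemma prun_weights B lt env x s1 : sz B e -> sz lt e ->
  prun env x (DPair (enc_ils (i_il K)) (DPair (DInt B) (DPair (DInt lt) (enc_inst K)))) s1 ->
  prun env (Call 11 x) (enc_list [seq DInt (wz K B lt l) | l <- i_il K]) (s1 + 3000 * (e * e * e * e)).
Proof.
move=> szB szl hx; have [h1 h2 h3] := epow; have bil := b_il HK.
have := prun_rec (acc := fun ls => enc_list [seq DInt (wz K B lt l) | l <- ls]) (s0 := 1)
  (s1 := 1200 * (e * e * e) + 300 * e + 500) (isT : (11 < size prog)%N) erefl _ _ hx.
move=> H; apply: prun_le (H _ _) _.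
- by ev.
- move=> pre l ls E.
  have := b_laws HK; split_pre E => /andP[_ /andP[/andP[sl al] _]].
  have szc : sz (lt * B) (2 * e) by apply: sz_le (sz_mul szl szB) _; lia.
  have sza := b_al HK; have szn := b_n HK; have szcap := b_cap HK; have szD := b_D HK; have szk := b_k HK.
  have sze := sz_excz al sza szc.
  have szt := sz_twz sl al szB szl.
  apply: prun_le.
    eapply prun_cons; last by ev.
    eapply (prun_thr sl al szB szt); first by lia.
    eapply prun_cons; first by ev.
    eapply prun_cons; first by ev.
    eapply prun_cons; last by ev.
    have -> : DInt (twz K l B lt) = if excz l (i_al K) (lt * B) * i_n K <= i_cap K * (i_D K * i_k K * B)
      then DInt ((excz l (i_al K) (lt * B) * i_n K) %/ (i_D K * i_k K * B))%Z else DInt (i_cap K + 1).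
      by rewrite /twz; case: ifP.
    have He : prun [:: enc_list [seq DInt (wz K B lt l0) | l0 <- ls];
       DPair (DPair (enc_il l) (enc_list [seq enc_il i | i <- ls]))
         (DPair (DInt B) (DPair (DInt lt) (enc_inst K)))]
       (Op Mul (exc_e (hd 1) (fld 2 (Snd (Snd (cx 1)))) (Op Mul (Fst (Snd (cx 1))) (Fst (cx 1))))
          (fld 3 (Snd (Snd (cx 1))))) (DInt (excz l (i_al K) (lt * B) * i_n K)) (100 * e + 150).
      apply: prun_le.
        eapply prun_opE; [ | ev | by [] | | ].
        - eapply (@prun_exc O L L_ge l (i_al K) (lt * B) e (2 * e)) => //; [lia | ev | ev | ev].
          + by bits; lia.
          + by bits; lia.
        - by bits; lia.
        - by bits; lia.
      rewrite /=; lia.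
    eapply prun_ifle.
    + exact: He.
    + by ev; bits; lia.
    + by bits; lia.
    + by bits; lia.
    + by move=> _; eapply prun_opE; [exact: He | ev | by [] | ..]; bits; lia.
    + by move=> _; ev; first [exact: bit1 | bits; lia].
  rewrite /=; lia.
- have q : (size (i_il K) * (1200 * (e * e * e) + 300 * e + 500 + 20) <=
     e * (1200 * (e * e * e) + 300 * e + 500 + 20))%N by rewrite leq_mul2r bil orbT.
  lia.
Qed.

Lemma prun_sel ls bs env x s : size bs = size ls ->
  prun env x (DPair (enc_ils ls) (enc_list [seq DInt (nat_of_bool b)%:Z | b <- bs])) s ->
  prun env (Call 12 x) (enc_ils (selz ls bs)) (s + 40 * (size ls).+1).
Proof.
elim: ls bs env x s => [|l ls IH] [|b bs] // env x s.
  move=> _ hx; have h : prun [:: DPair (enc_ils [::]) (enc_list [::])] (nth (Cst 0) prog 12) (DInt 0) 20.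
    rewrite /= /f_sel; apply: prun_le; first by eapply prun_ifint; [ev | exact: prun_cst].
    by [].
  by apply: prun_le (prun_call _ hx h) _ => //=; lia.
move=> [sb] hx.
have h : prun [:: DPair (enc_ils (l :: ls)) (enc_list [seq DInt (nat_of_bool b0)%:Z | b0 <- b :: bs])]
    (nth (Cst 0) prog 12) (enc_ils (selz (l :: ls) (b :: bs))) (35 + 40 * (size ls).+1).
  rewrite /= /f_sel; apply: prun_le.
    eapply prun_ifpair; first by ev.
    eapply prun_cons.
      eapply (@prun_if _ _ _ _ _ _ _ b%:Z (enc_il (if b then l else [::])) _ 5); first by ev.
      by case: (b) => /=; [apply: prun_le; [ev | ] | apply: prun_le; [exact: prun_cst | ]].
    by eapply (IH bs); [exact: sb | ev].
  by rewrite /=; lia.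
by apply: prun_le (prun_call _ hx h) _ => //=; lia.
Qed.

Lemma size_selz ls bs : size bs = size ls -> size (selz ls bs) = size ls.
Proof. by elim: ls bs => [|l ls IH] [|b bs] //= [/IH->]. Qed.

Lemma selz_bounded ls bs : all (fun l => (size l <= e)%N && atoms_sz e l) ls ->
  all (fun l => (size l <= e)%N && atoms_sz e l) (selz ls bs).
Proof.
elim: ls bs => [|l ls IH] [|b bs] //= /andP[h1 /IH ->].
by case: b; rewrite ?h1.
Qed.

Lemma sz_sumez ls c : all (fun l => (size l <= e)%N && atoms_sz e l) ls -> sz c (2 * e) ->
  sz (sumez K ls c) (7 * e + 2 + size ls).
Proof.
move=> + szc; elim: ls => [|l ls IH] /=; first by move=> _; apply: sz0.
move=> /andP[/andP[sl al] /IH{}IH]; rewrite addnS; apply: sz_add_max => //.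
by apply: sz_le (sz_excz al (b_al HK) szc) _; lia.
Qed.

Lemma prun_sum_exc ls c env x s1 : (size ls <= e)%N ->
  all (fun l => (size l <= e)%N && atoms_sz e l) ls -> sz c (2 * e) ->
  prun env x (DPair (enc_ils ls) (DPair (DInt (i_al K)) (DInt c))) s1 ->
  prun env (Call 13 x) (DInt (sumez K ls c)) (s1 + 300 * (e * e)).
Proof.
move=> sls als szc hx; have [h1 h2 h3] := epow.
have := prun_rec (acc := fun ls => DInt (sumez K ls c)) (s0 := 1) (s1 := 100 * e + 130)
  (isT : (13 < size prog)%N) erefl _ _ hx.
move=> H; apply: prun_le (H _ _) _.
- by ev.
- move=> pre l ls' E.
  have sls' : (size (l :: ls') <= e)%N by apply: leq_trans sls; rewrite E size_cat leq_addl.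
  move: als; split_pre E => /andP[_ /andP[/andP[sl al] als']].
  have sza := b_al HK; have sze := sz_excz al sza szc; have szs := sz_sumez als' szc.
  apply: prun_le.
    eapply prun_opE; [ev | | by [] | | ].
    + eapply (@prun_exc O L L_ge l (i_al K) c e (2 * e)) => //; [lia | ev | ev | ev].
    + by move: sls' => /= sls'; bits; lia.
    + by bits; lia.
  rewrite /=; lia.
- have q : (size ls * (100 * e + 130 + 20) <= e * (100 * e + 130 + 20))%N by rewrite leq_mul2r sls orbT.
  lia.
Qed.

Definition enc_ints (v : seq int) := enc_list (map DInt v).
Definition vsz s (v : seq int) := all (fun z => `|z| < 2 ^ s)%N v.

Lemma size_stepz a v : size (stepz K a v) = size v.
Proof. by elim: v => //= z v ->. Qed.

Lemma vsz_stepz a v s : sz a (20 * e) -> vsz s v -> vsz (s + 22 * e + 2) (stepz K a v).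
Proof.
move=> sza; elim: v => //= z v IH /andP[szz szv]; rewrite IH // andbT.
have szz' : sz z s by []. have szD := b_D HK.
have szh : sz (head 0 v) s by case: v szv {IH} => [_|y v /= /andP[]] //; apply: sz0.
change (sz (a * head 0 v + (i_D K - a) * z) (s + 22 * e + 2)).
apply: sz_le (sz_add_max (e := s + 21 * e + 1) _ _) _.
- by apply: sz_le (sz_mul sza szh) _; lia.
- by apply: sz_le (sz_mul (sz_sub szD sza) szz') _; lia.
- lia.
Qed.

Lemma prun_step a v s env x s1 : sz a (20 * e) -> vsz s v -> (s + 40 * e < L)%N ->
  prun env x (DPair (enc_ints v) (DPair (DInt a) (DInt (i_D K)))) s1 ->
  prun env (Call 14 x) (enc_ints (stepz K a v)) (s1 + 80 * (size v).+1).
Proof.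
move=> sza szv sL hx; have szD := b_D HK.
have := prun_rec (acc := fun v => enc_ints (stepz K a v)) (s0 := 1) (s1 := 55)
  (isT : (14 < size prog)%N) erefl _ _ hx.
move=> H; apply: prun_le (H _ _) _; last by lia.
- by ev.
- move=> pre z w E.
  move: szv; rewrite /vsz; split_pre E => /andP[_ /andP[szz szw]].
  have szz' : sz z s by [].
  have szh : sz (head 0 w) s by case: w szw {E} => [_|y w /= /andP[]] //; apply: sz0.
  apply: prun_le.
    eapply prun_cons; last by ev.
    eapply prun_opE; [ | ev | by [] | | ].
    + eapply (@prun_opE _ _ _ _ _ _ _ (a) (head 0 w)); [ev | | by [] | by bits; lia | by bits; lia].
      case: (w) => [|y w'].
        apply: (@prun_le _ _ _ _ _ _ 15); last by [].
        apply: prun_le; first by eapply prun_ifint; [ev | exact: prun_cst].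
        by [].
      apply: prun_le; first by eapply prun_ifpair; [ev | ev].
      by [].
    + by bits; lia.
    + by bits; lia.
    + by bits; lia.
    + by bits; lia.
    + by bits; lia.
    + by bits; lia.
  by [].
Qed.

Lemma vsz_dpz c ls : all (fun l => (size l <= e)%N && atoms_sz e l) ls -> sz c (2 * e) ->
  vsz (e + size ls * (22 * e + 2)) (dpz K c ls) /\ size (dpz K c ls) = i_kn K.
Proof.
move=> + szc; elim: ls => [|l ls IH] /=.
  move=> _; rewrite mul0n addn0 size_map size_down; split=> //.
  apply/allP => z /mapP[y /mem_down /andP[_ yk] ->].
  by apply: nat_sz; apply: leq_trans yk (b_kn HK).
move=> /andP[/andP[sl al] /IH[IH1 IH2]]; rewrite size_stepz; split=> //.
have := vsz_stepz (sz_pnz sl al szc) IH1; congr (is_true (vsz _ _)); lia.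
Qed.

Lemma prun_dp ls c env x s1 : (size ls <= e)%N ->
  all (fun l => (size l <= e)%N && atoms_sz e l) ls -> sz c (2 * e) ->
  prun env x (DPair (enc_ils ls) (DPair (DInt c) (enc_inst K))) s1 ->
  prun env (Call 15 x) (enc_ints (dpz K c ls)) (s1 + 1000 * (e * e)).
Proof.
move=> sls als szc hx; have [h1 h2 h3] := epow.
have := prun_rec (acc := fun ls => enc_ints (dpz K c ls)) (s0 := 20) (s1 := 530 * e + 200)
  (isT : (15 < size prog)%N) erefl _ _ hx.
move=> H; apply: prun_le (H _ _) _.
- have -> : enc_ints (dpz K c [::]) = enc_down (i_kn K) by rewrite /enc_ints -map_comp.
  by apply: prun_le; [ev | ].
- move=> pre l ls' E.
  have sls' : (size (l :: ls') <= e)%N by apply: leq_trans sls; rewrite E size_cat leq_addl.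
  move: als; split_pre E => /andP[_ /andP[/andP[sl al] als']].
  have [szv sv] := vsz_dpz als' szc; have bkn := b_kn HK.
  have q : (size ls' * (22 * e + 2) <= e * (22 * e + 2))%N.
    by rewrite leq_mul2r; apply/orP; right; move: sls' => /=; lia.
  apply: prun_le.
    eapply (prun_step (sz_pnz sl al szc) szv); first by lia.
    eapply prun_cons; first by ev.
    eapply prun_cons; last by ev.
    by eapply (prun_pn sl al szc); [ev | ev | ev].
  rewrite /= sv; lia.
- have q : (size ls * (530 * e + 200 + 20) <= e * (530 * e + 200 + 20))%N by rewrite leq_mul2r sls orbT.
  lia.
Qed.

Lemma sz_sumdz ls B js : (size ls <= e)%N -> all (fun l => (size l <= e)%N && atoms_sz e l) ls -> sz B e ->
  all (fun j => (j <= e)%N) js -> sz (sumdz K ls B js) (30 * (e * e) + size js).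
Proof.
move=> sls als szB; have [h1 h2 h3] := epow; elim: js => [|j js IH] /=; first by move=> _; apply: sz0.
move=> /andP[je /IH{}IH]; rewrite addnS; apply: sz_add_max => //.
have szj : sz j%:Z e by apply: nat_sz.
have szc : sz (j%:Z * B) (2 * e) by apply: sz_le (sz_mul szj szB) _; lia.
have [szv _] := vsz_dpz als szc.
have : sz (head 0 (dpz K (j%:Z * B) ls)) (e + size ls * (22 * e + 2)).
  by case: (dpz _ _ _) szv => [_|y v /andP[]] //; apply: sz0.
move/sz_le; apply.
have q : (size ls * (22 * e + 2) <= e * (22 * e + 2))%N by rewrite leq_mul2r sls orbT.
lia.
Qed.

Lemma prun_sum_dp ls B env x s1 : (size ls <= e)%N ->
  all (fun l => (size l <= e)%N && atoms_sz e l) ls -> sz B e ->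
  prun env x (DPair (enc_down (i_Ls K)) (DPair (enc_ils ls) (DPair (DInt B) (enc_inst K)))) s1 ->
  prun env (Call 16 x) (DInt (sumdz K ls B (down (i_Ls K)))) (s1 + 1200 * (e * e * e)).
Proof.
move=> sls als szB hx; have [h1 h2 h3] := epow; have bLs := b_Ls HK.
have := prun_rec (acc := fun js => DInt (sumdz K ls B js)) (s0 := 1) (s1 := 1000 * (e * e) + 150)
  (isT : (16 < size prog)%N) erefl _ _ hx.
rewrite size_down => H; apply: prun_le (H _ _) _.
- by ev.
- move=> pre j js E.
  have jsR : (size (j :: js) <= i_Ls K)%N by rewrite -(size_down (i_Ls K)) E size_cat leq_addl.
  have re : all (fun r => (r <= e)%N) (down (i_Ls K)).
    by apply/allP => y /mem_down /andP[_ ye]; apply: leq_trans ye bLs.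
  move: re; split_pre E => /andP[_ /andP[je jse]].
  have szj : sz j%:Z e by apply: nat_sz.
  have szc : sz (j%:Z * B) (2 * e) by apply: sz_le (sz_mul szj szB) _; lia.
  have [szv sv] := vsz_dpz als szc.
  have kn0 : (0 < i_kn K)%N by case: (b_Ls_kn HK) => // E0; move: jsR; rewrite E0.
  have szS := sz_sumdz sls als szB jse.
  have q : (size ls * (22 * e + 2) <= e * (22 * e + 2))%N by rewrite leq_mul2r sls orbT.
  have [y [w Ev]] : exists y w, dpz K (j%:Z * B) ls = y :: w.
    by case: (dpz _ _ _) sv kn0 => [|y w] /= <- // _; exists y, w.
  have szy : sz y (e + size ls * (22 * e + 2)) by move: szv; rewrite Ev => /andP[].
  apply: prun_le.
    eapply prun_opE; [ev | | | | ].
    + eapply (@prun_fst _ _ _ _ _ (DInt y) (enc_ints w)); rewrite -[DPair (DInt y) _]/(enc_ints (y :: w)) -Ev.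
      by eapply (prun_dp sls als szc); ev; bits; lia.
    + by rewrite /= Ev.
    + by move: jsR => /= jsR; bits; lia.
    + by bits; lia.
  rewrite /=; lia.
- have q : (i_Ls K * (1000 * (e * e) + 150 + 20) <= e * (1000 * (e * e) + 150 + 20))%N.
    by rewrite leq_mul2r bLs orbT.
  lia.
Qed.

End PureFunctions.

(** One more nested loop multiplies [w] by [e], and the added constant absorbs the overhead of the
    loop. *)
Lemma fold_cost A w e T N s : (0 < w)%N -> (0 < e)%N -> (N <= e)%N ->
  (s + 3 + N * (A * w * T.+1 + 20) + 10 <= s + (A + 100) * (w * e) * T.+1)%N.
Proof.
move=> w0 e0 Ne; have x0 : (0 < w * T.+1)%N by rewrite muln_gt0 w0.
have h1 : (N * (A * w * T.+1 + 20) <= e * (A * w * T.+1 + 20))%N by rewrite leq_mul2r Ne orbT.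
have h2 : (e <= e * (w * T.+1))%N by rewrite leq_pmulr.
lia.
Qed.

Lemma step_cost A B w T a : (a <= B * w)%N -> (a + A * w * T.+1 <= (A + B) * w * T.+1)%N.
Proof.
move=> h; have : (B * w <= B * w * T.+1)%N by rewrite leq_pmulr.
lia.
Qed.

(** * The search over scales, cutoffs and targets *)

Section Search.
Variables (O : oracle) (L e : nat) (K : inst) (F : set_system).
Variable il : 'I_(ground F) -> seq (int * int).
(** What is known of the time of one solver call on given weights; the search merely records it for
    each call. *)
Variable cst : ('I_(ground F) -> int) -> nat -> Prop.
Local Notation prun := (prun prog O L).
Local Notation runs := (runs prog O L).
Hypothesis e_gt0 : (0 < e)%N.
Hypothesis HK : bounded e K.
Hypothesis HL : (1000 * (e * e * e * e) < L)%N.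
Hypothesis K_il : i_il K = [seq il i | i <- enum 'I_(ground F)].
Hypothesis HO : forall w target, exists r c,
  [/\ O (enc_query w target) (enc_answer r) c, exact_sum_answer w target r & cst w c].

Definition cand (B : int) := exists2 b, (b < i_bl K)%N & exists i, B = b%:Z * excz (il i) 1 0.
Definition cutoff (lt : int) := exists2 l, l \in i_Ll K & lt = l%:Z - 1.
Hypothesis cand_sz : forall B, cand B -> sz B e.

Definition wfun B lt i := wz K B lt (il i).
Definition in_bits (T : {set 'I_(ground F)}) := [seq i \in T | i <- enum 'I_(ground F)].
Definition score_of B lt T := scorez K (selz (i_il K) (in_bits T)) B lt.

(** The accumulator is 0 as long as no set has been found, and then a pair of the best score and its
    set. *)
Definition acc_ok a := a = DInt 0 \/ exists T B lt,
  [/\ a = DPair (DInt (score_of B lt T)) (enc_set T), T \in feasible F, cand B & cutoff lt].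
Definition acc_le a (v : int) := exists sc (T : {set 'I_(ground F)}),
  a = DPair (DInt sc) (enc_set T) /\ sc <= v.
(** Existence of some feasible [S] with sum t only guarantees an answer; the score is controlled for
    the set [S'] that the solver chose. *)
Definition reached B lt t a :=
  (exists2 S, S \in feasible F & \sum_(i in S) wfun B lt i = t) ->
  exists S', [/\ S' \in feasible F, \sum_(i in S') wfun B lt i = t & acc_le a (score_of B lt S')].
Definition asked (qc : data * nat) := exists B lt target,
  [/\ cand B, cutoff lt, qc.1 = enc_query (wfun B lt) target & cst (wfun B lt) qc.2].
(** The best score only improves, so that what one query has achieved survives all later
    iterations. *)
Definition mono a a' := forall v, acc_le a v -> acc_le a' v.

Lemma reached_mono B lt t a a' : mono a a' -> reached B lt t a -> reached B lt t a'.
Proof. by move=> m h /h[S' [h1 h2 h3]]; exists S'; split=> //; apply: m. Qed.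

Let L_ge : (20 <= L)%N.
Proof. by have : (1 <= e * e * e * e)%N by [rewrite !muln_gt0 e_gt0]; lia. Qed.
Let epow : [/\ e <= e * e, e * e <= e * e * e & e * e * e <= e * e * e * e]%N.
Proof. by split; rewrite leq_pmulr. Qed.
Let bit0 : (bitlen 0 <= L)%N. Proof. exact: leq_trans L_ge. Qed.
Let bit1 : (bitlen 1 <= L)%N. Proof. exact: leq_trans L_ge. Qed.

Lemma cutoff_sz lt : cutoff lt -> sz lt e.
Proof.
case=> l lL ->; have := b_Ll_sz HK => /allP /(_ _ lL) /andP[l2 l0].
by rewrite /sz; lia.
Qed.

Lemma sel_bounded T : [/\ (size (selz (i_il K) (in_bits T)) <= e)%N,
  all (fun l => (size l <= e)%N && atoms_sz e l) (selz (i_il K) (in_bits T)) &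
  size (in_bits T) = size (i_il K)].
Proof.
have E : size (in_bits T) = size (i_il K) by rewrite K_il !size_map.
by split=> //; [rewrite size_selz ?(b_il HK) | apply/selz_bounded/b_laws].
Qed.

Lemma sz_score B lt T : sz B e -> sz lt e -> sz (score_of B lt T) (60 * (e * e)).
Proof.
move=> szB szl; have [s1 s2 s3] := sel_bounded T; have [h1 h2 h3] := epow.
have szc : sz (lt * B) (2 * e) by apply: sz_le (sz_mul szl szB) _; lia.
have q1 := sz_sumez e_gt0 HK HL s2 szc.
have re : all (fun r => (r <= e)%N) (down (i_Ls K)).
  by apply/allP => y /mem_down /andP[_ ye]; apply: leq_trans ye (b_Ls HK).
have q2 := sz_sumdz e_gt0 HK HL s1 s2 szB re; rewrite size_down in q2.
have bLs := b_Ls HK.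
have := sz_add (sz_mul (b_Dn HK) q1) (sz_mul (b_D HK) (sz_sub (sz_mul (sz_mul (sz_mul (b_k HK) szl) szB) (b_Dn HK)) (sz_mul szB q2))).
by move/sz_le; apply; lia.
Qed.

Definition update a sc (T : {set 'I_(ground F)}) : data :=
  match a with
  | DPair (DInt sc0) _ => if sc0 <= sc then a else DPair (DInt sc) (enc_set T)
  | _ => DPair (DInt sc) (enc_set T)
  end.

(** The body of [f_targets] after a successful query. *)
Definition update_e :=
  Let (Call 12 (Cons (fld 0 (Snd (Snd (Snd (Snd (cx 2)))))) (Snd (Var 0))))
     (let B := Fst (Snd (Snd (cx 3))) in let l := Fst (Snd (Snd (Snd (cx 3)))) in
      let K := Snd (Snd (Snd (Snd (cx 3)))) in
      (Let (Op Add (Op Mul (fld 5 K) (Call 13 (Cons (Var 0) (Cons (fld 2 K) (Op Mul l B)))))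
                   (Op Mul (fld 1 K) (Op Sub (Op Mul (Op Mul (Op Mul (fld 4 K) l) B) (fld 5 K))
                      (Op Mul B (Call 16 (Cons (fld 11 K) (Cons (Var 0) (Cons B K))))))))
      (If (IsPair (Var 3))
          (If (Op Leq (Fst (Var 3)) (Var 0)) (Var 3) (Cons (Var 0) (Snd (Var 2))))
          (Cons (Var 0) (Snd (Var 2)))))).

Lemma prun_update B lt a T u w a0 : cand B -> cutoff lt -> acc_ok a ->
  prun [:: enc_answer (Some T); a;
     DPair u (DPair a0 (DPair w (DPair (DInt B) (DPair (DInt lt) (enc_inst K)))))]
    update_e (update a (score_of B lt T) T) (2200 * (e * e * e)).
Proof.
move=> cB cl oka; have [h1 h2 h3] := epow.
have szB := cand_sz cB; have szl := cutoff_sz cl.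
have [s1 s2 s3] := sel_bounded T; have szc : sz (lt * B) (2 * e) by apply: sz_le (sz_mul szl szB) _; lia.
have szS := sz_score T szB szl.
have szDn := b_Dn HK; have szD := b_D HK; have szk := b_k HK; have sza := b_al HK.
have q1 := sz_sumez e_gt0 HK HL s2 szc.
have re : all (fun r => (r <= e)%N) (down (i_Ls K)).
  by apply/allP => y /mem_down /andP[_ ye]; apply: leq_trans ye (b_Ls HK).
have q2 := sz_sumdz e_gt0 HK HL s1 s2 szB re; rewrite size_down in q2.
have bLs := b_Ls HK; have bil := b_il HK.
have E : enc_set T = enc_list [seq DInt (nat_of_bool b)%:Z | b <- in_bits T].
  by rewrite /enc_set /in_bits -map_comp.
rewrite /update_e; apply: prun_le.
  eapply prun_let.
    eapply (prun_sel e_gt0 HL s3); rewrite -E; ev.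
  eapply prun_let.
    eapply prun_opE.
    - eapply prun_opE; [ev | | cbn [op_val]; reflexivity | | ].
      + eapply (prun_sum_exc e_gt0 HK HL s1 s2 szc); ev.
        * by bits; lia.
        * by bits; lia.
      + by bits; lia.
      + by bits; lia.
    - eapply prun_opE; [ev | | cbn [op_val]; reflexivity | | ].
      + eapply prun_opE; [ev | | cbn [op_val]; reflexivity | | ].
        * by bits; lia.
        * by bits; lia.
        * by bits; lia.
        * by bits; lia.
        * by bits; lia.
        * by bits; lia.
        * eapply prun_opE; [ev | | cbn [op_val]; reflexivity | | ].
          { by eapply (prun_sum_dp e_gt0 HK HL s1 s2 szB); ev. }
          { by bits; lia. }
          { by bits; lia. }
        * by bits; lia.
        * by bits; lia.
      + by bits; lia.
      + by bits; lia.
    - by cbn [op_val]; reflexivity.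
    - by bits; lia.
    - by bits; lia.
  rewrite -/(score_of B lt T) /update.
  instantiate (1 := 20%N).
  case: oka => [->|[T0 [B0 [lt0 [-> _ cB0 cl0]]]]].
    apply: prun_le; first by eapply prun_ifint; [ev | ev].
    by [].
  apply: prun_le; first eapply prun_ifpair; first by ev.
    have szS0 := sz_score T0 (cand_sz cB0) (cutoff_sz cl0).
    by eapply prun_ifle; [ev | ev | bits; lia | bits; lia | move=> _; ev | move=> _; ev].
  by [].
rewrite /=; lia.
Qed.

Lemma update_ok a B lt T : acc_ok a -> cand B -> cutoff lt -> T \in feasible F ->
  [/\ acc_ok (update a (score_of B lt T) T), mono a (update a (score_of B lt T) T) &
     acc_le (update a (score_of B lt T) T) (score_of B lt T)].
Proof.
move=> oka cB cl TF.
have H : acc_ok (DPair (DInt (score_of B lt T)) (enc_set T)) by right; exists T, B, lt.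
have H2 : acc_le (DPair (DInt (score_of B lt T)) (enc_set T)) (score_of B lt T).
  by exists (score_of B lt T), T.
case: oka => [->|[T0 [B0 [lt0 [-> T0F cB0 cl0]]]]] /=.
  by split=> // v [sc [? []]].
case: ifP => hle; split=> //; try by right; exists T0, B0, lt0.
- by exists (score_of B0 lt0 T0), T0.
- move=> v [sc [T1 [[<- _] scv]]]; exists (score_of B lt T), T; split=> //.
  by apply: le_trans scv; move: hle; case: leP => // /ltW.
Qed.

Lemma run_targets B lt a0 env x s : cand B -> cutoff lt -> acc_ok a0 ->
  prun env x (DPair (enc_down (i_T K)) (DPair a0 (DPair
    (enc_list [seq DInt (wz K B lt l) | l <- i_il K])
    (DPair (DInt B) (DPair (DInt lt) (enc_inst K)))))) s ->
  exists a tr, [/\ runs env (Call 17 x) a (s + 3000 * (e * e * e) * (i_T K).+1) tr,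
    acc_ok a, mono a0 a, forall t, (t < i_T K)%N -> reached B lt t%:Z a &
    (forall qc, List.In qc tr -> asked qc) /\ (size tr <= i_T K)%N].
Proof.
move=> cB cl ok0 hx; have [h1 h2 h3] := epow.
have szB := cand_sz cB; have szl := cutoff_sz cl.
pose I ys a (tr : trace) := [/\ acc_ok a, mono a0 a,
   forall t : nat, t \in ys -> reached B lt (t%:Z - 1) a &
   (forall qc, List.In qc tr -> asked qc) /\ (size tr <= size ys)%N].
have := @runs_rec prog O L nat enc_nat 17 _ _ _ (down (i_T K)) I 3 (2500 * (e * e * e)) a0 isT erefl _ _ _ env x s hx.
case.
- by apply: prun_le; [ev | ].
- by split=> //; split.
- move=> pre y ys a tr E [oka ma ga [atr str]].
  have yT : (0 < y <= i_T K)%N by apply: mem_down; rewrite E mem_cat inE eqxx orbT.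
  have szy : sz y%:Z (e * e * e * e).
    by have := b_T HK; rewrite /sz !absz_nat; apply: leq_ltn_trans; case/andP: yT.
  have [r [c [Or Ar Cr]]] := HO (wfun B lt) (y%:Z - 1).
  have Eq : DPair (enc_list [seq DInt (wz K B lt l) | l <- i_il K]) (DInt (y%:Z - 1)) =
     enc_query (wfun B lt) (y%:Z - 1).
    by rewrite /enc_query K_il -!map_comp.
  have hq : runs [:: a; DPair (DPair (enc_nat y) (enc_list (map enc_nat ys))) (DPair a0 (DPair
      (enc_list [seq DInt (wz K B lt l) | l <- i_il K]) (DPair (DInt B) (DPair (DInt lt) (enc_inst K)))))]
     (Query (Cons (Fst (Snd (cx 1))) (Op Sub (hd 1) (Cst 1)))) (enc_answer r) 20
      [:: (enc_query (wfun B lt) (y%:Z - 1), c)].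
    have hq0 : prun [:: a; DPair (DPair (enc_nat y) (enc_list (map enc_nat ys))) (DPair a0 (DPair
      (enc_list [seq DInt (wz K B lt l) | l <- i_il K]) (DPair (DInt B) (DPair (DInt lt) (enc_inst K)))))]
      (Cons (Fst (Snd (cx 1))) (Op Sub (hd 1) (Cst 1))) (enc_query (wfun B lt) (y%:Z - 1)) 19.
      rewrite -Eq; apply: prun_le.
        by eapply prun_cons; ev; first [exact: bit1 | bits; lia].
      by [].
    exact: (runs_query hq0 Or).
  have tail a' s' : prun [:: enc_answer r; a; DPair (DPair (enc_nat y) (enc_list (map enc_nat ys))) (DPair a0 (DPair
      (enc_list [seq DInt (wz K B lt l) | l <- i_il K]) (DPair (DInt B) (DPair (DInt lt) (enc_inst K)))))]
      (If (IsPair (Var 0)) update_e (Var 1)) a' s' -> (s' <= 2210 * (e * e * e))%N ->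
    runs [:: a; DPair (DPair (enc_nat y) (enc_list (map enc_nat ys))) (DPair a0 (DPair
      (enc_list [seq DInt (wz K B lt l) | l <- i_il K]) (DPair (DInt B) (DPair (DInt lt) (enc_inst K)))))]
     (Let (Query (Cons (Fst (Snd (cx 1))) (Op Sub (hd 1) (Cst 1)))) (If (IsPair (Var 0)) update_e (Var 1)))
     a' (2500 * (e * e * e)) [:: (enc_query (wfun B lt) (y%:Z - 1), c)].
    by move=> h hs; apply: runs_le (runs_let hq h) _; lia.
  have Hin qc : List.In qc (tr ++ [:: (enc_query (wfun B lt) (y%:Z - 1), c)]) -> asked qc.
    rewrite -[_ ++ _]/(app _ _) List.in_app_iff => -[/atr//|[<-|//]].
    by exists B, lt, (y%:Z - 1).
  have Hsz : (size (tr ++ [:: (enc_query (wfun B lt) (y%:Z - 1), c)]) <= size (y :: ys))%N.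
    by rewrite size_cat addn1.
  case: r Or Ar tail {hq} => [T|] Or Ar tail.
    have [TF Tw] := Ar; have [u1 u2 u3] := update_ok oka cB cl TF.
    exists (update a (score_of B lt T) T), [:: (enc_query (wfun B lt) (y%:Z - 1), c)]; split.
      apply: tail; first by eapply prun_ifpair; [ev | exact: prun_update].
      by lia.
    split=> //; first by move=> v /ma; apply: u2.
    move=> t; rewrite inE => /orP[/eqP -> _|/ga]; last exact: reached_mono.
    by exists T.
  exists a, [:: (enc_query (wfun B lt) (y%:Z - 1), c)]; split.
    apply: tail; first by eapply prun_ifint; ev.
    by rewrite /=; lia.
  split=> // t; rewrite inE => /orP[/eqP -> [S SF Sw]|/ga]; last exact: reached_mono.
  by have := Ar S SF.
move=> a [tr [ra [oka ma ga [atr str]]]]; exists a, tr; split=> //.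
- by apply: runs_le ra _; rewrite size_down; nia.
- move=> t tT; have -> : t%:Z = t.+1%:Z - 1 by lia.
  by apply: ga; elim: (i_T K) tT => // N IH; rewrite inE ltnS leq_eqVlt => /orP[/eqP->|/IH ->]; rewrite ?eqxx ?orbT.
- by split=> //; rewrite size_down in str.
Qed.

Lemma run_cutoffs B a0 env x s : cand B -> acc_ok a0 ->
  prun env x (DPair (enc_list (map enc_nat (i_Ll K))) (DPair a0 (DPair (DInt B) (enc_inst K)))) s ->
  exists a tr, [/\ runs env (Call 18 x) a (s + 63 * 100 * (e * e * e * e * e) * (i_T K).+1) tr,
    acc_ok a, mono a0 a,
    forall l t, l \in i_Ll K -> (t < i_T K)%N -> reached B (l%:Z - 1) t%:Z a &
    (forall qc, List.In qc tr -> asked qc) /\ (size tr <= size (i_Ll K) * i_T K)%N].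
Proof.
move=> cB ok0 hx; have [h1 h2 h3] := epow; have szB := cand_sz cB.
pose I ys a (tr : trace) := [/\ acc_ok a, mono a0 a,
   forall l t : nat, l \in ys -> (t < i_T K)%N -> reached B (l%:Z - 1) t%:Z a &
   (forall qc, List.In qc tr -> asked qc) /\ (size tr <= size ys * i_T K)%N].
have := @runs_rec prog O L nat enc_nat 18 _ _ _ (i_Ll K) I 3 (62 * 100 * (e * e * e * e) * (i_T K).+1)
  a0 isT erefl _ _ _ env x s hx.
case.
- by apply: prun_le; [ev | ].
- by split=> //; split.
- move=> pre y ys a tr E [oka ma ga [atr str]].
  have yL : y \in i_Ll K by rewrite E mem_cat inE eqxx orbT.
  have cl : cutoff (y%:Z - 1) by exists y.
  have szl := cutoff_sz cl.
  have szy : sz y%:Z e by have := b_Ll_sz HK => /allP /(_ _ yL) /andP[].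
  have hl : prun [:: a; DPair (DPair (enc_nat y) (enc_list (map enc_nat ys))) (DPair a0
      (DPair (DInt B) (enc_inst K)))] (Op Sub (hd 1) (Cst 1)) (DInt (y%:Z - 1)) 5.
    by apply: prun_le; [ev; first [exact: bit1 | bits; lia] | ].
  have hc : prun [:: a; DPair (DPair (enc_nat y) (enc_list (map enc_nat ys))) (DPair a0
      (DPair (DInt B) (enc_inst K)))]
      (Cons (fld 13 (Snd (Snd (cx 1)))) (Cons (Var 0)
     (Cons (Call 11 (Cons (fld 0 (Snd (Snd (cx 1)))) (Cons (Fst (Snd (cx 1))) (Cons (Op Sub (hd 1) (Cst 1)) (Snd (Snd (cx 1)))))))
       (Cons (Fst (Snd (cx 1))) (Cons (Op Sub (hd 1) (Cst 1)) (Snd (Snd (cx 1))))))))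
     (DPair (enc_down (i_T K)) (DPair a (DPair
      (enc_list [seq DInt (wz K B (y%:Z - 1) l) | l <- i_il K])
      (DPair (DInt B) (DPair (DInt (y%:Z - 1)) (enc_inst K)))))) (3000 * (e * e * e * e) + 150).
    apply: prun_le.
      eapply prun_cons; first by ev.
      eapply prun_cons; first by ev.
      eapply prun_cons; last by eapply prun_cons; [ev | eapply prun_cons; [exact: hl | ev]].
      eapply (prun_weights e_gt0 HK HL szB szl).
      eapply prun_cons; first by ev.
      by eapply prun_cons; [ev | eapply prun_cons; [exact: hl | ev]].
    by rewrite /=; lia.
  have [a' [tr' [ra' oka' ma' ga' [atr' str']]]] := run_targets cB cl oka hc.
  exists a', tr'; split.
    apply: runs_le ra' _; move: h3 (leq_trans e_gt0 (leq_trans h1 h2)).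
    move: (e * e * e * e)%N => v; move: (e * e * e)%N (i_T K) => u T uv u1.
    have : (u * T.+1 <= v * T.+1)%N by rewrite leq_mul2r uv orbT.
    have : (v <= v * T.+1)%N by rewrite leq_pmulr.
    lia.
  split=> //.
  + by move=> v /ma; apply: ma'.
  + move=> l t; rewrite inE => /orP[/eqP->|lys] tT; first exact: ga'.
    by apply: reached_mono ma' _; apply: ga.
  + split; last by rewrite size_cat mulSn addnC leq_add.
    by move=> qc; rewrite -[_ ++ _]/(app _ _) List.in_app_iff => -[/atr|/atr'].
move=> a [tr [ra [oka ma ga [atr str]]]]; exists a, tr; split=> //.
apply: runs_le ra _; rewrite -[(63 * 100)%N]/(62 * 100 + 100)%N; apply: fold_cost => //; last exact: b_Ll HK.
by rewrite !muln_gt0 e_gt0.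
Qed.

Definition base i := excz (il i) 1 0.

Lemma run_scales i a0 env x s : sz (base i) e -> acc_ok a0 ->
  prun env x (DPair (enc_down (i_bl K)) (DPair a0 (DPair (DInt (base i)) (enc_inst K)))) s ->
  exists a tr, [/\ runs env (Call 19 x) a (s + 65 * 100 * (e * e * e * e * e * e) * (i_T K).+1) tr,
    acc_ok a, mono a0 a,
    forall b l t, (b < i_bl K)%N -> l \in i_Ll K -> (t < i_T K)%N ->
      reached (b%:Z * base i) (l%:Z - 1) t%:Z a &
    (forall qc, List.In qc tr -> asked qc) /\ (size tr <= i_bl K * (size (i_Ll K) * i_T K))%N].
Proof.
move=> szb ok0 hx; have [h1 h2 h3] := epow; have bbl := b_bl HK.
pose I ys a (tr : trace) := [/\ acc_ok a, mono a0 a,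
   forall b l t : nat, b \in ys -> l \in i_Ll K -> (t < i_T K)%N ->
     reached ((b%:Z - 1) * base i) (l%:Z - 1) t%:Z a &
   (forall qc, List.In qc tr -> asked qc) /\ (size tr <= size ys * (size (i_Ll K) * i_T K))%N].
have := @runs_rec prog O L nat enc_nat 19 _ _ _ (down (i_bl K)) I 3
  (64 * 100 * (e * e * e * e * e) * (i_T K).+1) a0 isT erefl _ _ _ env x s hx.
case.
- by apply: prun_le; [ev | ].
- by split=> //; split.
- move=> pre y ys a tr E [oka ma ga [atr str]].
  have /andP[y0 yb] : (0 < y <= i_bl K)%N by apply: mem_down; rewrite E mem_cat inE eqxx orbT.
  have szy : sz y%:Z e by apply: nat_sz; apply: leq_trans yb bbl.
  have szy1 : sz (y%:Z - 1) e by have -> : y%:Z - 1 = y.-1%:Z by [lia]; apply: nat_sz; lia.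
  have cB : cand ((y%:Z - 1) * base i).
    by exists y.-1; [lia | exists i; congr (_ * _); lia].
  have hc : prun [:: a; DPair (DPair (enc_nat y) (enc_list (map enc_nat ys))) (DPair a0
      (DPair (DInt (base i)) (enc_inst K)))]
      (Cons (fld 14 (Snd (Snd (cx 1)))) (Cons (Var 0)
     (Cons (Op Mul (Op Sub (hd 1) (Cst 1)) (Fst (Snd (cx 1)))) (Snd (Snd (cx 1))))))
     (DPair (enc_list (map enc_nat (i_Ll K))) (DPair a (DPair (DInt ((y%:Z - 1) * base i)) (enc_inst K)))) 60.
    by apply: prun_le; [ev; first [exact: bit1 | bits; lia] | ].
  have [a' [tr' [ra' oka' ma' ga' [atr' str']]]] := run_cutoffs cB oka hc.
  exists a', tr'; split.
    apply: runs_le ra' _; rewrite -[(64 * 100)%N]/(63 * 100 + 100)%N; apply: step_cost.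
    by rewrite (@leq_trans 100) // leq_pmulr // !muln_gt0 e_gt0.
  split=> //.
  + by move=> v /ma; apply: ma'.
  + move=> b l t; rewrite inE => /orP[/eqP->|bys] lL tT; first exact: ga'.
    by apply: reached_mono ma' _; apply: ga.
  + split; last by rewrite size_cat mulSn addnC leq_add.
    by move=> qc; rewrite -[_ ++ _]/(app _ _) List.in_app_iff => -[/atr|/atr'].
move=> a [tr [ra [oka ma ga [atr str]]]]; exists a, tr; rewrite size_down in ra str; split=> //.
- apply: runs_le ra _; rewrite -[(65 * 100)%N]/(64 * 100 + 100)%N; apply: fold_cost => //.
  by rewrite !muln_gt0 e_gt0.
- move=> b l t bb lL tT; have -> : b%:Z = b.+1%:Z - 1 by lia.
  apply: ga => //; elim: (i_bl K) bb => // N IH.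
  by rewrite inE ltnS leq_eqVlt => /orP[/eqP->|/IH ->]; rewrite ?eqxx ?orbT.
Qed.

Hypothesis base_sz : forall i, sz (base i) e.

Lemma run_items env x s :
  prun env x (DPair (enc_ils (i_il K)) (enc_inst K)) s ->
  exists a tr, [/\ runs env (Call 20 x) a (s + 69 * 100 * (e * e * e * e * e * e * e) * (i_T K).+1) tr,
    acc_ok a,
    forall i b l t, (b < i_bl K)%N -> l \in i_Ll K -> (t < i_T K)%N ->
      reached (b%:Z * base i) (l%:Z - 1) t%:Z a &
    (forall qc, List.In qc tr -> asked qc) /\
    (size tr <= size (i_il K) * (i_bl K * (size (i_Ll K) * i_T K)))%N].
Proof.
move=> hx; have [h1 h2 h3] := epow; have bil := b_il HK.
pose I (ys : seq (seq (int * int))) a (tr : trace) := [/\ acc_ok a,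
   forall i (b l t : nat), il i \in ys -> (b < i_bl K)%N -> l \in i_Ll K -> (t < i_T K)%N ->
     reached (b%:Z * base i) (l%:Z - 1) t%:Z a &
   (forall qc, List.In qc tr -> asked qc) /\
   (size tr <= size ys * (i_bl K * (size (i_Ll K) * i_T K)))%N].
have := @runs_rec prog O L _ enc_il 20 _ _ _ (i_il K) I 3
  (68 * 100 * (e * e * e * e * e * e) * (i_T K).+1) (DInt 0) isT erefl _ _ _ env x s hx.
case.
- by apply: prun_le; [ev | ].
- by split=> //; left.
- move=> pre y ys a tr E [oka ga [atr str]].
  have yL : y \in i_il K by rewrite E mem_cat inE eqxx orbT.
  have [i Ei] : exists i, y = il i by move: yL; rewrite K_il => /mapP[i _ ->]; exists i.
  have /andP[sl al] := allP (b_laws HK) _ yL.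
  have hb : prun [:: a; DPair (DPair (enc_il y) (enc_list (map enc_il ys))) (enc_inst K)]
     (exc_e (hd 1) (Cst 1) (Cst 0)) (DInt (base i)) (100 * e + 120).
    rewrite /base -Ei; apply: prun_le.
      eapply (@prun_exc O L L_ge y 1 0 e e) => //; [exact: sz_small | exact: sz0 | lia | ev | exact: prun_cst | exact: prun_cst].
    by lia.
  have hc : prun [:: a; DPair (DPair (enc_il y) (enc_list (map enc_il ys))) (enc_inst K)]
     (Cons (fld 7 (cx 1)) (Cons (Var 0) (Cons (exc_e (hd 1) (Cst 1) (Cst 0)) (cx 1))))
     (DPair (enc_down (i_bl K)) (DPair a (DPair (DInt (base i)) (enc_inst K)))) (100 * e + 170).
    apply: prun_le; first by eapply prun_cons; [ev | eapply prun_cons; [ev | eapply prun_cons; [exact: hb | ev]]].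
    by rewrite /=; lia.
  have [a' [tr' [ra' oka' ma' ga' [atr' str']]]] := run_scales (base_sz i) oka hc.
  exists a', tr'; split.
    apply: runs_le ra' _; rewrite -[(68 * 100)%N]/(65 * 100 + 300)%N; apply: step_cost.
    have : (e <= e * e * e * e * e * e)%N by rewrite leq_pmull // !muln_gt0 e_gt0.
    by move: (e * e * e * e * e * e)%N; lia.
  split=> //.
  + move=> i' b l t; rewrite inE => /orP[/eqP Ei'|bys] bb lL tT.
      have -> : base i' = base i by rewrite /base Ei' Ei.
      exact: ga'.
    by apply: reached_mono ma' _; apply: ga.
  + split; last by rewrite size_cat mulSn addnC leq_add.
    by move=> qc; rewrite -[_ ++ _]/(app _ _) List.in_app_iff => -[/atr|/atr'].
move=> a [tr [ra [oka ga [atr str]]]]; exists a, tr; split=> //.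
- apply: runs_le ra _; rewrite -[(69 * 100)%N]/(68 * 100 + 100)%N; apply: fold_cost => //.
  by rewrite !muln_gt0 e_gt0.
- by move=> i b l t; apply: ga; rewrite K_il map_f // mem_enum.
Qed.

End Search.

(** * Common denominator and scaling of the laws *)

Definition enc_ratpair (a : rat * rat) := DPair (enc_rat a.1) (enc_rat a.2).
(** A plain product of the denominators, with no gcd to compute; its bit length is still polynomial
    in the input size. *)
Definition den_law (l : law) : int := foldr (fun a acc => acc * (denq a.1 * denq a.2)) 1 l.
Definition den_all (ls : seq law) : int := foldr (fun l acc => acc * den_law l) 1 ls.
Definition scale_law (D : int) (l : law) : seq (int * int) :=
  [seq (numq a.1 * (D %/ denq a.1)%Z, numq a.2 * (D %/ denq a.2)%Z) | a <- l].

Definition rat_sz s (q : rat) := (`|numq q| < 2 ^ s)%N && (`|denq q| < 2 ^ s)%N.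
Definition law_sz s (l : law) := (size l <= s)%N && all (fun a => rat_sz s a.1 && rat_sz s a.2) l.

Lemma sz_den_law s l : law_sz s l -> sz (den_law l) (size l * (2 * s)).+1.
Proof.
case/andP=> _; elim: l => [|a l IH] /=; first by move=> _; apply: sz_small.
case/andP=> /andP[/andP[_ d1] /andP[_ d2]] /IH{}IH.
have h1 : sz (denq a.1) s by []. have h2 : sz (denq a.2) s by [].
by apply: sz_le (sz_mul IH (sz_mul h1 h2)) _; lia.
Qed.

Lemma sz_den_all s ls : (0 < s)%N -> all (law_sz s) ls -> sz (den_all ls) (size ls * (3 * (s * s))).+1.
Proof.
move=> s0; elim: ls => [|l ls IH] /=; first by move=> _; apply: sz_small.
case/andP=> hl /IH{}IH; apply: sz_le (sz_mul IH (sz_den_law hl)) _.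
have /andP[sl _] := hl.
have : (size l * (2 * s) <= s * (2 * s))%N by rewrite leq_mul2r sl orbT.
have : (1 <= s * s)%N by rewrite muln_gt0 s0.
lia.
Qed.

Section Prep.
Variables (O : oracle) (L s : nat).
Local Notation prun := (prun prog O L).
Hypothesis s_gt0 : (0 < s)%N.
Hypothesis HL : (100 * (s * s * s * s) < L)%N.

Let spow : [/\ s <= s * s, s * s <= s * s * s, s * s * s <= s * s * s * s & 1 <= s * s * s * s]%N.
Proof. by split; rewrite ?leq_pmulr // !muln_gt0 s_gt0. Qed.
Let L_ge : (20 <= L)%N.
Proof. by have [_ _ _] := spow; lia. Qed.
Let bit0 : (bitlen 0 <= L)%N. Proof. exact: leq_trans L_ge. Qed.
Let bit1 : (bitlen 1 <= L)%N. Proof. exact: leq_trans L_ge. Qed.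

Lemma prun_len (T : Type) (enc : T -> data) (ys : seq T) u env x s1 : (size ys <= s)%N ->
  prun env x (DPair (enc_list (map enc ys)) u) s1 ->
  prun env (Call 3 x) (DInt (size ys)%:Z) (s1 + 40 * (size ys).+1).
Proof.
move=> sy hx; have [h1 h2 h3 h4] := spow.
have := prun_rec (acc := fun ys : seq T => DInt (size ys)%:Z) (s0 := 1) (s1 := 3)
  (isT : (3 < size prog)%N) erefl _ _ hx.
move=> H; apply: prun_le (H _ _) _; last by lia.
- by ev.
- move=> pre y zs E.
  have szz : sz (size zs)%:Z s by apply: nat_sz; move: sy; rewrite E size_cat /=; lia.
  have -> : (size (y :: zs))%:Z = (size zs)%:Z + 1 by rewrite /=; lia.
  by apply: prun_le; [ev; first [exact: bit1 | bits; lia] | ].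
Qed.

Lemma prun_den_law l u env x s1 : law_sz s l ->
  prun env x (DPair (enc_law l) u) s1 ->
  prun env (Call 4 x) (DInt (den_law l)) (s1 + 60 * s.+1).
Proof.
move=> hl hx; have [h1 h2 h3 h4] := spow; have /andP[sl al] := hl.
have := prun_rec (enc := enc_ratpair) (acc := fun l => DInt (den_law l)) (s0 := 1) (s1 := 18)
  (isT : (4 < size prog)%N) erefl _ _ hx.
move=> H; apply: prun_le (H _ _) _; last by lia.
- by ev.
- move=> pre a l' E; move: (al) (sl); split_pre E => /andP[_ /andP[/andP[/andP[_ d1] /andP[_ d2]] al']] sl'.
  have q1 : sz (denq a.1) s by []. have q2 : sz (denq a.2) s by [].
  have sl2 : (size l' <= s)%N by lia.
  have q3 : sz (den_law l') (size l' * (2 * s)).+1 by apply: sz_den_law; rewrite /law_sz sl2 al'.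
  have : (size l' * (2 * s) <= s * (2 * s))%N by rewrite leq_mul2r sl2 orbT.
  move=> q4; apply: prun_le; first (ev; bits; lia).
  by [].
Qed.

Lemma prun_den ls u env x s1 : (size ls <= s)%N -> all (law_sz s) ls ->
  prun env x (DPair (enc_list (map enc_law ls)) u) s1 ->
  prun env (Call 5 x) (DInt (den_all ls)) (s1 + 200 * (s * s)).
Proof.
move=> sl al hx; have [h1 h2 h3 h4] := spow.
have := prun_rec (acc := fun ls => DInt (den_all ls)) (s0 := 1) (s1 := 60 * s + 75)
  (isT : (5 < size prog)%N) erefl _ _ hx.
move=> H; apply: prun_le (H _ _) _.
- by ev.
- move=> pre l ls' E; move: (al) (sl); split_pre E => /andP[_ /andP[hl al']] sl'.
  have sl2 : (size ls' <= s)%N by lia.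
  have q1 := sz_den_law hl; have q2 := sz_den_all s_gt0 al'; have /andP[sll _] := hl.
  have q3 : (size l * (2 * s) <= s * (2 * s))%N by rewrite leq_mul2r sll orbT.
  have q4 : (size ls' * (3 * (s * s)) <= s * (3 * (s * s)))%N by rewrite leq_mul2r sl2 orbT.
  apply: prun_le.
    eapply prun_opE; [ev | eapply (prun_den_law (u := DInt 0) hl); ev | cbn [op_val]; reflexivity | | ].
    + exact: bit0.
    + by bits; lia.
    + by bits; lia.
  by rewrite /=; lia.
- have : (size ls * (60 * s + 75 + 20) <= s * (60 * s + 75 + 20))%N by rewrite leq_mul2r sl orbT.
  lia.
Qed.

Lemma prun_scale_law D l env x s1 : sz D (4 * (s * s * s)) -> law_sz s l ->
  prun env x (DPair (enc_law l) (DInt D)) s1 ->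
  prun env (Call 6 x) (enc_il (scale_law D l)) (s1 + 80 * s.+1).
Proof.
move=> szD hl hx; have [h1 h2 h3 h4] := spow; have /andP[sl al] := hl.
have := prun_rec (enc := enc_ratpair) (acc := fun l => enc_il (scale_law D l)) (s0 := 1) (s1 := 45)
  (isT : (6 < size prog)%N) erefl _ _ hx.
move=> H; apply: prun_le (H _ _) _; last by lia.
- by ev.
- move=> pre a l' E; move: (al); split_pre E => /andP[_ /andP[/andP[/andP[n1 d1] /andP[n2 d2]] al']].
  have q1 : sz (denq a.1) s by []. have q2 : sz (denq a.2) s by [].
  have q3 : sz (numq a.1) s by []. have q4 : sz (numq a.2) s by [].
  apply: prun_le; first (ev; bits; lia).
  by [].
Qed.

Lemma prun_scale D ls env x s1 : sz D (4 * (s * s * s)) -> (size ls <= s)%N -> all (law_sz s) ls ->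
  prun env x (DPair (enc_list (map enc_law ls)) (DInt D)) s1 ->
  prun env (Call 7 x) (enc_ils (map (scale_law D) ls)) (s1 + 220 * (s * s)).
Proof.
move=> szD sl al hx; have [h1 h2 h3 h4] := spow.
have := prun_rec (acc := fun ls => enc_ils (map (scale_law D) ls)) (s0 := 1) (s1 := 80 * s + 90)
  (isT : (7 < size prog)%N) erefl _ _ hx.
move=> H; apply: prun_le (H _ _) _.
- by ev.
- move=> pre l ls' E; move: (al); split_pre E => /andP[_ /andP[hl al']].
  apply: prun_le.
    eapply prun_cons; last by ev.
    by eapply (prun_scale_law szD hl); ev.
  by rewrite /=; lia.
- have : (size ls * (80 * s + 90 + 20) <= s * (80 * s + 90 + 20))%N by rewrite leq_mul2r sl orbT.
  lia.
Qed.

End Prep.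

(** The granularity G of [small_stable] for means up to [L = 17 * m ^ 2]: here 544 is [32 * 17], the
    cut of the expansion, and 68 is [4 * 17]. *)
Definition gran (m : nat) : nat :=
  (32 * (m * m * (m * m)) * (544 * (m * m) + 1) * (68 * (m * m)) ^ (544 * (m * m)))%N.
(** Digits are at most [n * gran m]: rounding n items at that scale moves a power sum by at most
    [1 / gran m]. Sums of n digits stay below this radix. *)
Definition small_base (n m : nat) : nat := (n * (n * gran m) + 1)%N.
(** One digit for each of the [544 * m ^ 2] powers at each threshold [l * B] with
    [0 < l < k * m ^ 2], and one digit for the tail. *)
Definition small_dim (k m : nat) : nat := ((k * (m * m) - 1) * (544 * (m * m)) + 1)%N.

(** No threshold is listed, so that the weight is the tail digit alone; its sum is at most
    [2 * n * m] and l ranges over [0, ..., 2 * m + 1]. *)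
Definition large_inst il D al (n k m : nat) : inst :=
  Inst il D al n%:Z k%:Z (D ^+ n) (2 * n * m)%N%:Z n.+1 1 1 0 0 0 (2 * n * m).+1 (down (2 * m + 2)).
Definition small_inst il D al (n k m : nat) : inst :=
  Inst il D al n%:Z k%:Z (D ^+ n) (2 * n * m)%N%:Z n.+1 (small_base n m)%:Z (n * gran m)%N%:Z
    (544 * (m * m)) (k * (m * m) - 1) k (small_base n m ^ small_dim k m) [:: (k * (m * m) + 1)%N].

Lemma PoszX (a r : nat) : a%:Z ^+ r = (a ^ r)%N%:Z.
Proof. by elim: r => [|r IH]; rewrite ?expr0 ?expn0 // exprS expnS IH PoszM. Qed.

(** * Sizes of the parameters for small k *)

Section Small.
Variables (O : oracle) (L e s m n k : nat).
Local Notation prun := (prun prog O L).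
Hypothesis m_gt0 : (0 < m)%N.
Hypothesis s_gt0 : (0 < s)%N.
Hypothesis He : (100 * (s * s * s * s) + 200 * 100 * (m * m * m * m) <= e)%N.
Hypothesis HL : (1000 * (e * e * e * e) < L)%N.
Hypothesis ns : (n <= s)%N.
Hypothesis k_gt0 : (0 < k)%N.
Hypothesis km : (k <= 16 * (m * m))%N.

Let mpow : [/\ m <= m * m, m * m <= m * m * m, m * m * m <= m * m * m * m & 1 <= m]%N.
Proof. by split; rewrite ?leq_pmulr. Qed.
Let spow : [/\ s <= s * s, s * s <= s * s * s, s * s * s <= s * s * s * s & 1 <= s]%N.
Proof. by split; rewrite ?leq_pmulr // !muln_gt0 s_gt0. Qed.
Let e_gt0 : (0 < e)%N.
Proof. by have [? ? ? ?] := mpow; lia. Qed.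
Let epow : [/\ e <= e * e, e * e <= e * e * e, e * e * e <= e * e * e * e & 100 * e <= e * e]%N.
Proof.
split; rewrite ?leq_pmulr // leq_mul2r; apply/orP; right.
by have [? ? ? ?] := mpow; lia.
Qed.
Let L_ge : (20 <= L)%N.
Proof. by have [? ? ? ?] := epow; lia. Qed.
Let bit0 : (bitlen 0 <= L)%N. Proof. exact: leq_trans L_ge. Qed.
Let bit1 : (bitlen 1 <= L)%N. Proof. exact: leq_trans L_ge. Qed.

Lemma h_le : (k * (m * m) <= 16 * (m * m * m * m))%N.
Proof. by have : (k * (m * m) <= 16 * (m * m) * (m * m))%N by [rewrite leq_mul2r km orbT]; lia. Qed.

(** The power has an exponent polynomial in m, hence a polynomial bit length: words stay short, and
    only the number of targets is exponential in [1 / eps]. *)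
Lemma sz_gran : sz (gran m)%:Z (90 * 100 * (m * m * m * m)).
Proof.
have [h1 h2 h3 h4] := mpow.
have szm : sz m%:Z m by apply: nat_sz.
have szR : sz (544 * (m * m) + 1)%N%:Z (545 * (m * m)) by apply: nat_sz; lia.
have szb : sz (68 * (m * m))%N%:Z (7 + (m + m)).
  by rewrite PoszM; apply: sz_mul; rewrite ?PoszM; [| exact: sz_mul].
have szp := sz_exp (544 * (m * m)) szb.
rewrite /gran !PoszM -PoszX; apply: sz_le (sz_mul (sz_mul (sz_mul (e1 := 6) _ (sz_mul (sz_mul szm szm) (sz_mul szm szm))) szR) szp) _.
  by [].
have : (544 * (m * m) * (7 + (m + m)) <= 544 * (m * m) * (9 * m))%N by rewrite leq_mul2l; apply/orP; right; lia.
lia.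
Qed.

Lemma sz_small_base : sz (small_base n m)%:Z (2 * s + 91 * 100 * (m * m * m * m)).
Proof.
have [h1 h2 h3 h4] := mpow.
have szn : sz n%:Z s by apply: nat_sz.
rewrite /small_base PoszD !PoszM; apply: sz_le (sz_add (sz_mul szn (sz_mul szn sz_gran)) (sz_cst 1)) _.
rewrite absz1; lia.
Qed.

Lemma small_dim_le : (small_dim k m <= e * e)%N.
Proof.
have [h1 h2 h3 h4] := mpow; have hh := h_le.
have q1 : (k * (m * m) - 1 <= e)%N by lia.
have q2 : (544 * (m * m) <= 544 * e)%N by lia.
rewrite /small_dim.
have : ((k * (m * m) - 1) * (544 * (m * m)) <= (16 * (m * m * m * m)) * (544 * (m * m * m * m)))%N by apply: leq_mul; lia.
have : ((200 * 100 * (m * m * m * m)) * (200 * 100 * (m * m * m * m)) <= e * e)%N by apply: leq_mul; lia.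
have : (1 <= m * m * m * m)%N by lia.
move: (m * m * m * m)%N => v v1; have : (v <= v * v)%N by rewrite leq_pmulr.
lia.
Qed.

Lemma sz_small_T : sz (small_base n m ^ small_dim k m)%N%:Z (e * e * e * e).
Proof.
have [h1 h2 h3 h4] := mpow; have [g1 g2 g3 g4] := spow; have [f1 f2 f3 f4] := epow.
rewrite -PoszX; apply: sz_le (sz_exp _ sz_small_base) _.
have q : (2 * s + 91 * 100 * (m * m * m * m) <= e)%N by lia.
have : (small_dim k m * (2 * s + 91 * 100 * (m * m * m * m)) <= (e * e) * e)%N by apply: leq_mul => //; apply: small_dim_le.
have : (2 * (e * e * e) <= e * (e * e * e))%N by rewrite leq_mul2r; apply/orP; right; lia.
lia.
Qed.

Lemma prun_small il D al env x s1 :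
  prun env x (DPair (DInt k%:Z) (DPair (DInt m%:Z) (DInt n%:Z))) s1 ->
  prun env (Call 21 x) (enc_params_of (small_inst il D al n k m))
    (s1 + 200 * (e * e) + 12 * (small_base n m ^ small_dim k m)).
Proof.
move=> hx; have [h1 h2 h3 h4] := mpow; have [g1 g2 g3 g4] := spow; have [f1 f2 f3 f4] := epow.
have hh := h_le; have hd := small_dim_le; have szT := sz_small_T.
have szm : sz m%:Z m by apply: nat_sz.
have szn : sz n%:Z s by apply: nat_sz.
have szk : sz k%:Z e by apply: nat_sz; lia.
pose R := (544 * (m * m))%N; pose h := (k * (m * m))%N.
have szm2 : sz (m * m)%N%:Z e by apply: nat_sz; lia.
have szR : sz R%:Z e by apply: nat_sz; rewrite /R; lia.
have szR1 : sz (544 * (m * m) + 1)%N%:Z e by apply: nat_sz; lia.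
have szh : sz h%:Z e by apply: nat_sz; rewrite /h; lia.
have szg : sz (gran m)%:Z e by apply: sz_le sz_gran _; lia.
have sznG : sz (n * gran m)%N%:Z e by rewrite PoszM; apply: sz_le (sz_mul szn sz_gran) _; lia.
have szBs : sz (small_base n m)%:Z e by apply: sz_le sz_small_base _; lia.
have szb : sz (68 * (m * m))%N%:Z (7 + (m + m)).
  by rewrite PoszM; apply: sz_mul; rewrite ?PoszM; [| exact: sz_mul].
have szp : sz ((68 * (m * m))%N%:Z ^+ R) e.
  apply: sz_le (sz_exp R szb) _; rewrite /R.
  have : (544 * (m * m) * (7 + (m + m)) <= 544 * (m * m) * (9 * m))%N by rewrite leq_mul2l; apply/orP; right; lia.
  lia.
have szh1 : sz (h%:Z - 1) e by have -> : h%:Z - 1 = (h - 1)%N%:Z by [rewrite /h; lia]; apply: nat_sz; rewrite /h; lia.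
have h0 : (0 < h)%N by rewrite /h !muln_gt0 k_gt0 m_gt0.
have szdim : sz (small_dim k m)%:Z (2 * e + 2).
  rewrite /small_dim PoszD PoszM; apply: sz_le (sz_add (sz_mul (a := (h - 1)%N%:Z) (e1 := e) _ szR) (sz_cst 1)) _ => //.
    by apply: nat_sz; rewrite /h; lia.
  by rewrite absz1; lia.
have qR : (R <= e)%N by rewrite /R; lia.
have qh : (h <= e)%N by rewrite /h; lia.
set T := (small_base n m ^ small_dim k m)%N in szT *.
set x0 := DPair (DInt k%:Z) (DPair (DInt m%:Z) (DInt n%:Z)) in hx.
have key : prun [:: x0] (nth (Cst 0) prog 21) (enc_params_of (small_inst il D al n k m)) (190 * (e * e) + 12 * T).
  rewrite /= /f_small; apply: prun_le.
    eapply (@prun_let _ _ _ _ _ _ (DInt (m * m)%N%:Z)).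
      by eapply prun_opE; [ev | ev | by rewrite PoszM | bits; lia | bits; lia].
    eapply (@prun_let _ _ _ _ _ _ (DInt R%:Z)).
      by eapply prun_opE; [apply: prun_cst; apply: (@sz_bitlen _ 10); [by [] | lia] | ev | by rewrite /R PoszM | bits; lia | bits; lia].
    eapply (@prun_let _ _ _ _ _ _ (DInt h%:Z)).
      by eapply prun_opE; [ev | ev | by rewrite /h PoszM | bits; lia | bits; lia].
    eapply (@prun_let _ _ _ _ _ _ (DInt (n * gran m)%N%:Z)).
      eapply prun_opE; [ev | | by rewrite PoszM | by bits; lia | by bits; lia].
      eapply (@prun_opE _ _ _ _ _ _ _ (32 * (m * m * (m * m)) * (544 * (m * m) + 1))%N%:Z ((68 * (m * m))%N%:Z ^+ R)).
      - eapply (@prun_opE _ _ _ _ _ _ _ (32 * (m * m * (m * m)))%N%:Z (544 * (m * m) + 1)%N%:Z).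
        + eapply (@prun_opE _ _ _ _ _ _ _ 32 (m * m * (m * m))%N%:Z); [ | | by rewrite PoszM | | ].
          * by apply: prun_cst; apply: (@sz_bitlen _ 6); [by [] | lia].
          * by eapply prun_opE; [ev | ev | by rewrite PoszM | bits; lia | bits; lia].
          * by apply: (@sz_bitlen _ 6); [by [] | lia].
          * by rewrite PoszM; bits; lia.
        + by eapply prun_opE; [ev | exact: prun_cst | by rewrite PoszD | bits; lia | exact: bit1].
        + by rewrite [in RHS]PoszM.
        + by rewrite !PoszM; apply: (@sz_bitlen _ (6 + (e + e))); [rewrite -PoszM; apply: sz_mul => //; rewrite PoszM; apply: sz_mul | lia].
        + by bits; lia.
      - eapply (prun_pow L_ge szb (e := 7 + (m + m)) (N := R) (eN := e)) => //.
        + by lia.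
        + have : (544 * (m * m) * (7 + (m + m)) <= 544 * (m * m) * (9 * m))%N by rewrite leq_mul2l; apply/orP; right; lia.
          by rewrite /R; lia.
        + by eapply prun_opE; [apply: prun_cst; apply: (@sz_bitlen _ 7); [by [] | lia] | ev | by rewrite PoszM | apply: (@sz_bitlen _ 7); [by [] | lia] | bits; lia].
        + by ev.
      - by rewrite /gran [in RHS]PoszM PoszX.
      - rewrite PoszM; apply: (@sz_bitlen _ (6 + (e + e) + e)); last by lia.
        apply: sz_mul => //; rewrite PoszM; apply: sz_mul => //; rewrite PoszM; exact: sz_mul.
      - by bits; lia.
    eapply (@prun_let _ _ _ _ _ _ (DInt (small_base n m)%:Z)).
      eapply prun_opE; [ | exact: prun_cst | by rewrite /small_base PoszD PoszM | | exact: bit1].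
      + by eapply prun_opE; [ev | ev | by [] | bits; lia | bits; lia].
      + by bits; lia.
    eapply prun_cons; first by ev.
    eapply prun_cons; first by ev.
    eapply prun_cons; first by eapply (prun_down L_ge szR); [lia | ev].
    eapply prun_cons.
      have E : h%:Z - 1 = (h - 1)%N%:Z by lia.
      eapply (prun_down L_ge (N := h - 1) (e := e)); [ by rewrite -E | lia | ].
      by eapply prun_opE; [ev | exact: prun_cst | by rewrite -E | bits; lia | exact: bit1].
    eapply prun_cons; first by eapply (prun_down L_ge szk); [lia | ev].
    eapply prun_cons.
      eapply (prun_down L_ge szT); first by lia.
      rewrite /T -PoszX; eapply (prun_pow L_ge szBs (N := small_dim k m) (eN := 2 * e + 2)) => //.
      + by lia.
      + have : (small_dim k m * e <= (e * e) * e)%N by rewrite leq_mul2r hd orbT.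
        by lia.
      + by ev.
      + eapply (@prun_opE _ _ _ _ _ _ _ ((h - 1) * R)%N%:Z 1); [ | exact: prun_cst | by rewrite /small_dim PoszD | | exact: bit1].
        * have E : h%:Z - 1 = (h - 1)%N%:Z by lia.
          by eapply prun_opE; [eapply prun_opE; [ev | exact: prun_cst | by [] | bits; lia | exact: bit1] | ev | by rewrite /= E PoszM | bits; lia | bits; lia].
        * rewrite PoszM; apply: (@sz_bitlen _ (e + e)); last by lia.
          by apply: sz_mul => //; apply: nat_sz; lia.
    eapply prun_cons; last exact: prun_cst.
    eapply prun_cons; last exact: prun_cst.
    by eapply prun_opE; [ev | exact: prun_cst | by rewrite /enc_nat PoszD | bits; lia | exact: bit1].
  by rewrite /=; move: T szT => T _; lia.
by apply: prun_le (prun_call _ hx key) _ => //; lia.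
Qed.
End Small.

Lemma bitlen_lt z : (`|z| < 2 ^ bitlen z)%N.
Proof. exact: trunc_log_ltn. Qed.

Lemma dsize_gt0 x : (0 < dsize x)%N.
Proof. by case: x. Qed.

Lemma dsize_list_size xs : (size xs < dsize (enc_list xs))%N.
Proof. by elim: xs => //= x xs IH; have := dsize_gt0 x; lia. Qed.

Lemma dsize_list_mem (T : eqType) (f : T -> data) xs x :
  x \in xs -> (dsize (f x) <= dsize (enc_list (map f xs)))%N.
Proof. by elim: xs => //= y xs IH; rewrite inE => /orP[/eqP->|/IH]; lia. Qed.

Ltac fields := cbn [large_inst small_inst i_il i_D i_al i_n i_k i_Dn i_cap i_bl i_Bs i_nG i_R i_Ls
  i_kn i_T i_Ll].

(** * The run on a given input *)

Section Main.
Variables (O : oracle) (F : set_system) (X : 'I_(ground F) -> law) (k : nat) (eps : rat).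
Variable code : bitseq.
Variable cst : ('I_(ground F) -> int) -> nat -> Prop.
Hypothesis k_gt0 : (0 < k)%N.
Hypothesis eps_gt0 : 0 < eps.
Hypothesis HO : forall w target, exists r c,
  [/\ O (enc_query w target) (enc_answer r) c, exact_sum_answer w target r & cst w c].

Local Notation n := (ground F).
(** The integer part of [1 / eps], plus 1. *)
Definition precision := (`|(denq eps %/ numq eps)%Z|.+1)%N.
Local Notation m := precision.
Definition input_size := dsize (enc_params X k eps).
Local Notation s := input_size.
(** The term in [s] makes room for [D ^ n], of about [4 * s ^ 4] bits, and the term in [m] for the
    radix, of [O(m ^ 4)] bits. *)
Definition word_size := (100 * (s * s * s * s) + 200 * 100 * (m * m * m * m))%N.
Local Notation e := word_size.
Definition word_bound := (1000 * (e * e * e * e)).+1.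
Local Notation L := word_bound.
Definition all_laws := [seq X i | i <- enum 'I_n].
Local Notation laws := all_laws.
Definition common_den := den_all laws.
Local Notation D := common_den.
Definition scaled_law i := scale_law D (X i).
Local Notation il := scaled_law.
Definition scaled_laws := [seq il i | i <- enum 'I_n].
Local Notation ils := scaled_laws.
Definition layer_scale := D * k%:Z * m%:Z.
Local Notation al := layer_scale.
Definition large_mode := 16 * (denq eps * denq eps) <= k%:Z * (numq eps * numq eps).
Local Notation large := large_mode.
Definition ptas_inst := if large then large_inst ils D al n k m else small_inst ils D al n k m.
Local Notation K := ptas_inst.
Hypothesis km : ~~ large -> (k <= 16 * (m * m))%N.

Lemma num_gt0 : 0 < numq eps. Proof. by rewrite numq_gt0. Qed.

Lemma precisionE : (denq eps %/ numq eps)%Z + 1 = m%:Z.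
Proof.
have := num_gt0; have := denq_gt0 eps; rewrite /m => d0 n0.
have : 0 <= (denq eps %/ numq eps)%Z by rewrite divz_ge0 // ltW.
by clear; lia.
Qed.

Lemma s_gt0 : (0 < s)%N. Proof. exact: dsize_gt0. Qed.
Lemma m_gt0 : (0 < m)%N. Proof. by []. Qed.
Lemma n_gt0 : (0 < n)%N. Proof. exact: ground_gt0. Qed.

Lemma laws_dsize : (dsize (enc_laws X) <= s)%N.
Proof. exact: leqW (leq_addr _ _). Qed.

Lemma size_laws : size laws = n.
Proof. by rewrite size_map size_enum_ord. Qed.

Lemma n_le : (n <= s)%N.
Proof.
have h := dsize_list_size [seq enc_law (X i) | i <- enum 'I_n].
rewrite size_map size_enum_ord in h; exact: leq_trans (ltnW h) laws_dsize.
Qed.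

Lemma rat_sz_dsize q N : (dsize (enc_rat q) <= N)%N -> rat_sz N q.
Proof.
rewrite /= /rat_sz => h; apply/andP; split.
  by apply: leq_trans (bitlen_lt _) _; rewrite leq_exp2l //; lia.
by apply: leq_trans (bitlen_lt _) _; rewrite leq_exp2l //; lia.
Qed.

Lemma laws_sz : all (law_sz s) laws.
Proof.
apply/allP => l /mapP[i _ ->]; have h := laws_dsize.
have hi : (dsize (enc_law (X i)) <= s)%N.
  by apply: leq_trans (dsize_list_mem (fun i => enc_law (X i)) (mem_enum 'I_n i)) h.
apply/andP; split.
  have h2 := dsize_list_size [seq DPair (enc_rat a.1) (enc_rat a.2) | a <- X i].
  by rewrite size_map in h2; apply: leq_trans (ltnW h2) hi.
apply/allP => a aX; have := leq_trans (dsize_list_mem (fun a => DPair (enc_rat a.1) (enc_rat a.2)) aX) hi.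
by move=> /= ha; apply/andP; split; apply: rat_sz_dsize => /=; lia.
Qed.

Lemma sz_k : sz k%:Z s.
Proof.
apply: leq_trans (bitlen_lt _) _; rewrite leq_exp2l // /s /enc_params /=; lia.
Qed.

Lemma sz_num : sz (numq eps) s.
Proof. apply: leq_trans (bitlen_lt _) _; rewrite leq_exp2l // /s /enc_params /=; lia. Qed.
Lemma sz_den : sz (denq eps) s.
Proof. apply: leq_trans (bitlen_lt _) _; rewrite leq_exp2l // /s /enc_params /=; lia. Qed.

Lemma mpow : [/\ m <= m * m, m * m <= m * m * m, m * m * m <= m * m * m * m & 1 <= m]%N.
Proof. by split; rewrite ?leq_pmulr. Qed.
Lemma spow : [/\ s <= s * s, s * s <= s * s * s, s * s * s <= s * s * s * s & 1 <= s]%N.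
Proof. by have := s_gt0 => s0; split; rewrite ?leq_pmulr // !muln_gt0 s0. Qed.
Lemma e_gt0 : (0 < e)%N.
Proof. by have [? ? ? ?] := mpow; rewrite /e; lia. Qed.
Lemma epow : [/\ e <= e * e, e * e <= e * e * e, e * e * e <= e * e * e * e & 100 * e <= e * e]%N.
Proof.
have e0 := e_gt0; split; rewrite ?leq_pmulr // leq_mul2r; apply/orP; right.
by have [? ? ? ?] := mpow; rewrite /e; lia.
Qed.

Lemma sz_D : sz D (4 * (s * s * s)).
Proof.
apply: sz_le (sz_den_all s_gt0 laws_sz) _; rewrite size_laws.
have [h1 h2 h3 h4] := spow.
have : (n * (3 * (s * s)) <= s * (3 * (s * s)))%N by rewrite leq_mul2r n_le orbT.
by lia.
Qed.

Lemma il_sz i : (size (il i) <= s)%N /\ atoms_sz (5 * (s * s * s)) (il i).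
Proof.
have /andP[sl al0] := allP laws_sz (X i) (map_f X (mem_enum 'I_n i)).
have [h1 h2 h3 h4] := spow; have szD := sz_D.
split; first by rewrite size_map.
rewrite /atoms_sz all_map; apply/allP => a aX.
have /andP[/andP[n1 _] /andP[n2 _]] := allP al0 a aX.
have n1' : sz (numq a.1) s by []. have n2' : sz (numq a.2) s by [].
have q1 : sz (numq a.1 * (D %/ denq a.1)%Z) (5 * (s * s * s)) by apply: sz_le (sz_mul n1' (sz_div _ szD)) _; lia.
have q2 : sz (numq a.2 * (D %/ denq a.2)%Z) (5 * (s * s * s)) by apply: sz_le (sz_mul n2' (sz_div _ szD)) _; lia.
by apply/andP; split.
Qed.

Lemma atoms_sz_le a b l : atoms_sz a l -> (a <= b)%N -> atoms_sz b l.
Proof.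
move=> /allP h ab; apply/allP => x /h /andP[h1 h2].
by apply/andP; split; [apply: leq_trans h1 _ | apply: leq_trans h2 _]; rewrite leq_exp2l.
Qed.

Lemma sz_base i : sz (base il i) (18 * (s * s * s) + 2).
Proof.
have [h1 h2 h3 h4] := spow; have [sl al0] := il_sz i.
apply: sz_le (sz_excz (e := 5 * (s * s * s)) (ec := 0) al0 _ (sz0 _)) _.
  by apply: sz_small => //; lia.
by lia.
Qed.

Lemma K_il : i_il K = [seq il i | i <- enum 'I_(ground F)].
Proof. by rewrite /K; case: large. Qed.
Lemma K_bl : i_bl K = n.+1.
Proof. by rewrite /K; case: large. Qed.

Lemma cand_sz_main B : cand K il B -> sz B e.
Proof.
case=> b; rewrite K_bl ltnS => bn [i ->].
have [h1 h2 h3 h4] := spow; have := n_le => ns.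
have q : sz b%:Z s by apply: nat_sz; apply: leq_trans bn ns.
by apply: sz_le (sz_mul q (sz_base i)) _; rewrite /e; lia.
Qed.

Lemma bounded_K : bounded e K.
Proof.
have [h1 h2 h3 h4] := spow; have [g1 g2 g3 g4] := mpow; have ns := n_le; have [f1 f2 f3 f4] := epow.
have szD := sz_D; have szk := sz_k.
have szn : sz n%:Z s by apply: nat_sz.
have szm : sz m%:Z m by apply: nat_sz.
have se : (18 * (s * s * s) + s + m + 10 <= e)%N by rewrite /e; lia.
have c_il : (size ils <= e)%N by rewrite size_map size_enum_ord; apply: leq_trans ns _; lia.
have c_laws : all (fun l => (size l <= e)%N && atoms_sz e l) ils.
  apply/allP => l /mapP[i _ ->]; have [sl al0] := il_sz i.
  by apply/andP; split; [lia | apply: atoms_sz_le al0 _; lia].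
have c_D : sz D e by apply: sz_le szD _; lia.
have c_al : sz al e by apply: sz_le (sz_mul (sz_mul szD szk) szm) _; lia.
have c_n : sz n%:Z e by apply: sz_le szn _; lia.
have c_k : sz k%:Z e by apply: sz_le szk _; lia.
have c_Dn : sz (D ^+ n) e.
  apply: sz_le (sz_exp n szD) _; have : (n * (4 * (s * s * s)) <= s * (4 * (s * s * s)))%N by rewrite leq_mul2r ns orbT.
  by rewrite /e; lia.
have c_cap : sz (2 * n * m)%N%:Z (2 + s + m) by rewrite !PoszM; apply: sz_mul => //; apply: sz_mul.
have c_cap' : sz (2 * n * m)%N%:Z e by apply: sz_le c_cap _; lia.
have c1 : sz 1 e by apply: sz_small => //; lia.
rewrite /K; case: (boolP large) => lg.
  apply: (@Bounded e (large_inst ils D al n k m) c_il c_laws c_D c_al c_n c_k c_Dn c_cap'); fields.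
  - by lia.
  - exact: c1.
  - exact: c1.
  - by [].
  - by [].
  - by [].
  - by left.
  - have -> : (2 * n * m).+1%:Z = (2 * n * m)%N%:Z + 1 by lia.
    by apply: sz_le (sz_add c_cap (sz_cst 1)) _; rewrite absz1; lia.
  - by rewrite size_down /e; lia.
  - apply/allP => x /mem_down /andP[x0 xm]; rewrite x0 andbT.
    have : sz x%:Z e by apply: nat_sz; rewrite /e; lia.
    by [].
have kk := km lg.
have He : (100 * (s * s * s * s) + 200 * 100 * (m * m * m * m) <= e)%N by [].
have HL : (1000 * (e * e * e * e) < L)%N by [].
have hh := h_le m_gt0 s_gt0 He HL ns k_gt0 kk.
have hT := sz_small_T m_gt0 s_gt0 He HL ns k_gt0 kk.
have hB := sz_small_base m_gt0 s_gt0 He HL ns k_gt0 kk.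
have hG := sz_gran m_gt0 s_gt0 He HL ns k_gt0 kk.
apply: (@Bounded e (small_inst ils D al n k m) c_il c_laws c_D c_al c_n c_k c_Dn c_cap'); fields.
- by lia.
- by apply: sz_le hB _; rewrite /e; lia.
- by rewrite PoszM; apply: sz_le (sz_mul szn hG) _; rewrite /e; lia.
- by rewrite /e; lia.
- by rewrite /e; lia.
- by rewrite /e; lia.
- by right.
- exact: hT.
- exact: e_gt0.
- rewrite /all andbT !addn1 andbT.
  have : sz (k * (m * m) + 1)%N%:Z e by apply: nat_sz; rewrite /e; lia.
  by rewrite /sz absz_nat addn1.
Qed.

Definition step_count := (80 * 100 * (e * e * e * e * e * e * e) * (i_T K).+1)%N.
Local Notation steps := step_count.

(** The final [Snd] evaluates only on a pair, so the run is conditional on the accumulator being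
    one. That follows later, from a query that must have succeeded. *)
Lemma run_main : exists a tr, [/\
  forall u v, a = DPair u v -> runs prog O L [:: ptas_input code X k eps] f_main v steps tr,
  acc_ok K il a,
  forall i b l t, (b < n.+1)%N -> l \in i_Ll K -> (t < i_T K)%N ->
    reached K il (b%:Z * base il i) (l%:Z - 1) t%:Z a &
  (forall qc, List.In qc tr -> asked K il cst qc) /\
  (size tr <= n * (n.+1 * (size (i_Ll K) * i_T K)))%N].
Proof.
have [h1 h2 h3 h4] := spow; have [g1 g2 g3 g4] := mpow; have ns := n_le; have [f1 f2 f3 f4] := epow.
have e0 := e_gt0; have HL : (1000 * (e * e * e * e) < L)%N by [].
have se : (18 * (s * s * s) + s + m + 10 <= e)%N by rewrite /e; lia.
have ss : (100 * (s * s * s * s) <= e)%N by rewrite /e; lia.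
have se3 : (100 * (s * s * s * s) < L)%N by lia.
have L_ge : (20 <= L)%N by lia.
have bit0 : (bitlen 0 <= L)%N by exact: leq_trans L_ge.
have bit1 : (bitlen 1 <= L)%N by exact: leq_trans L_ge.
have bit2 : (bitlen 2 <= L)%N by exact: leq_trans L_ge.
have szD := sz_D; have szk := sz_k; have szden := sz_den; have sznum := sz_num.
have szn : sz n%:Z s by apply: nat_sz.
have szm : sz m%:Z m by apply: nat_sz.
have HK := bounded_K; have bilK := b_il HK.
have lsz : (size laws <= s)%N by rewrite size_laws.
set x0 := ptas_input code X k eps.
have E0 : x0 = DPair (enc_bits code) (DPair (enc_list (map enc_law laws)) (DPair (DInt k%:Z)
   (DPair (DInt (numq eps)) (DInt (denq eps))))).
  by rewrite /x0 /ptas_input /enc_params /enc_laws /laws -map_comp.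
have Hm : prun prog O L [:: x0] (Op Add (Op Div (Snd (Snd (Snd (Snd (Var 0))))) (Fst (Snd (Snd (Snd (Var 0)))))) (Cst 1))
   (DInt m%:Z) 20.
  rewrite E0 -precisionE; apply: prun_le; [ev; first [exact: bit1 | bits; lia] | by []].
have Hn : prun prog O L [:: DInt m%:Z; x0] (Call 3 (Cons (Fst (Snd (Var 1))) (Cst 0))) (DInt n%:Z) (10 + 40 * s.+1).
  rewrite E0 -size_laws; apply: prun_le; first by eapply (prun_len s_gt0 se3 lsz); ev.
  by rewrite size_laws /=; lia.
have HD : prun prog O L [:: DInt n%:Z; DInt m%:Z; x0] (Call 5 (Cons (Fst (Snd (Var 2))) (Cst 0))) (DInt D) (10 + 200 * (s * s)).
  rewrite E0; apply: prun_le; first by eapply (prun_den s_gt0 se3 lsz laws_sz); ev.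
  by lia.
have szcap : sz (2 * n%:Z * m%:Z) (2 + s + m) by apply: sz_mul => //; apply: sz_mul.
have Ecap : (2 * n * m)%N%:Z = 2 * n%:Z * m%:Z by rewrite !PoszM.
set P := (If (Op Leq (Op Mul (Cst 16) (Op Mul (Snd (Snd (Snd (Snd (Var 3))))) (Snd (Snd (Snd (Snd (Var 3)))))))
        (Op Mul (Fst (Snd (Snd (Var 3)))) (Op Mul (Fst (Snd (Snd (Snd (Var 3))))) (Fst (Snd (Snd (Snd (Var 3))))))))
     (Cons (Cst 1) (Cons (Cst 1) (Cons (Cst 0) (Cons (Cst 0) (Cons (Cst 0)
       (Cons (Call 1 (Op Add (Op Mul (Op Mul (Cst 2) (Var 1)) (Var 2)) (Cst 1)))
       (Cons (Call 1 (Op Add (Op Mul (Cst 2) (Var 2)) (Cst 2))) (Cst 0))))))))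
     (Call 21 (Cons (Fst (Snd (Snd (Var 3)))) (Cons (Var 2) (Var 1))))).
have HP : prun prog O L [:: DInt D; DInt n%:Z; DInt m%:Z; x0] P (enc_params_of K)
   (400 * (e * e) + 30 * (i_T K).+1).
  have -> : enc_params_of K = if 16 * (denq eps * denq eps) <= k%:Z * (numq eps * numq eps)
     then enc_params_of (large_inst ils D al n k m) else enc_params_of (small_inst ils D al n k m).
    by rewrite /K /large; case: ifP.
  rewrite E0 /P.
  have sz16 : sz 16 5 by [].
  have bT := b_T HK.
  apply: (@prun_le prog O L _ _ _ (30 + 30 + (150 * e + 12 * (i_T K).+1) + (200 * (e * e) + 50 + 12 * (i_T K)) + 2)); last by lia.
  eapply prun_ifle.
  - by apply: prun_le; [ev; first [apply: (@sz_bitlen _ 5) => //; lia | bits; lia] | by []].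
  - by apply: prun_le; [ev; bits; lia | by []].
  - by bits; lia.
  - by bits; lia.
  - move=> lg; have EK : K = large_inst ils D al n k m by rewrite /K /large lg.
    rewrite EK in bT *; rewrite [i_T _]/= in bT *.
    apply: prun_le.
      eapply prun_cons; first exact: prun_cst.
      eapply prun_cons; first exact: prun_cst.
      eapply prun_cons; first exact: prun_cst.
      eapply prun_cons; first exact: prun_cst.
      eapply prun_cons; first exact: prun_cst.
      eapply prun_cons.
        eapply (prun_down L_ge bT); first by lia.
        have -> : (2 * n * m).+1%:Z = 2 * n%:Z * m%:Z + 1 by rewrite -Ecap; lia.
        by ev; first [exact: bit1 | exact: bit2 | bits; lia].
      eapply prun_cons; last exact: prun_cst.
      eapply (prun_down L_ge (N := (2 * m + 2)%N) (e := e)).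
      - by apply: nat_sz; rewrite /e; lia.
      - by lia.
      - have -> : (2 * m + 2)%N%:Z = 2 * m%:Z + 2 by rewrite PoszD PoszM.
        by ev; first [exact: bit1 | exact: bit2 | bits; lia].
    by have : (2 * m + 2 <= e)%N by [rewrite /e; lia]; lia.
  - move=> lg; have EK : K = small_inst ils D al n k m by rewrite /K /large leNgt lg.
    have kk : (k <= 16 * (m * m))%N by apply: km; rewrite /large -ltNge.
    rewrite EK [i_T _]/=.
    have He : (100 * (s * s * s * s) + 200 * 100 * (m * m * m * m) <= e)%N by [].
    apply: prun_le; first by eapply (prun_small m_gt0 s_gt0 He HL ns k_gt0 kk); ev.
    by lia.
have Hil : prun prog O L [:: enc_params_of K; DInt D; DInt n%:Z; DInt m%:Z; x0]
   (Call 7 (Cons (Fst (Snd (Var 4))) (Var 1))) (enc_ils ils) (10 + 220 * (s * s)).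
  have -> : ils = map (scale_law D) laws by rewrite /ils /laws -map_comp.
  by rewrite E0; apply: prun_le; [eapply (prun_scale s_gt0 se3 szD lsz laws_sz); ev | lia].
have Hx : prun prog O L [:: enc_ils ils; enc_params_of K; DInt D; DInt n%:Z; DInt m%:Z; x0]
   (Cons (Var 0) (Cons (Var 0) (Cons (Var 2) (Cons (Op Mul (Op Mul (Var 2) (Fst (Snd (Snd (Var 5))))) (Var 4)) (Cons (Var 3)
    (Cons (Fst (Snd (Snd (Var 5)))) (Cons (pow_e (Var 2) (Var 3)) (Cons (Op Mul (Op Mul (Cst 2) (Var 3)) (Var 4))
    (Cons (Call 1 (Op Add (Var 3) (Cst 1))) (Var 1)))))))))) (DPair (enc_ils (i_il K)) (enc_inst K)) (100 + 60 * s.+1).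
  have -> : enc_inst K = DPair (enc_ils ils) (DPair (DInt D) (DPair (DInt al) (DPair (DInt n%:Z)
    (DPair (DInt k%:Z) (DPair (DInt (D ^+ n)) (DPair (DInt (2 * n%:Z * m%:Z)) (DPair (enc_down n.+1) (enc_params_of K)))))))).
    by rewrite -Ecap /enc_inst /K; case: large.
  have -> : i_il K = ils by rewrite /K; case: large.
  have q : (n * (4 * (s * s * s)) <= s * (4 * (s * s * s)))%N by rewrite leq_mul2r ns orbT.
  rewrite E0; apply: prun_le.
    eapply prun_cons; first by ev.
    eapply prun_cons; first by ev.
    eapply prun_cons; first by ev.
    eapply prun_cons; first by ev; bits; lia.
    eapply prun_cons; first by ev.
    eapply prun_cons; first by ev.
    eapply prun_cons; first by eapply (prun_pow L_ge szD szn); [lia | lia | ev | ev].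
    eapply prun_cons; first by ev; first [exact: bit2 | bits; lia].
    eapply prun_cons; last by ev.
    eapply (prun_down L_ge (N := n.+1) (e := s.+2)).
    - have -> : n.+1%:Z = n%:Z + 1 by lia.
      by apply: sz_le (sz_add szn (sz_cst 1)) _; rewrite absz1; lia.
    - by lia.
    - have -> : n.+1%:Z = n%:Z + 1 by lia.
      by ev; first [exact: bit1 | bits; lia].
  by rewrite /=; lia.
have base_sz i : sz (base il i) e by apply: sz_le (sz_base i) _; lia.
have [a [tr [ra oka ga [ask st]]]] := run_items e0 HK HL K_il HO cand_sz_main base_sz Hx.
have EilK : size (i_il K) = n by rewrite K_il size_map size_enum_ord.
rewrite K_bl EilK in ga st; exists a, tr; split=> // u v Ea.
rewrite Ea in ra.
have R1 := runs_let Hm (runs_let Hn (runs_let HD (runs_let HP (runs_let Hil (runs_snd ra))))).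
apply: runs_le R1 _.
rewrite /steps.
have q7 : (e * e <= e * e * e * e * e * e * e)%N.
  have -> : (e * e * e * e * e * e * e = e * e * (e * e * e * e * e))%N by rewrite !mulnA.
  by apply: leq_pmulr; rewrite !muln_gt0 e0.
move: (i_T K) (e * e * e * e * e * e * e)%N q7 => T w q7.
have : (w <= w * T.+1)%N by rewrite leq_pmulr.
have : (T.+1 <= w * T.+1)%N by rewrite leq_pmull //; lia.
lia.
Qed.

End Main.

(** * From scaled integers to probabilities *)

Lemma exczE l al c : excz l al c = \sum_(a <- l) a.2 * Num.max 0 (al * a.1 - c).
Proof.
elim: l => [|a l IH]; rewrite ?big_nil // big_cons -IH /=.
case: ifP => h; first by rewrite max_r // addrC.
by rewrite max_l ?mulr0 ?add0r // ltW // ltNge h.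
Qed.

Lemma pbin_ge (R : realFieldType) (ps : seq R) (f : nat -> R) j : probs ps ->
  {homo f : x y / (x <= y)%N >-> x <= y} -> f j <= pbin ps f j.
Proof.
move=> + fm; elim: ps j => //= q ps IH j /andP[/andP[q0 q1] H].
have h1 := IH j H; have h2 := pbin_nondec j H fm.
have : 0 <= q * (pbin ps f j.+1 - pbin ps f j) by rewrite mulr_ge0 // subr_ge0.
by lra.
Qed.

(** As [k > 0], min(k, N) is at least the indicator of each single event. Summed over the layers: a
    set is worth at least the mean of any of its items. *)
Lemma emin_ge (R : realFieldType) (ps : seq R) k q : (0 < k)%N -> probs ps -> q \in ps -> q <= emin k ps.
Proof.
move=> k0; have fm : {homo (fun x => (minn k x)%:R : R) : x y / (x <= y)%N >-> x <= y}.
  by move=> x y xy; rewrite ler_nat; lia.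
have f0 (ps' : seq R) : pbin ps' (fun x => (minn k x)%:R) 0 = emin k ps' by [].
elim: ps => //= q' ps IH /andP[/andP[q0 q1] H]; rewrite inE => /orP[/eqP->|/(IH H)].
  rewrite /emin /=; have h1 := pbin_ge 0 H fm; have h2 := pbin_ge 1 H fm.
  rewrite (_ : minn k 1 = 1)%N in h2; last by lia.
  rewrite (_ : minn k 0 = 0)%N in h1; last by lia.
  have : 0 <= q' * (pbin ps (fun x => (minn k x)%:R) 1 - 1) by rewrite mulr_ge0 // subr_ge0.
  have : 0 <= (1 - q') * pbin ps (fun x => (minn k x)%:R) 0 by rewrite mulr_ge0 // subr_ge0.
  lra.
rewrite /emin /=; have h2 := pbin_nondec 0 H fm.
have : 0 <= q' * (pbin ps (fun x => (minn k x)%:R) 1 - pbin ps (fun x => (minn k x)%:R) 0) by rewrite mulr_ge0 // subr_ge0.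
lra.
Qed.

Section Glue.
Variables (n : nat) (X : 'I_n -> law) (k m : nat) (D : int).
Hypothesis lawX : forall i, is_law (X i).
Hypothesis D_gt0 : 0 < D.
Hypothesis D_dvd : forall i a, a \in X i -> (denq a.1 %| D)%Z && (denq a.2 %| D)%Z.
Hypothesis k_gt0 : (0 < k)%N.
Hypothesis m_gt1 : (1 < m)%N.

Definition gal := D * k%:Z * m%:Z.
Definition gil i := scale_law D (X i).
(** The number of layers per unit of an atom: [gil] multiplies the atoms by [D], and [gal] is
    applied on top. *)
Definition alpha : rat := (gal * D)%:~R.
Definition gp i j := pexc X alpha i j.
Definition gJ := (\max_(i < n) \max_(a <- gil i) `|(gal * a.1)%R|)%N.

Lemma gal_gt0 : 0 < gal.
Proof. by rewrite !mulr_gt0 // ltz_nat // ltnW. Qed.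

Lemma alpha_gt0 : 0 < alpha.
Proof. by rewrite ltr0z mulr_gt0 ?gal_gt0. Qed.

Lemma scale_rat q : (denq q %| D)%Z -> (numq q * (D %/ denq q)%Z)%:~R = D%:~R * q.
Proof.
move=> /divzK E; have -> : D%:~R = (D %/ denq q)%Z%:~R * (denq q)%:~R :> rat by rewrite -intrM E.
by rewrite intrM numqE; ring.
Qed.

Lemma gil_ge0 i a : a \in gil i -> 0 <= a.1 /\ 0 <= a.2.
Proof.
case/mapP=> b bX ->; have [/allP /(_ _ bX) /andP[b1 b2] _] := lawX i.
have DD q : 0 <= (D %/ denq q)%Z by rewrite divz_ge0 ?denq_gt0 // ltW.
by rewrite /= !mulr_ge0 ?DD ?numq_ge0.
Qed.

Lemma alphaE i a : a \in X i -> alpha * a.1 = (gal * (numq a.1 * (D %/ denq a.1)%Z))%:~R.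
Proof.
by move=> aX; rewrite [in RHS]intrM scale_rat /alpha ?intrM ?mulrA //; have /andP[] := D_dvd aX.
Qed.

Lemma alphaJ i a : a \in X i -> exists2 z : nat, alpha * a.1 = z%:R & (z <= gJ)%N.
Proof.
move=> aX; set b := (numq a.1 * (D %/ denq a.1)%Z, numq a.2 * (D %/ denq a.2)%Z).
have bg : b \in gil i by apply/mapP; exists a.
exists `|(gal * b.1)%R|%N.
  rewrite (alphaE aX) -[RHS]/((Posz `|(gal * b.1)%R|)%:~R) gez0_abs //.
  by rewrite mulr_ge0 ?(ltW gal_gt0) //; have [] := gil_ge0 bg.
apply: leq_trans (leq_bigmax_cond (F := fun i => \max_(a <- gil i) `|(gal * a.1)%R|)%N i isT).
exact: (leq_bigmax_seq (F := fun a : int * int => `|(gal * a.1)%R|%N)).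
Qed.

Lemma gp01 i j : 0 <= gp i j <= 1.
Proof. exact: pexc01. Qed.
Lemma gp_anti i j j' : (j <= j')%N -> gp i j' <= gp i j.
Proof. exact: pexc_anti. Qed.
Lemma gp_J i j : (gJ <= j)%N -> gp i j = 0.
Proof. by apply: pexc_J => a i'; apply: alphaJ. Qed.

Lemma lval_ETop S : alpha * ETop X k S = lval gp gJ k S.
Proof. by apply: ETop_layers => //; [exact: alpha_gt0 | move=> i a; apply: alphaJ]. Qed.

Lemma intr_max0 (z : int) : (Num.max 0 z)%:~R = Num.max 0 z%:~R :> rat.
Proof.
by case: (lerP 0 z) => h; [rewrite max_r ?ler0z | rewrite max_l ?lerz0 ?ltW].
Qed.

Lemma exc_excess i (c : nat) : (excz (gil i) gal c)%:~R = D%:~R * excess gp gJ i c.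
Proof.
rewrite exczE rmorph_sum /= big_map excess_pexc; last by move=> ? ?; apply: alphaJ.
rewrite mulr_sumr big_seq_cond [RHS]big_seq_cond; apply: eq_bigr => a /andP[aX _].
rewrite /= [in LHS]intrM scale_rat ?mulrA; last by have /andP[] := D_dvd aX.
congr (_ * _); rewrite intr_max0; congr (Num.max _ _).
by rewrite (alphaE aX) intrB mulrA.
Qed.

Lemma D_gt0R : 0 < D%:~R :> rat. Proof. by rewrite ltr0z. Qed.

Lemma pn_gp i (c : nat) : (excz (gil i) gal c - excz (gil i) gal (c%:Z + 1))%:~R = D%:~R * gp i c.
Proof.
have -> : c%:Z + 1 = c.+1%:Z by lia.
rewrite intrB !exc_excess -mulrBr; congr (_ * _); rewrite /excess.
have [cJ|Jc] := ltnP c gJ; first by rewrite big_ltn // addrK.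
by rewrite !big_geq ?gp_J ?subrr // ltnW.
Qed.

(** This is why the layer scale contains [k * m]: what remains is an integer, so that its multiples
    are admissible values of B. *)
Lemma excess0 i : excess gp gJ i 0 = (k * m)%:R * (excz (gil i) 1 0)%:~R.
Proof.
have D0 := D_gt0R; apply: (mulfI (lt0r_neq0 D0)); rewrite -exc_excess.
have -> : excz (gil i) gal 0 = gal * excz (gil i) 1 0.
  rewrite !exczE mulr_sumr big_seq_cond [RHS]big_seq_cond; apply: eq_bigr => a /andP[/gil_ge0 [a1 a2] _].
  by rewrite !subr0 mul1r (max_r a1) (max_r (mulr_ge0 (ltW gal_gt0) a1)) mulrCA.
by rewrite /gal !intrM natrM; ring.
Qed.

Lemma base_ge0 i : 0 <= excz (gil i) 1 0.
Proof.
rewrite exczE big_seq_cond; apply: sumr_ge0 => a /andP[/gil_ge0 [a1 a2] _].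
by rewrite mulr_ge0 // le_max lexx.
Qed.

Lemma exc_ge0 i (c : int) : 0 <= excz (gil i) gal c.
Proof.
rewrite exczE big_seq_cond; apply: sumr_ge0 => a /andP[/gil_ge0 [a1 a2] _].
by rewrite mulr_ge0 // le_max lexx.
Qed.

Lemma excess_le_lval (S : {set 'I_n}) i : i \in S -> excess gp gJ i 0 <= lval gp gJ k S.
Proof.
move=> iS; rewrite /excess /lval; apply: ler_sum => j _; apply: emin_ge => //.
  exact: probs_layer gp01 _ _.
by apply: map_f; rewrite mem_enum.
Qed.

Lemma lval_le_sum (S : {set 'I_n}) : lval gp gJ k S <= \sum_(i in S) excess gp gJ i 0.
Proof. exact: (sum_tail_le gp01 gp_J k_gt0 S 0 (leqnn _)). Qed.

(** With [mu] the largest mean in S, the value lies between [mu] and [n * mu]. Take the least b with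
    value at most [b * mu]; its minimality and [mu <= lval] give the factor 2. The item [i0] serves
    when the value is 0, with [B = 0]. *)
Lemma exists_scale (S : {set 'I_n}) (i0 : 'I_n) : exists i b B,
  [/\ (b <= n)%N, B%:Z = b%:Z * excz (gil i) 1 0, B = 0%N -> lval gp gJ k S = 0,
     lval gp gJ k S <= (k * m * B)%:R & (k * m * B)%:R <= 2 * lval gp gJ k S].
Proof.
have V0 : 0 <= lval gp gJ k S by apply: lval_ge0 gp01 _.
have [VE|Vn] := eqVneq (lval gp gJ k S) 0.
  by exists i0, 0%N, 0%N; rewrite VE muln0 mulr0 mul0r.
have Vp : 0 < lval gp gJ k S by rewrite lt_neqAle eq_sym Vn.
have [i iS] : exists i, i \in S.
  apply/set0Pn; apply: contraTneq Vp => ->; rewrite -leNgt.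
  by apply: le_trans (lval_le_sum _) _; rewrite big_set0.
pose i1 := [arg max_(j > i in S) excess gp gJ j 0]%O.
have [i1S i1max] : i1 \in S /\ forall j, j \in S -> excess gp gJ j 0 <= excess gp gJ i1 0.
  by rewrite /i1; case: arg_maxP => // j jS jm; split.
set mu := excess gp gJ i1 0 in i1max *.
have Vn_mu : lval gp gJ k S <= n%:R * mu.
  apply: le_trans (lval_le_sum _) _.
  apply: (@le_trans _ _ (\sum_(j in S) mu)); first by apply: ler_sum.
  rewrite sumr_const -[leLHS]mulr_natl ler_wpM2r //; first exact: excess_ge0 gp01 _ _.
  by rewrite ler_nat -[leqRHS](card_ord n) max_card.
have [b bV bmin] := ex_minnP (ex_intro (fun b => lval gp gJ k S <= b%:R * mu) n Vn_mu).
have mu_le : mu <= lval gp gJ k S by apply: excess_le_lval.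
have b0 : (0 < b)%N by rewrite lt0n; apply: contraTneq bV => ->; rewrite mul0r -ltNge.
have bV2 : b%:R * mu <= 2 * lval gp gJ k S.
  case: b b0 bmin {bV} => // b _ bmin; have : ~~ (lval gp gJ k S <= b%:R * mu).
    by apply/negP => /bmin; rewrite ltnn.
  by rewrite -ltNge -[b.+1]addn1 natrD mulrDl mul1r; lra.
have B0 : 0 <= b%:Z * excz (gil i1) 1 0 by rewrite mulr_ge0 ?base_ge0.
exists i1, b, `|(b%:Z * excz (gil i1) 1 0)%R|%N.
have E : (k * m * `|(b%:Z * excz (gil i1) 1 0)%R|)%:R = b%:R * mu :> rat.
  rewrite natrM -[X in _ * X]/((Posz `|(b%:Z * excz (gil i1) 1 0)%R|)%:~R) gez0_abs //.
  by rewrite intrM /mu excess0; ring.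
split; rewrite ?E ?gez0_abs //; first by apply: bmin.
move=> B00; move: E bV; rewrite B00 muln0 => <- h.
by apply: le_anti; rewrite V0 h.
Qed.

End Glue.

Lemma radix_inj (B A A' x x' : int) : 0 <= x < B -> 0 <= x' < B ->
  A * B + x = A' * B + x' -> A = A' /\ x = x'.
Proof.
move=> /andP[x0 xB] /andP[x0' xB'] E.
suff EA : A = A' by split=> //; move: E; rewrite EA; lia.
by case: (ltrgtP A A') => // h; nia.
Qed.

Lemma upper_perm (R : realFieldType) n (p : 'I_n -> nat -> R) J k S B l Ls Ls' :
  perm_eq Ls Ls' -> upper p J k S B l Ls = upper p J k S B l Ls'.
Proof. by move=> h; rewrite /upper (perm_big _ h). Qed.

Lemma perm_down N : perm_eq (down N) (iota 1 N).
Proof.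
elim: N => // N IH; rewrite -addn1 iotaD addn1 /= add1n perm_sym perm_catC /= perm_cons perm_sym.
exact: IH.
Qed.

Lemma nth_down N j : nth 0 [seq x%:Z | x <- down N] j = N%:Z - (minn N j)%:Z.
Proof.
elim: N j => [|N IH] j; first by rewrite nth_nil min0n.
by case: j => [|j] /=; rewrite ?IH; lia.
Qed.

(** * Weights and scores in terms of probabilities *)

Section Weights.
Variables (n : nat) (X : 'I_n -> law) (k m : nat) (D : int).
Hypothesis lawX : forall i, is_law (X i).
Hypothesis D_gt0 : 0 < D.
Hypothesis D_dvd : forall i a, a \in X i -> (denq a.1 %| D)%Z && (denq a.2 %| D)%Z.
Hypothesis k_gt0 : (0 < k)%N.
Hypothesis m_gt1 : (1 < m)%N.
Hypothesis n_gt0 : (0 < n)%N.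
Local Notation gal := (gal k m D).
Local Notation gil := (gil X D).
Local Notation gp := (gp X k m D).
Local Notation gJ := (gJ X k m D).
Local Notation lval := (lval gp gJ k).
Local Notation upper := (upper gp gJ k).
Local Notation tail := (tail gp gJ).

Variable K : inst.
Hypothesis K_il : i_il K = [seq gil i | i <- enum 'I_n].
Hypothesis K_D : i_D K = D.
Hypothesis K_al : i_al K = gal.
Hypothesis K_n : i_n K = n%:Z.
Hypothesis K_k : i_k K = k%:Z.
Hypothesis K_Dn : i_Dn K = D ^+ n.
Hypothesis K_cap : i_cap K = (2 * n * m)%N%:Z.
Hypothesis K_kn : i_Ls K = 0%N \/ i_kn K = k.

Let p01 := @gp01 n X k m D lawX.
Let p_anti := @gp_anti n X k m D lawX.
Let p_J := gp_J lawX D_gt0 D_dvd k_gt0 m_gt1.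

Lemma D0 : 0 < D%:~R :> rat. Proof. by rewrite ltr0z. Qed.

Lemma pnz_gp i (c : nat) : (pnz K (gil i) c)%:~R = D%:~R * gp i c.
Proof. by rewrite /pnz K_al pn_gp. Qed.

Lemma pnz_bounds i (c : nat) : 0 <= pnz K (gil i) c <= D.
Proof.
have := pnz_gp i c; have /andP[p0 p1] := p01 i c => E.
rewrite -(ler0z rat) -(ler_int rat) E mulr_ge0 ?(ltW D0) //=.
by rewrite ler_piMr // ltW // D0.
Qed.

Lemma selz_map (s : seq 'I_n) (T : {set 'I_n}) :
  selz [seq gil i | i <- s] [seq i \in T | i <- s] = [seq if i \in T then gil i else [::] | i <- s].
Proof. by elim: s => //= i s ->. Qed.

Lemma nth_stepz a v j : nth 0 (stepz K a v) j = a * nth 0 v j.+1 + (D - a) * nth 0 v j.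
Proof.
elim: v j => [|x v IH] j; first by rewrite !nth_nil; ring.
by case: j => [|j] /=; [rewrite K_D nth0 | exact: IH].
Qed.

(** Conditioning on one item is one [stepz]. Both branches are multiplied by [D], so the power of
    [D] counts all items, selected or not. *)
Lemma dpz_pbin (c j : nat) (s : seq 'I_n) (T : {set 'I_n}) : i_kn K = k ->
  (nth 0 (dpz K c [seq if i \in T then gil i else [::] | i <- s]) j)%:~R =
  D%:~R ^+ size s * (k%:R - pbin [seq if i \in T then gp i c else 0 | i <- s] (fun x => (minn k x)%:R) j).
Proof.
move=> Ek; elim: s j => [|i s IH] j /=.
  by rewrite expr0 mul1r Ek nth_down intrB.
rewrite nth_stepz intrD !intrM !IH.
have -> : (pnz K (if i \in T then gil i else [::]) c)%:~R = D%:~R * (if i \in T then gp i c else 0).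
  by case: ifP => _; [apply: pnz_gp | rewrite /pnz /= subr0 mulr0].
have -> : (D - pnz K (if i \in T then gil i else [::]) c)%:~R = D%:~R * (1 - (if i \in T then gp i c else 0)).
  rewrite intrB; case: ifP => _; first by rewrite pnz_gp mulrBr mulr1.
  by rewrite /pnz /= subr0 !subr0 mulr1.
rewrite exprS; set d := D%:~R; set u := d ^+ size s; set q := (if i \in T then _ else _).
set P1 := pbin _ _ j.+1; set P0 := pbin _ _ j; move: d u q P1 P0 => d u q P1 P0.
by ring.
Qed.

Lemma pbin_select (c : nat) (s : seq 'I_n) (T : {set 'I_n}) f j :
  pbin [seq if i \in T then gp i c else 0 | i <- s] f j = pbin [seq gp i c | i <- s & i \in T] f j.
Proof.
elim: s j => //= i s IH j; case: ifP => _ /=; first by rewrite !IH.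
by rewrite mul0r subr0 mul1r add0r.
Qed.

Lemma enum_set (T : {set 'I_n}) : enum T = [seq i <- enum 'I_n | i \in T].
Proof. by rewrite enumT. Qed.

Lemma sumez_tail (c : nat) (s : seq 'I_n) (T : {set 'I_n}) :
  (sumez K [seq if i \in T then gil i else [::] | i <- s] c)%:~R =
  D%:~R * \sum_(i <- s | i \in T) excess gp gJ i c.
Proof.
elim: s => [|i s IH] /=; first by rewrite big_nil mulr0.
rewrite big_cons intrD IH; case: ifP => iT; last by rewrite addr0.
by rewrite K_al exc_excess //; ring.
Qed.

(** The excesses carry one factor [D] and the dynamic programs carry [D ^ n]; [scorez] multiplies
    them crosswise to the common factor [D ^ n.+1]. *)
Lemma score_upper (T : {set 'I_n}) (B l : nat) :
  (scorez K (selz (i_il K) [seq i \in T | i <- enum 'I_n]) B%:Z l%:Z)%:~R =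
  D%:~R ^+ n.+1 * upper T B l (down (i_Ls K)).
Proof.
rewrite K_il selz_map /scorez K_Dn K_D K_k.
rewrite intrD !intrM intrB !intrM -PoszM sumez_tail rmorphXn /=.
have -> : \sum_(i <- enum 'I_n | i \in T) excess gp gJ i (l * B) = tail T (l * B).
  by rewrite tail_excess -big_enum /= enum_set big_filter big_enum_cond.
have -> : (sumdz K [seq if i \in T then gil i else [::] | i <- enum 'I_n] B%:Z (down (i_Ls K)))%:~R =
  D%:~R ^+ n * \sum_(l' <- down (i_Ls K)) (k%:R - lemin gp k T (l' * B)).
  case: K_kn => [->|Ek]; first by rewrite /= big_nil mulr0.
  elim: (down _) => [|j js IH]; first by rewrite big_nil mulr0.
  rewrite big_cons mulrDr /= intrD IH addrC; congr (_ + _).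
  rewrite -PoszM -nth0 dpz_pbin // size_enum_ord; congr (_ * (_ - _)).
  by rewrite pbin_select /lemin /emin /layer enum_set.
rewrite /upper !natrM exprS; ring.
Qed.

Section Radix.
Hypothesis Bs_gt : i_nG K * n%:Z < i_Bs K.
Hypothesis nG_gt0 : 0 < i_nG K.

Definition dig (pn : int) r := ((i_nG K * pn ^+ r) %/ (D ^+ r))%Z.

Lemma dig_bounds pn r : 0 <= pn <= D -> 0 <= dig pn r <= i_nG K.
Proof.
case/andP=> p0 pD; have Dr : 0 < D ^+ r by apply: exprn_gt0.
rewrite divz_ge0 // mulr_ge0 ?exprn_ge0 ?(ltW nG_gt0) //=.
rewrite -(ler_pM2r Dr); apply: le_trans (lez_floor _ _) _; first by rewrite gt_eqF.
by rewrite ler_wpM2l ?(ltW nG_gt0) // lerXn2r ?nnegrE // ltW.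
Qed.

Lemma sum_dig_bounds (T : {set 'I_n}) (pn : 'I_n -> int) r : (forall i, 0 <= pn i <= D) ->
  0 <= \sum_(i in T) dig (pn i) r < i_Bs K.
Proof.
move=> h; apply/andP; split.
  by apply: sumr_ge0 => i _; have /andP[] := dig_bounds r (h i).
apply: le_lt_trans Bs_gt; apply: (@le_trans _ _ (\sum_(i in T) i_nG K)).
  by apply: ler_sum => i _; have /andP[] := dig_bounds r (h i).
rewrite sumr_const -mulr_natr ler_wpM2l ?(ltW nG_gt0) // natz lez_nat.
by rewrite -[leqRHS](card_ord n) max_card.
Qed.

(** Every digit sum is in the range of a digit, so there are no carries and the digits can be peeled
    off one at a time from the least significant one; the sums of [a] are what remains. *)
Lemma digz_inj (S T : {set 'I_n}) (pn a : 'I_n -> int) rs : (forall i, 0 <= pn i <= D) ->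
  \sum_(i in S) digz K (pn i) rs (a i) = \sum_(i in T) digz K (pn i) rs (a i) ->
  \sum_(i in S) a i = \sum_(i in T) a i /\
  {in rs, forall r, \sum_(i in S) dig (pn i) r = \sum_(i in T) dig (pn i) r}.
Proof.
move=> h; elim: rs => [|r rs IH] //=; rewrite !big_split /= -!mulr_suml K_D => E.
have [/IH [E1 E2] Er] := radix_inj (sum_dig_bounds S r h) (sum_dig_bounds T r h) E.
by split=> // r'; rewrite inE => /orP[/eqP->|/E2].
Qed.

Lemma thrz_inj (S T : {set 'I_n}) (B : nat) (a : 'I_n -> int) ls :
  \sum_(i in S) thrz K (gil i) B ls (a i) = \sum_(i in T) thrz K (gil i) B ls (a i) ->
  \sum_(i in S) a i = \sum_(i in T) a i /\
  {in ls, forall l, {in down (i_R K), forall r,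
     \sum_(i in S) dig (pnz K (gil i) (l * B)%N) r = \sum_(i in T) dig (pnz K (gil i) (l * B)%N) r}}.
Proof.
elim: ls => [|l ls IH] //= E.
have [/IH [E1 E2] Er] := digz_inj (fun i => pnz_bounds i (l * B)) E.
by split=> // l'; rewrite inE => /orP[/eqP->|/E2].
Qed.

(** Rounding down costs less than 1 per item, hence at most n per set; at scale [n * G] this is
    [1 / G]. *)
Lemma power_sums (S T : {set 'I_n}) (c r : nat) (G : nat) : (0 < G)%N ->
  i_nG K = (n * G)%N%:Z ->
  \sum_(i in S) dig (pnz K (gil i) c) r = \sum_(i in T) dig (pnz K (gil i) c) r ->
  `|\sum_(i in S) gp i c ^+ r - \sum_(i in T) gp i c ^+ r| <= G%:R^-1.
Proof.
move=> G0 EG E; have Dr : 0 < D ^+ r by apply: exprn_gt0.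
have nG0 : 0 < (n * G)%:R :> rat by rewrite ltr0n muln_gt0 n_gt0.
have Hd i : (dig (pnz K (gil i) c) r)%:~R <= (n * G)%:R * gp i c ^+ r <= (dig (pnz K (gil i) c) r)%:~R + 1.
  have Dr' : 0 < D%:~R ^+ r :> rat by rewrite exprn_gt0 // D0.
  have Ep : (i_nG K * pnz K (gil i) c ^+ r)%:~R = (n * G)%:R * gp i c ^+ r * D%:~R ^+ r.
    by rewrite EG intrM rmorphXn /= pnz_gp exprMn; ring.
  have ED : (D ^+ r)%:~R = D%:~R ^+ r :> rat by rewrite rmorphXn.
  apply/andP; split; rewrite -(ler_pM2r Dr') -Ep -ED.
    by rewrite -intrM ler_int lez_floor // gt_eqF.
  by rewrite -[1]/(1%:~R) -intrD -intrM ler_int ltW // ltz_ceil.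
have Hs (U : {set 'I_n}) : (\sum_(i in U) dig (pnz K (gil i) c) r)%:~R <= (n * G)%:R * \sum_(i in U) gp i c ^+ r <=
    (\sum_(i in U) dig (pnz K (gil i) c) r)%:~R + n%:R.
  rewrite mulr_sumr rmorph_sum /=; apply/andP; split.
    by apply: ler_sum => i _; have /andP[] := Hd i.
  apply: (@le_trans _ _ (\sum_(i in U) ((dig (pnz K (gil i) c) r)%:~R + 1))).
    by apply: ler_sum => i _; have /andP[] := Hd i.
  by rewrite big_split /= lerD2l sumr_const ler_nat -[leqRHS](card_ord n) max_card.
have /andP[s1 s2] := Hs S; have /andP[t1 t2] := Hs T; rewrite E in s1 s2.
rewrite -(ler_pM2l nG0) -[X in X * `|_|]ger0_norm ?(ltW nG0) // -normrM mulrBr.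
have -> : (n * G)%:R / G%:R = n%:R :> rat by rewrite natrM mulfK // pnatr_eq0 -lt0n.
by rewrite ler_norml; apply/andP; split; lra.
Qed.

Lemma digz_sum_lt (S : {set 'I_n}) (pn a : 'I_n -> int) q rs : (forall i, 0 <= pn i <= D) ->
  0 <= \sum_(i in S) a i < i_Bs K ^+ q ->
  0 <= \sum_(i in S) digz K (pn i) rs (a i) < i_Bs K ^+ (q + size rs).
Proof.
move=> h ha; elim: rs => [|r rs IH]; first by rewrite addn0.
rewrite /= big_split /= -mulr_suml K_D addnS exprSr.
have /andP[x0 xB] := sum_dig_bounds S r h; have /andP[A0 AB] := IH.
have B0 : 0 < i_Bs K by apply: le_lt_trans xB.
rewrite addr_ge0 ?mulr_ge0 ?(ltW B0) //=.
move: (i_Bs K ^+ (q + size rs)) AB => P; rewrite -lezD1 => AB.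
apply: (@lt_le_trans _ _ ((\sum_(i in S) digz K (pn i) rs (a i) + 1) * i_Bs K)).
  by rewrite mulrDl mul1r ltrD2l.
by rewrite ler_wpM2r // ltW.
Qed.

Lemma thrz_sum_lt (S : {set 'I_n}) (B : nat) (a : 'I_n -> int) q ls :
  0 <= \sum_(i in S) a i < i_Bs K ^+ q ->
  0 <= \sum_(i in S) thrz K (gil i) B ls (a i) < i_Bs K ^+ (q + size ls * i_R K).
Proof.
move=> ha; elim: ls => [|l ls IH]; first by rewrite addn0.
have := digz_sum_lt (down (i_R K)) (fun i => pnz_bounds i (l * B)) IH.
by rewrite size_down -addnA [(_ * i_R K + _)%N]addnC -mulSn.
Qed.

End Radix.

Section Tails.
Variables (B l : nat).
Local Notation tw i := (twz K (gil i) B%:Z l%:Z).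

Let en_cast i : (excz (gil i) gal (l%:Z * B%:Z) * n%:Z)%:~R = D%:~R * (n%:R * excess gp gJ i (l * B)).
Proof. by rewrite -PoszM intrM exc_excess //; ring. Qed.

Let q_cast : (D * k%:Z * B%:Z)%:~R = D%:~R * (k * B)%:R :> rat.
Proof. by rewrite !intrM natrM mulrA. Qed.

Let q_ge0 : 0 <= D * k%:Z * B%:Z.
Proof. by rewrite !mulr_ge0 // ltW. Qed.

Let twE i : tw i = if excz (gil i) gal (l%:Z * B%:Z) * n%:Z <= (2 * n * m)%N%:Z * (D * k%:Z * B%:Z)
  then (excz (gil i) gal (l%:Z * B%:Z) * n%:Z %/ (D * k%:Z * B%:Z))%Z else (2 * n * m)%N%:Z + 1.
Proof. by rewrite /twz K_al K_n K_D K_k K_cap. Qed.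

Let en_ge0 i : 0 <= excz (gil i) gal (l%:Z * B%:Z) * n%:Z.
Proof. by rewrite mulr_ge0 ?exc_ge0. Qed.

Lemma tw_bounds i : 0 <= tw i <= (2 * n * m)%N%:Z + 1.
Proof.
rewrite twE; case: ifP => [h|_]; last by lia.
have [->|q0] := eqVneq (D * k%:Z * B%:Z) 0; first by rewrite divz0; lia.
have qp : 0 < D * k%:Z * B%:Z by rewrite lt_neqAle eq_sym q0.
rewrite divz_ge0 // en_ge0 /=; apply: (@le_trans _ _ (2 * n * m)%N%:Z); last by lia.
by rewrite -(ler_pM2r qp); apply: le_trans h; rewrite lez_floor.
Qed.

(** Weights are nonnegative, so a sum within the cap excludes the items of weight [cap + 1]; all
    others are rounded by at most one unit [k * B / n]. *)
Lemma tw_up (T : {set 'I_n}) : \sum_(i in T) tw i <= (2 * n * m)%N%:Z ->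
  n%:R * tail T (l * B) <= ((\sum_(i in T) tw i)%:~R + n%:R) * (k * B)%:R.
Proof.
move=> hT.
have Hi i : i \in T -> n%:R * excess gp gJ i (l * B) <= ((tw i)%:~R + 1) * (k * B)%:R.
  move=> iT; have : tw i <= (2 * n * m)%N%:Z.
    apply: le_trans hT; rewrite (bigD1 i) //= lerDl; apply: sumr_ge0 => j _.
    by have /andP[] := tw_bounds j.
  rewrite twE; case: ifP => [h _|_]; last by lia.
  rewrite -(ler_pM2l D0) -en_cast mulrCA -q_cast -[1]/(1%:~R) -intrD -intrM ler_int.
  have [E|q0] := eqVneq (D * k%:Z * B%:Z) 0; first by move: h; rewrite E !mulr0.
  have qp : 0 < D * k%:Z * B%:Z by rewrite lt_neqAle eq_sym q0.
  by rewrite ltW // ltz_ceil.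
rewrite mulr_sumr; apply: (@le_trans _ _ (\sum_(i in T) ((tw i)%:~R + 1) * (k * B)%:R)).
  by apply: ler_sum => i iT; apply: Hi.
rewrite -mulr_suml ler_wpM2r // big_split /= rmorph_sum lerD2l sumr_const ler_nat.
by rewrite -[leqRHS](card_ord n) max_card.
Qed.

(** The cap [2 * n * m] is the tail bound [2 * k * m * B] in units of [k * B / n], so that no item
    of S is capped. If [B = 0], the quotients are divisions by 0, with value 0. *)
Lemma tw_low (S : {set 'I_n}) : tail S (l * B) <= (2 * k * m * B)%:R ->
  0 <= \sum_(i in S) tw i <= (2 * n * m)%N%:Z /\
  (\sum_(i in S) tw i)%:~R * (k * B)%:R <= n%:R * tail S (l * B).
Proof.
move=> hS.
have Hcap i : i \in S -> excz (gil i) gal (l%:Z * B%:Z) * n%:Z <= (2 * n * m)%N%:Z * (D * k%:Z * B%:Z).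
  move=> iS; rewrite -(ler_int rat) en_cast [leRHS]intrM q_cast [leRHS]mulrCA ler_pM2l ?D0 //.
  have : excess gp gJ i (l * B) <= tail S (l * B).
    rewrite tail_excess (bigD1 i) //= lerDl; apply: sumr_ge0 => j _.
    exact: excess_ge0 p01 _ _.
  move=> h1; apply: (@le_trans _ _ (n%:R * (2 * k * m * B)%:R)).
    by rewrite ler_wpM2l // (le_trans h1).
  by rewrite -[(2 * n * m)%N%:~R]/((2 * n * m)%:R) -!natrM ler_nat; lia.
have Hlow i : i \in S -> (tw i)%:~R * (k * B)%:R <= n%:R * excess gp gJ i (l * B).
  move=> iS; rewrite twE Hcap // -(ler_pM2l D0) -en_cast mulrCA -q_cast -intrM ler_int.
  have [->|q0] := eqVneq (D * k%:Z * B%:Z) 0; first by rewrite mulr0 en_ge0.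
  by rewrite lez_floor.
have H2 : (\sum_(i in S) tw i)%:~R * (k * B)%:R <= n%:R * tail S (l * B).
  by rewrite rmorph_sum mulr_suml mulr_sumr; apply: ler_sum.
have H0 : 0 <= \sum_(i in S) tw i by apply: sumr_ge0 => i _; have /andP[] := tw_bounds i.
split=> //; rewrite H0 /=.
have [B0|B0] := posnP B.
  rewrite big1 // => i iS; rewrite twE Hcap // B0 !mulr0 divz0 //.
have kB : 0 < (k * B)%:R :> rat by rewrite ltr0n muln_gt0 k_gt0.
rewrite -(ler_int rat) -(ler_pM2r kB); apply: le_trans H2 _.
apply: (@le_trans _ _ (n%:R * (2 * k * m * B)%:R)); first by rewrite ler_wpM2l.
by rewrite -[(2 * n * m)%N%:~R]/((2 * n * m)%:R) -!natrM ler_nat; lia.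
Qed.

Lemma tw_tail (S T : {set 'I_n}) : tail S (l * B) <= (2 * k * m * B)%:R ->
  \sum_(i in T) tw i = \sum_(i in S) tw i -> tail T (l * B) <= tail S (l * B) + (k * B)%:R.
Proof.
move=> hS E; have [/andP[_ h1] h2] := tw_low hS.
have n0 : 0 < n%:R :> rat by rewrite ltr0n.
have := tw_up (T := T); rewrite E => /(_ h1) h3.
rewrite -(ler_pM2l n0); lra.
Qed.

End Tails.
End Weights.

Lemma gran_sufficient m : (32 * m ^ 4 * (32 * (17 * m ^ 2)).+1 * (4 * (17 * m ^ 2)) ^ (32 * (17 * m ^ 2)) <= gran m)%N.
Proof.
rewrite /gran -[(32 * (17 * m ^ 2)).+1]addn1 (_ : m ^ 4 = m * m * (m * m))%N -?mulnn; last by rewrite (expnD m 2 2) -mulnn.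
have E1 z : (32 * (17 * z) = 544 * z)%N by lia.
have E2 z : (4 * (17 * z) = 68 * z)%N by lia.
by rewrite E1 E2.
Qed.

Lemma gran_ge m : (0 < m)%N -> (32 * m <= gran m)%N.
Proof.
move=> m0; have p : (0 < (68 * (m * m)) ^ (544 * (m * m)))%N by rewrite expn_gt0 !muln_gt0 m0.
rewrite /gran; move: p; move: (_ ^ _)%N => P p.
apply: (@leq_trans (32 * (m * m * (m * m)))%N); last first.
  by rewrite -[leqRHS]mulnA; apply: leq_pmulr; rewrite muln_gt0 p andbT addn1.
by rewrite leq_mul2l /= -mulnA; apply: leq_pmulr; rewrite !muln_gt0 m0.
Qed.

Lemma mem_downE N x : (x \in down N) = (0 < x <= N)%N.
Proof. by rewrite (perm_mem (perm_down N)) mem_iota add1n ltnS. Qed.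

(** * A guess whose every answer is good *)

Section Queries.
Variables (n : nat) (X : 'I_n -> law) (k m : nat) (D : int).
Hypothesis lawX : forall i, is_law (X i).
Hypothesis D_gt0 : 0 < D.
Hypothesis D_dvd : forall i a, a \in X i -> (denq a.1 %| D)%Z && (denq a.2 %| D)%Z.
Hypothesis k_gt0 : (0 < k)%N.
Hypothesis m_gt1 : (1 < m)%N.
Hypothesis n_gt0 : (0 < n)%N.
Local Notation gal := (gal k m D).
Local Notation gil := (gil X D).
Local Notation gp := (gp X k m D).
Local Notation gJ := (gJ X k m D).
Local Notation lval := (lval gp gJ k).
Local Notation upper := (upper gp gJ k).
Local Notation tail := (tail gp gJ).
Local Notation ils := [seq gil i | i <- enum 'I_n].

Let p01 := @gp01 n X k m D lawX.
Let p_anti := @gp_anti n X k m D lawX.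
Let p_J := gp_J lawX D_gt0 D_dvd k_gt0 m_gt1.

Definition good_query K (S : {set 'I_n}) i b (l t : nat) := exists B : nat,
  [/\ (b <= n)%N, B%:Z = b%:Z * excz (gil i) 1 0, l.+1 \in i_Ll K, (t < i_T K)%N &
   \sum_(j in S) wz K B%:Z l%:Z (gil j) = t%:Z /\
   forall T : {set 'I_n}, \sum_(j in T) wz K B%:Z l%:Z (gil j) = t%:Z ->
     upper T B l (down (i_Ls K)) <= (1 + 8 / m%:R) * lval S].

(** The degenerate scale: [B = 0] puts all thresholds at 0, so that the bound is the total mean of
    T, which the tail digits force to be 0 like that of S. *)
Lemma upper_zero (S T : {set 'I_n}) l Ls : lval S = 0 ->
  tail T (l * 0) <= tail S (l * 0) + (k * 0)%:R -> upper T 0 l Ls <= (1 + 8 / m%:R) * lval S.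
Proof.
move=> V0; rewrite !muln0 addr0 V0 mulr0 upperE !muln0 mul0r subr0 addr0.
move/le_trans; apply; rewrite tail_excess big1 // => i iS; apply: le_anti.
rewrite excess_ge0 // andbT -V0.
exact: excess_le_lval.
Qed.

Lemma tail_zero (S : {set 'I_n}) : lval S = 0 -> tail S 0 = 0.
Proof.
move=> V0; rewrite tail_excess big1 // => i iS; apply: le_anti.
rewrite excess_ge0 // andbT -V0.
exact: excess_le_lval.
Qed.

Lemma int_nat (z : int) : 0 <= z -> exists t : nat, z = t%:Z.
Proof. by case: z => // t; exists t. Qed.

Lemma good_large (S : {set 'I_n}) : (4 * m ^ 2 <= k)%N ->
  exists i b l t, good_query (large_inst ils D gal n k m) S i b l t.
Proof.
move=> km; set K := large_inst _ _ _ _ _ _.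
have [i [b [B [bn EB BV OB BO]]]] := exists_scale lawX D_gt0 D_dvd k_gt0 m_gt1 S (Ordinal n_gt0).
exists i, b.
have HT l (T : {set 'I_n}) : \sum_(j in T) wz K B%:Z l%:Z (gil j) = \sum_(j in T) twz K (gil j) B%:Z l%:Z by [].
have main l : (l <= 2 * m + 1)%N -> tail S (l * B) <= (2 * k * m * B)%:R ->
   (forall T, tail T (l * B) <= tail S (l * B) + (k * B)%:R -> upper T B l [::] <= (1 + 8 / m%:R) * lval S) ->
   exists l t, good_query K S i b l t.
  move=> lm h1 h2.
  have [/andP[s0 s1] _] := tw_low lawX D_gt0 D_dvd k_gt0 m_gt1 n_gt0 (K := K) erefl erefl erefl erefl erefl erefl (or_introl erefl) h1.
  have [t Et] := int_nat s0.
  exists l, t, B; split=> //.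
  - by rewrite mem_downE; lia.
  - by rewrite [i_T _]/= -ltz_nat -Et; lia.
  - split; first by rewrite HT.
    by move=> T; rewrite HT -Et => ET; apply: h2; exact: (tw_tail lawX D_gt0 D_dvd k_gt0 m_gt1 n_gt0 (K := K) erefl erefl erefl erefl erefl erefl (or_introl erefl) h1 ET).
have [B0|B0] := posnP B.
  apply: (main 0%N) => //; first by rewrite mul0n tail_zero ?BV.
  by rewrite B0 => T h; have V0 := BV B0; exact (@upper_zero S T 0 [::] V0 h).
have [l [lm h1 h2]] := large_grid p01 p_anti p_J k_gt0 m_gt1 km B0 OB.
apply: (main l) => // T h3.
exact: (large_upper p01 m_gt1 BO h2 h3).
Qed.

Lemma good_small (S : {set 'I_n}) : (k <= 16 * m ^ 2)%N ->
  exists i b l t, good_query (small_inst ils D gal n k m) S i b l t.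
Proof.
move=> km; set K := small_inst _ _ _ _ _ _.
have [i [b [B [bn EB BV OB BO]]]] := exists_scale lawX D_gt0 D_dvd k_gt0 m_gt1 S (Ordinal n_gt0).
set h := (k * (m * m))%N.
have m0 : (0 < m)%N by apply: ltnW.
have Eh : h = (k * m ^ 2)%N by rewrite -mulnn.
have h0 : (0 < h)%N by rewrite /h !muln_gt0 k_gt0 m0.
have g32 := gran_ge m0.
have G0 : (0 < gran m)%N by apply: leq_trans g32; rewrite muln_gt0 m0.
have nG0 : 0 < i_nG K by rewrite [i_nG _]/= ltz_nat muln_gt0 n_gt0.
have BsE : i_Bs K = (n * (n * gran m) + 1)%N%:Z by [].
have Bs_gt : i_nG K * n%:Z < i_Bs K.
  by rewrite BsE [i_nG _]/= -PoszM ltz_nat addn1 ltnS mulnC.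
have h1 : tail S (h * B) <= (2 * k * m * B)%:R.
  have [B0|B0] := posnP B; first by rewrite B0 !muln0 tail_zero ?BV.
  by have := small_tail p01 p_anti p_J k_gt0 m_gt1 km B0 OB; rewrite -Eh.
have [/andP[s0 s1] _] := tw_low lawX D_gt0 D_dvd k_gt0 m_gt1 n_gt0 (K := K) erefl erefl erefl erefl erefl erefl (or_intror erefl) h1.
(* The tail of S fits into one digit, so that the packed sum has [small_dim k m] digits and the loop
   over the targets meets it. *)
have capB : (2 * n * m < n * (n * gran m) + 1)%N.
  rewrite addn1 ltnS; apply: (@leq_trans (n * (n * (32 * m)))); last by rewrite !leq_mul2l g32 !orbT.
  by rewrite -mulnA (mulnC 2) -!mulnA leq_mul2l; apply/orP; right; nia.
have a0 : 0 <= \sum_(j in S) twz K (gil j) B%:Z h%:Z < i_Bs K ^+ 1.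
  by rewrite s0 expr1 BsE; apply: le_lt_trans s1 _; rewrite ltz_nat.
have := thrz_sum_lt lawX D_gt0 D_dvd k_gt0 m_gt1 (K := K) erefl erefl Bs_gt nG0 B (down (i_Ls K)) a0.
rewrite size_down => /andP[w0 wT].
have [t Et] := int_nat w0.
have ETn : i_Bs K ^+ (1 + i_Ls K * i_R K) = (i_T K)%:Z.
  by rewrite BsE PoszX [i_T _]/= /small_base /small_dim [i_Ls _]/= [i_R _]/= (addnC 1%N).
exists i, b, h, t, B; split=> //.
- by rewrite [i_Ll _]/= inE addn1.
- by rewrite -ltz_nat -ETn -Et.
split=> // T; rewrite -Et => ET.
have [E1 E2] := thrz_inj lawX D_gt0 D_dvd k_gt0 m_gt1 (K := K) erefl erefl Bs_gt nG0 ET.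
have h3 : tail T (h * B) <= tail S (h * B) + (k * B)%:R.
  exact: (tw_tail lawX D_gt0 D_dvd k_gt0 m_gt1 n_gt0 (K := K) erefl erefl erefl erefl erefl erefl (or_intror erefl) h1 E1).
have [B0|B0] := posnP B.
  by move: h3; rewrite B0 => h3; exact (upper_zero _ (BV B0) h3).
have Ep : perm_eq (down (i_Ls K)) (iota 1 (k * m ^ 2).-1).
  by rewrite -Eh -subn1; apply: perm_down.
rewrite (upper_perm _ _ _ _ _ _ Ep).
rewrite Eh in h3 *; apply: (small_upper p01 p_anti p_J k_gt0 m_gt1 km B0 OB BO h3) => l /andP[l0 lh].
apply: (small_stable p01 k_gt0 m_gt1 km (G := gran m)); first exact: gran_sufficient.
move=> r /andP[r0 rR].
have lin : l \in down (i_Ls K) by rewrite (perm_mem Ep) mem_iota l0 /=; move: lh; rewrite -Eh; lia.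
have rin : r \in down (i_R K).
  rewrite mem_downE r0 /=; apply: leq_trans rR _.
  by rewrite -mulnn; move: (m * m)%N => z; lia.
exact (power_sums lawX D_gt0 D_dvd k_gt0 m_gt1 n_gt0 (K := K) erefl G0 erefl (esym (E2 l lin r rin))).
Qed.

Lemma wz_large_bounds (B l : nat) i : let K := large_inst ils D gal n k m in
  (0 <= wz K B%:Z l%:Z (gil i) <= (2 * n * m)%N%:Z + 1) : Prop.
Proof. move=> K; exact (tw_bounds lawX D_gt0 k_gt0 m_gt1 n_gt0 (K := K) erefl erefl erefl erefl erefl erefl (or_introl erefl) B l i). Qed.

Lemma wz_small_bounds (B l : nat) i : let K := small_inst ils D gal n k m in
  (0 <= wz K B%:Z l%:Z (gil i) < (small_base n m)%:Z ^+ (small_dim k m).+1) : Prop.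
Proof.
move=> K.
have G0 : (0 < gran m)%N by apply: leq_trans (gran_ge (ltnW m_gt1)); rewrite muln_gt0 (ltnW m_gt1).
have nG0 : 0 < i_nG K by rewrite [i_nG _]/= ltz_nat muln_gt0 n_gt0.
have BsE : i_Bs K = (small_base n m)%:Z by [].
have Bs_gt : i_nG K * n%:Z < i_Bs K.
  by rewrite BsE [i_nG _]/= -PoszM ltz_nat /small_base addn1 ltnS mulnC.
have [t0 t1] := andP (tw_bounds lawX D_gt0 k_gt0 m_gt1 n_gt0 (K := K) erefl erefl erefl erefl erefl erefl (or_intror erefl) B l i).
(* A singleton allows reusing the bound on sums. The item is arbitrary and may have tail weight
   [cap + 1]; two radix places hold it, whence the exponent [(small_dim k m).+1]. *)
have a0 : 0 <= \sum_(j in [set i]) twz K (gil j) B%:Z l%:Z < i_Bs K ^+ 2.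
  rewrite big_set1 t0; apply: le_lt_trans t1 _; rewrite BsE PoszX -PoszD ltz_nat.
  have b2 : (2 * n * m + 1 < (small_base n m) * small_base n m)%N.
    have := gran_ge (ltnW m_gt1); rewrite /small_base; move: (gran m) => G GE.
    have H1 : (32 * m <= n * (n * G))%N.
      by rewrite mulnA; apply: leq_trans GE _; apply: leq_pmull; rewrite muln_gt0 n_gt0.
    have H2 : (n <= n * (n * G))%N by apply: leq_pmulr; rewrite muln_gt0 n_gt0 //; lia.
    move: (n * (n * G))%N H1 H2 => Z; nia.
  by rewrite -mulnn.
have := thrz_sum_lt lawX D_gt0 D_dvd k_gt0 m_gt1 (K := K) erefl erefl Bs_gt nG0 B (down (i_Ls K)) a0.
rewrite size_down big_set1 BsE.
suff -> : (2 + i_Ls K * i_R K = (small_dim k m).+1)%N by [].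
by rewrite /small_dim [i_Ls _]/= [i_R _]/= addn1 add2n.
Qed.
End Queries.

Lemma den_law_dvd l a : a \in l -> (denq a.1 * denq a.2 %| den_law l)%Z.
Proof.
elim: l => //= b l IH; rewrite inE => /orP[/eqP->|/IH h]; first exact: dvdz_mull.
exact: dvdz_mulr.
Qed.

Lemma den_law_gt0 l : 0 < den_law l.
Proof. by elim: l => //= a l IH; rewrite !mulr_gt0. Qed.

Lemma den_all_dvd (ls : seq law) (l : law) a : l \in ls -> a \in l -> (denq a.1 %| den_all ls)%Z && (denq a.2 %| den_all ls)%Z.
Proof.
move=> + /den_law_dvd ha; elim: ls => //= l' ls IH; rewrite inE => /orP[/eqP E|/IH/andP[h1 h2]].
  rewrite -E; apply/andP; split; apply: dvdz_mull; apply: dvdz_trans ha; [exact: dvdz_mulr|exact: dvdz_mull].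
by apply/andP; split; apply: dvdz_mulr.
Qed.

Lemma den_all_gt0 ls : 0 < den_all ls.
Proof. by elim: ls => //= l ls IH; rewrite mulr_gt0 // den_law_gt0. Qed.

Lemma rat_num_den (q : rat) : q * (denq q)%:~R = (numq q)%:~R.
Proof. by rewrite numqE. Qed.

(** * The precision and the two modes *)

Section Scales.
Variable eps : rat.
Hypothesis eps_gt0 : 0 < eps.
Hypothesis eps_le1 : eps <= 1.
Local Notation m := (precision eps).

Let den0 : 0 < (denq eps)%:~R :> rat. Proof. by rewrite ltr0z. Qed.

Lemma m_gt1 : (1 < m)%N.
Proof.
have := precisionE eps_gt0; have n0 := num_gt0 eps_gt0.
have nd : numq eps <= denq eps.
  rewrite -(ler_int rat) -rat_num_den; apply: ler_piMl => //; exact: ltW.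
have : 1 <= (denq eps %/ numq eps)%Z by rewrite lez_divRL // mul1r.
by lia.
Qed.

Lemma inv_m_le : m%:R^-1 <= eps.
Proof.
have E := precisionE eps_gt0; have n0 := num_gt0 eps_gt0.
have h : denq eps < m%:Z * numq eps by rewrite -E; apply: ltz_ceil.
rewrite -div1r ler_pdivrMr ?ltr0n ?m_gt0 // -(ler_pM2r den0) mul1r mulrAC rat_num_den mulrC.
by move: (ltW h); rewrite -(ler_int rat) intrM -pmulrn.
Qed.

Lemma m_le : m%:R <= eps^-1 + 1.
Proof.
have E := precisionE eps_gt0; have n0 := num_gt0 eps_gt0.
have h : (m%:Z - 1) * numq eps <= denq eps by rewrite -E addrK; apply: lez_floor; rewrite gt_eqF.
rewrite -lerBlDr -[eps^-1]div1r ler_pdivlMr //.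
rewrite -(ler_pM2r den0) mul1r -mulrA rat_num_den.
by move: h; rewrite -(ler_int rat) intrM intrB -pmulrn.
Qed.

(** From [m - 1 <= 1 / eps] one gets [k >= 16 * (m - 1) ^ 2], and [m <= 2 * (m - 1)]: the constant
    16 is four times the 4 of [emin_frac]. *)
Lemma large_k k : large_mode k eps -> (4 * m ^ 2 <= k)%N.
Proof.
have E := precisionE eps_gt0; have n0 := num_gt0 eps_gt0; have m1 := m_gt1.
have h : (m%:Z - 1) * numq eps <= denq eps by rewrite -E addrK; apply: lez_floor; rewrite gt_eqF.
rewrite /large_mode -mulnn => h2; move: m h m1 h2 => M; move: (numq eps) (denq eps) n0 => a d a0 h m1 h2.
have h3 : (M%:Z - 1) * a * ((M%:Z - 1) * a) <= d * d by apply: ler_pM => //; nia.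
have h4 : 16 * ((M%:Z - 1) * (M%:Z - 1)) * (a * a) <= k%:Z * (a * a).
  apply: le_trans h2; rewrite (_ : _ * (a * a) = 16 * ((M%:Z - 1) * a * ((M%:Z - 1) * a))); last by ring.
  by rewrite ler_pM2l.
have aa : 0 < a * a by rewrite mulr_gt0.
rewrite ler_pM2r // in h4; nia.
Qed.

Lemma small_k k : ~~ large_mode k eps -> (k <= 16 * (m * m))%N.
Proof.
have E := precisionE eps_gt0; have n0 := num_gt0 eps_gt0.
have h : denq eps < m%:Z * numq eps by rewrite -E; apply: ltz_ceil.
have d0 : 0 < denq eps by [].
rewrite /large_mode -ltNge => h2; move: m h h2 => M; move: (numq eps) (denq eps) n0 d0 => a d a0 d0 h h2.
have h3 : d * d <= (M%:Z * a) * (M%:Z * a) by apply: ler_pM; rewrite ltW.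
have h4 : k%:Z * (a * a) < 16 * (M%:Z * M%:Z) * (a * a).
  apply: lt_le_trans h2 _; rewrite (_ : _ * (a * a) = 16 * ((M%:Z * a) * (M%:Z * a))); last by ring.
  by rewrite ler_pM2l.
have aa : 0 < a * a by rewrite mulr_gt0.
rewrite ltr_pM2r // in h4; lia.
Qed.
End Scales.

(** * Correctness of the returned set *)

Section Correct.
Variables (F : set_system) (X : 'I_(ground F) -> law) (k : nat) (eps : rat).
Variables (code : bitseq) (Q : program) (cc : nat).
Hypothesis lawX : forall i, is_law (X i).
Hypothesis k_gt0 : (0 < k)%N.
Hypothesis eps_gt0 : 0 < eps.
Hypothesis eps_le1 : eps <= 1.

Let cst (w : 'I_(ground F) -> int) (t : nat) := (t <= cc * (size code).+1 ^ cc * maxn 1 (magnitude w) ^ cc)%N.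
Hypothesis HQ : forall (w : 'I_(ground F) -> int) target, exists (r : option {set 'I_(ground F)}) (t : nat),
    [/\ run Q no_oracle (exact_sum_input code (enc_query w target)) (enc_answer r) t [::],
        exact_sum_answer w target r & cst w t].

Local Notation D := (common_den X).
Local Notation m := (precision eps).
Local Notation K := (ptas_inst X k eps).
Local Notation il := (scaled_law X).
Local Notation n := (ground F).

Let n_gt0 : (0 < n)%N. Proof. exact: ground_gt0. Qed.
Let m1 : (1 < m)%N. Proof. exact: m_gt1. Qed.
Lemma D_gt0 : 0 < D. Proof. exact: den_all_gt0. Qed.
Lemma D_dvd i a : a \in X i -> (denq a.1 %| D)%Z && (denq a.2 %| D)%Z.
Proof. by move=> h; apply: den_all_dvd h; apply: map_f; rewrite mem_enum. Qed.

Lemma exists_good (S : {set 'I_n}) : exists i b l t, good_query X k m D K S i b l t.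
Proof.
rewrite /ptas_inst; case: ifP => h.
  by apply: (good_large lawX D_gt0 D_dvd k_gt0 m1 n_gt0); apply: large_k.
apply: (good_small lawX D_gt0 D_dvd k_gt0 m1 n_gt0); rewrite -mulnn; apply: small_k => //.
by rewrite h.
Qed.

Lemma K_upper : [/\ i_D K = D, i_al K = gal k m D, i_k K = k%:Z, i_Dn K = D ^+ n &
  i_Ls K = 0%N \/ i_kn K = k].
Proof. by rewrite /ptas_inst; case: ifP => _; split=> //; [left | right]. Qed.

Lemma K_Ls l : l \in i_Ll K -> (0 < l)%N /\ all (fun l' => (l' < l.-1)%N) (down (i_Ls K)).
Proof.
rewrite /ptas_inst; case: ifP => _.
  by rewrite (_ : i_Ll _ = down (2 * m + 2)) // mem_downE => /andP[].
rewrite inE => /eqP ->; split; first by rewrite addn1.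
by apply/allP => x; rewrite mem_downE => /andP[x0]; rewrite addn1 /=; lia.
Qed.

Lemma score_sound (T : {set 'I_n}) B lt : cand K il B -> cutoff K lt -> exists b l : nat,
  [/\ B = b%:Z, lt = l%:Z & lval (gp X k m D) (gJ X k m D) k T <=
     upper (gp X k m D) (gJ X k m D) k T b l (down (i_Ls K))].
Proof.
case=> b _ [i EB] [l /K_Ls[l0 hl] El].
have [z Ez] := int_nat (base_ge0 lawX D_gt0 i).
exists (b * z)%N, l.-1; split.
- by rewrite EB PoszM -Ez.
- by rewrite El; case: l l0 {hl El} => // l _; rewrite -addn1 PoszD addrK addn1.
apply: lval_upper hl; [exact: gp01 | exact: gp_anti | | by [] | ].
  exact: gp_J lawX D_gt0 D_dvd k_gt0 m1.
by rewrite (perm_uniq (perm_down _)) iota_uniq.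
Qed.

Lemma score_value T (b l : nat) :
  (score_of K b%:Z l%:Z T)%:~R = D%:~R ^+ n.+1 * upper (gp X k m D) (gJ X k m D) k T b l (down (i_Ls K)).
Proof.
have [h1 h2 h3 h4 h5] := K_upper.
exact: (score_upper lawX D_gt0 D_dvd k_gt0 m1 (K_il X k eps) h1 h2 h3 h4 h5).
Qed.

(** The returned set [T1] may stem from an unrelated guess. Its value is at most its own score,
    which is at most the score of the set [S'] that answered the good query, and that score is
    bounded by the optimum. *)
Lemma correct a : acc_ok K il a ->
  (forall i b l t, (b < n.+1)%N -> l \in i_Ll K -> (t < i_T K)%N ->
    reached K il (b%:Z * base il i) (l%:Z - 1) t%:Z a) ->
  exists sc (T : {set 'I_n}), [/\ a = DPair (DInt sc) (enc_set T), T \in feasible F &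
    ETop X k T <= (1 + 8 * eps) * OPTmin X k].
Proof.
move=> ok rch.
have [S0 S0F] : exists S0, S0 \in feasible F by apply/set0Pn; exact: feasible_neq0.
have pF : odflt set0 [pick S in feasible F] \in feasible F.
  by case: pickP => [S //|/(_ S0)]; rewrite S0F.
rewrite /OPTmin; case: arg_minP => // S SF Smin.
have [i [b [l [t [B [bn EB ll tT [St good]]]]]]] := exists_good S.
have [l0 hl] := K_Ls ll; rewrite /= in hl.
have [|S' [S'F S't [sc [T [Ea Hsc]]]]] := rch i b l.+1 t bn ll tT.
  exists S => //; rewrite -St; apply: eq_bigr => j _.
  rewrite /wfun /base -EB; congr wz; lia.
rewrite /base -EB (_ : l.+1%:Z - 1 = l%:Z) in S't Hsc; last by lia.
have {}good := good S' S't.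
case: ok => [E|[T1 [B1 [lt1 [E T1F cB cl]]]]]; first by rewrite E in Ea.
exists sc, T1; rewrite E in Ea; have [Esc _] := Ea; split=> //; first by rewrite E -Esc.
have [b1 [l1 [Eb El H1]]] := score_sound T1 cB cl.
have Dn : 0 < (D%:~R ^+ n.+1 : rat) by rewrite exprn_gt0 // ltr0z D_gt0.
have H2 : upper (gp X k m D) (gJ X k m D) k T1 b1 l1 (down (i_Ls K)) <=
    upper (gp X k m D) (gJ X k m D) k S' B l (down (i_Ls K)).
  rewrite -(ler_pM2l Dn) -!score_value ler_int.
  by move: Hsc; rewrite -Esc Eb El.
have al0 := alpha_gt0 D_gt0 k_gt0 m1.
have := le_trans H1 (le_trans H2 good).
rewrite -!(lval_ETop lawX D_gt0 D_dvd k_gt0 m1) mulrCA ler_pM2l // => H.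
apply: le_trans H _; apply: ler_wpM2r.
  by rewrite -(pmulr_rge0 _ al0) (lval_ETop lawX D_gt0 D_dvd k_gt0 m1); apply: lval_ge0; exact: gp01.
by have := inv_m_le eps_gt0; lra.
Qed.

Definition asked_ok (qc : data * nat) := exists (w : 'I_n -> int) target,
  [/\ qc.1 = enc_query w target,
   (large_mode k eps -> magnitude w <= 2 * n * m + 1)%N,
   (~~ large_mode k eps -> magnitude w <= small_base n m ^ (small_dim k m).+1)%N &
   (qc.2 <= cc * (size code).+1 ^ cc * maxn 1 (magnitude w) ^ cc)%N].

Lemma asked_magnitude qc : asked K il cst qc -> asked_ok qc.
Proof.
case=> B [lt [tg [cB cl E1 E2]]]; have [b [l [EB El _]]] := score_sound set0 cB cl.
exists (wfun K il B lt), tg; split=> // h; apply/bigmax_leqP => i _; rewrite /wfun EB El /ptas_inst.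
  rewrite h; have /andP[h1 h2] := wz_large_bounds lawX D_gt0 k_gt0 m1 n_gt0 b l i.
  by rewrite -lez_nat gez0_abs // PoszD.
rewrite (negbTE h); have /andP[h1 h2] := wz_small_bounds lawX D_gt0 D_dvd k_gt0 m1 n_gt0 b l i.
by rewrite -lez_nat gez0_abs // -PoszX ltW.
Qed.

Lemma run_ptas : exists S t tr,
  [/\ run prog (solver_oracle Q code) (ptas_input code X k eps) (enc_set S) t tr,
      S \in feasible F, ETop X k S <= (1 + 8 * eps) * OPTmin X k,
      (t <= step_count X k eps * ((word_bound X k eps).+1 * (word_bound X k eps).+1))%N &
      (forall qc, List.In qc tr -> asked_ok qc) /\ (size tr <= n * (n.+1 * (size (i_Ll K) * i_T K)))%N].
Proof.
have [a [tr [R1 ok rch [as_ sz_]]]] := @run_main (solver_oracle Q code) F X k eps code cst k_gt0 eps_gt0 HQ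
  (@small_k eps eps_gt0 eps_le1 k).
have [sc [T [Ea TF HT]]] := correct ok rch.
have [t Ht tt] := R1 _ _ Ea.
exists T, t, tr; split=> //; split=> // qc /as_; exact: asked_magnitude.
Qed.
End Correct.

(** * Bounds on time, calls and magnitudes *)

Lemma poly_steps (a b d r : nat) : exists c0 : nat, forall s m T : nat, (0 < s)%N -> (0 < m)%N ->
  forall e L : nat, e = (a.+1 * (s * s * s * s) + b * (m * m * m * m))%N -> L = (d * (e * e * e * e)).+1 ->
  (r * (e * e * e * e * e * e * e) * T * (L.+1 * L.+1) <= c0 * (s * m) ^ 60 * T)%N.
Proof.
(* [L] is of order [e ^ 4], which makes the cost of order [e ^ 7 * e ^ 8], and [e] is at most a
   constant times [(s * m) ^ 4]: hence 15 and 60. *)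
exists (r * ((d + 2) * (d + 2)) * (a.+1 + b) ^ 15)%N => s m T s0 m0 e L eE LE.
have x4 x : (x * x * x * x = x ^ 4)%N by rewrite !expnS expn0 muln1 !mulnA.
have he : (e <= (a.+1 + b) * (s * m) ^ 4)%N.
  rewrite eE !x4 expnMn mulnDl leq_add // leq_mul2l ?leq_pmulr ?leq_pmull ?expn_gt0 ?s0 ?m0 ?orbT //.
have e0 : (0 < e)%N by rewrite eE !x4 ltn_addr // muln_gt0 expn_gt0 s0.
have hL : (L.+1 <= (d + 2) * e ^ 4)%N.
  have : (0 < e ^ 4)%N by rewrite expn_gt0 e0.
  by rewrite LE x4; move: (e ^ 4)%N => z z0; rewrite mulnDl; clear -z0; lia.
have {}he : (e ^ 15 <= (a.+1 + b) ^ 15 * (s * m) ^ 60)%N.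
  by rewrite (expnM _ 4 15) -expnMn leq_exp2r.
have x7 : (e * e * e * e * e * e * e = e ^ 7)%N by rewrite !expnS expn0 muln1 !mulnA.
rewrite x7; apply: leq_trans (leq_mul (leqnn _) (leq_mul hL hL)) _.
apply: (@leq_trans (r * ((d + 2) * (d + 2)) * e ^ 15 * T)%N); last first.
  rewrite leq_mul2r -[leqRHS]mulnA leq_mul2l he !orbT //.
rewrite (expnD e 7 8) (expnD e 4 4); move: (e ^ 7)%N (e ^ 4)%N (d + 2)%N => u v w; clear.
by rewrite leq_eqVlt; apply/orP; left; apply/eqP; ring.
Qed.

Lemma steps_bound : exists c0 : nat, forall (F : set_system) (X : 'I_(ground F) -> law) k eps,
  (step_count X k eps * ((word_bound X k eps).+1 * (word_bound X k eps).+1)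
    <= c0 * (input_size X k eps * precision eps) ^ 60 * (i_T (ptas_inst X k eps)).+1)%N.
Proof.
have [c0 H] := poly_steps 99 (200 * 100) 1000 (80 * 100); exists c0 => F X k eps.
exact: (H _ _ _ (s_gt0 X k eps) (m_gt0 eps) _ _ erefl erefl).
Qed.

Section Large.
Variables (F : set_system) (X : 'I_(ground F) -> law) (k : nat) (eps : rat).
Hypothesis eps_gt0 : 0 < eps.
Hypothesis eps_le1 : eps <= 1.
Hypothesis lg : large_mode k eps.
Local Notation n := (ground F).
Local Notation m := (precision eps).
Local Notation K := (ptas_inst X k eps).

Lemma T_large : i_T K = (2 * n * m).+1.
Proof. by rewrite /ptas_inst lg. Qed.

Lemma Ll_large : size (i_Ll K) = (2 * m + 2)%N.
Proof. by rewrite /ptas_inst lg (_ : i_Ll _ = down (2 * m + 2)) // size_down. Qed.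

Lemma inv_ge1 : 1 <= eps^-1.
Proof. by rewrite invf_ge1. Qed.

Lemma m_le2 : m%:R <= 2 * eps^-1.
Proof. by have := m_le eps_gt0; have := inv_ge1; lra. Qed.

Lemma pow_base_le (b : rat) (i j : nat) : 1 <= b -> (i <= j)%N -> b ^+ i <= b ^+ j.
Proof. by move=> b1; apply: ler_weXn2l. Qed.

Lemma prod_le (a : nat) (z : rat) : 0 <= z -> 1 <= z + eps^-1 -> a%:R <= z -> (a * m)%:R <= 2 * (z + eps^-1) ^+ 2.
Proof.
move=> z0 z1 az; have h1 := m_le2; have h2 := inv_ge1.
rewrite natrM; apply: le_trans (ler_pM _ _ az h1) _ => //.
have : 0 <= z * z + eps^-1 * eps^-1 by rewrite addr_ge0 // mulr_ge0 // (le_trans _ h2).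
by rewrite expr2; move: (eps^-1) => y h; nra.
Qed.

Lemma magnitude_large (w : 'I_n -> int) : (magnitude w <= 2 * n * m + 1)%N ->
  (magnitude w)%:R <= 6 * (n%:R + eps^-1) ^+ 2.
Proof.
have n0 : (0 < n)%N := ground_gt0 F; have m0 := m_gt0 eps; have h2 := inv_ge1.
move=> h; have h3 : (magnitude w <= 3 * (n * m))%N.
  by apply: leq_trans h _; have : (0 < n * m)%N by [rewrite muln_gt0 n0 m0]; rewrite -mulnA; move: (n * m)%N; clear; lia.
have n1 : 1 <= n%:R :> rat by rewrite ler1n.
have h4 := @prod_le n n%:R (ler0n _ _) _ (lexx _).
have {}h4 := h4 (ltac:(lra)).
have : (magnitude w)%:R <= (3 * (n * m))%:R :> rat by rewrite ler_nat.
rewrite (natrM _ 3); lra.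
Qed.

Lemma trace_large (t : nat) : (t <= n * (n.+1 * (size (i_Ll K) * i_T K)))%N ->
  t%:R <= 96 * (n%:R + eps^-1) ^+ 5.
Proof.
rewrite Ll_large T_large; have n0 : (0 < n)%N := ground_gt0 F; have m0 := m_gt0 eps; have h2 := inv_ge1.
move=> h; have h3 : (t <= 24 * ((n * m) * (n * m) * n))%N.
  apply: leq_trans h _.
  apply: (@leq_trans (n * (2 * n * (4 * m * (3 * (n * m))))))%N; last first.
    by rewrite leq_eqVlt; apply/orP; left; apply/eqP; ring.
  rewrite leq_mul2l; apply/orP; right; apply: leq_mul; first by lia.
  apply: leq_mul; first by lia.
  by have : (0 < n * m)%N by [rewrite muln_gt0 n0 m0]; rewrite -mulnA; move: (n * m)%N; clear; lia.
have n1 : 1 <= n%:R :> rat by rewrite ler1n.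
have h4 : (n * m)%:R <= 2 * (n%:R + eps^-1) ^+ 2 by apply: prod_le => //; lra.
have h5 : t%:R <= (24 * ((n * m) * (n * m) * n))%:R :> rat by rewrite ler_nat.
apply: le_trans h5 _; rewrite natrM (natrM _ (_ * _) n) (natrM _ (n * m)).
have h6 : n%:R <= n%:R + eps^-1 by lra.
have h7 := ler_pM (ler0n _ _) (ler0n _ _) h4 h4.
have h8 := ler_pM (mulr_ge0 (ler0n rat _) (ler0n _ _)) (ler0n _ _) h7 h6.
have {}h8 := ler_wpM2l (ler0n rat 24) h8.
apply: le_trans h8 _; rewrite le_eqVlt; apply/orP; left; apply/eqP; ring.
Qed.

Lemma steps_large (c0 j t : nat) : (t <= c0 * (input_size X k eps * m) ^ j * (i_T K).+1)%N ->
  t%:R <= (4 * c0 * 2 ^ j.+1)%:R * (eps^-1 + (input_size X k eps)%:R) ^+ (2 * j.+1).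
Proof.
rewrite T_large; have n0 : (0 < n)%N := ground_gt0 F; have m0 := m_gt0 eps; have h2 := inv_ge1.
have ns := @n_le F X k eps; have s0 := s_gt0 X k eps; move: (input_size X k eps) ns s0 => z ns z0 h.
have h3 : (t <= 4 * c0 * (z * m) ^ j.+1)%N.
  apply: leq_trans h _; rewrite (expnS _ j); move: (_ ^ j)%N => x.
  apply: (@leq_trans (c0 * x * (4 * (z * m)))%N).
    rewrite leq_mul2l; apply/orP; right.
    have : (n * m <= z * m)%N by rewrite leq_mul2r ns orbT.
    have : (0 < n * m)%N by rewrite muln_gt0 n0 m0.
    by rewrite -mulnA; move: (n * m)%N (z * m)%N; clear; lia.
  by rewrite leq_eqVlt; apply/orP; left; apply/eqP; ring.
have z1 : 1 <= z%:R :> rat by rewrite ler1n.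
have h4 : (z * m)%:R <= 2 * (z%:R + eps^-1) ^+ 2 by apply: prod_le => //; lra.
have : t%:R <= (4 * c0 * (z * m) ^ j.+1)%:R :> rat by rewrite ler_nat.
move=> h5; apply: le_trans h5 _; rewrite !(natrM _ (4 * c0)) -mulrA ler_wpM2l // natrX.
have h6 : 0 <= 2 * (z%:R + eps^-1) ^+ 2 by apply: le_trans h4.
apply: (@le_trans _ _ ((2 * (z%:R + eps^-1) ^+ 2) ^+ j.+1)); first by rewrite lerXn2r ?nnegrE.
by rewrite exprMn -exprM natrX (addrC eps^-1).
Qed.
End Large.

(** One number above both the targets and the magnitudes. There are at most [16 * 544 * m ^ 6]
    digits, by [k <= 16 * m ^ 2]; the factor 2 covers the extra radix place of the magnitudes. *)
Definition query_range (n m : nat) : nat := (n * n * (gran m).+1) ^ (2 * (16 * 544 * m ^ 6)).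

Lemma range_ge n m : (0 < n)%N -> (1 < m)%N -> (2 * n * m + 2 <= n * n * (gran m).+1)%N.
Proof.
move=> n0 m1; have := gran_ge (ltnW m1); move: (gran m) => G h.
apply: (@leq_trans (n * n * (32 * m))); last by rewrite leq_mul2l (leq_trans h) ?orbT.
have : (n * m <= n * (n * m))%N by apply: leq_pmull.
have : (0 < n * m)%N by rewrite muln_gt0 n0 ltnW.
by rewrite -!mulnA (mulnCA n 32 m) (mulnCA n 32); move: (n * m)%N (n * (n * m))%N; clear; lia.
Qed.

Lemma small_dim_lt k m q : (0 < k)%N -> (1 < m)%N -> (k <= 16 * (m * m))%N -> q = (16 * 544)%N ->
  (small_dim k m < 2 * (q * m ^ 6))%N.
Proof.
move=> k0 m1 km ->; rewrite /small_dim.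
have [p ->] : exists p, 544%N = p.+1 by exists 543%N.
have k2 : (0 < k * (m * m))%N by rewrite !muln_gt0 k0 (ltnW m1).
have p2 : (0 < p.+1 * (m * m))%N by rewrite !muln_gt0 (ltnW m1).
have m6 : (0 < m ^ 6)%N by rewrite expn_gt0 (ltnW m1).
have h : (k * (m * m) * (p.+1 * (m * m)) <= 16 * p.+1 * m ^ 6)%N.
  have -> : (16 * p.+1 * m ^ 6 = 16 * (m * m) * (m * m) * (p.+1 * (m * m)))%N.
    by rewrite !expnS expn0; ring.
  by rewrite leq_mul2r leq_mul2r km !orbT.
have h2 : ((k * (m * m) - 1) * (p.+1 * (m * m)) + 1 <= k * (m * m) * (p.+1 * (m * m)))%N.
  by move: (k * (m * m))%N (p.+1 * (m * m))%N k2 p2; clear => a b a0 b0; rewrite mulnBl mul1n; nia.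
apply: leq_ltn_trans (leq_trans h2 h) _.
by apply: ltn_Pmull => //; rewrite muln_gt0 m6 andbT.
Qed.

Section Range.
Variables (F : set_system) (X : 'I_(ground F) -> law) (k : nat) (eps : rat).
Hypothesis eps_gt0 : 0 < eps.
Hypothesis eps_le1 : eps <= 1.
Hypothesis k_gt0 : (0 < k)%N.
Local Notation n := (ground F).
Local Notation m := (precision eps).
Local Notation K := (ptas_inst X k eps).
Local Notation Y := (query_range n m).
Hypothesis km : (k <= 16 * (m * m))%N.

Let n0 : (0 < n)%N. Proof. exact: ground_gt0. Qed.
Let m1 : (1 < m)%N. Proof. exact: m_gt1. Qed.
Let Z2 : (2 * n * m + 2 <= n * n * (gran m).+1)%N. Proof. exact: range_ge. Qed.

Lemma range_gt0 : (0 < Y)%N.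
Proof. by rewrite /query_range expn_gt0 !muln_gt0 n0. Qed.

Lemma range_pow b i : (b <= n * n * (gran m).+1)%N -> (0 < i)%N ->
  (i <= 2 * (16 * 544 * m ^ 6))%N -> (b ^ i <= Y)%N.
Proof.
move=> hb i0 hi; apply: (@leq_trans ((n * n * (gran m).+1) ^ i)%N); first by rewrite leq_exp2r.
by rewrite /query_range leq_pexp2l // !muln_gt0 n0.
Qed.

Let dim_pos : (0 < 2 * (16 * 544 * m ^ 6))%N.
Proof. by rewrite muln_gt0 (muln_gt0 _ (m ^ 6)) expn_gt0 (ltnW m1). Qed.

Lemma large_range b : (b <= 2 * n * m + 2)%N -> (b <= Y)%N.
Proof. by move=> hb; rewrite -[b]expn1; apply: range_pow => //; apply: leq_trans hb Z2. Qed.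

Lemma small_base_le : (small_base n m <= n * n * (gran m).+1)%N.
Proof.
rewrite /small_base mulnA mulnS addnC leq_add2r muln_gt0 n0 //.
Qed.

(** Both modes have to be treated: at the boundary [k = 16 / eps ^ 2] the program runs in large
    mode, and the time bound for small k is claimed there too. *)
Lemma T_range : (i_T K <= Y)%N.
Proof.
rewrite /ptas_inst; case: ifP => _.
  by rewrite (_ : i_T _ = (2 * n * m).+1) //; apply: large_range; lia.
rewrite (_ : i_T _ = small_base n m ^ small_dim k m)%N //; apply: range_pow => //.
- exact: small_base_le.
- by rewrite /small_dim addn1.
- by apply: ltnW; apply: small_dim_lt.
Qed.

Lemma Ll_range : (size (i_Ll K) <= 4 * m)%N.
Proof.
rewrite /ptas_inst; case: ifP => _; last by rewrite (_ : size _ = 1)%N // muln_gt0 ltnW.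
by rewrite (_ : i_Ll _ = down (2 * m + 2)) // size_down; move: m1; clear; lia.
Qed.

Lemma magnitude_range (w : 'I_n -> int) : (large_mode k eps -> magnitude w <= 2 * n * m + 1)%N ->
  (~~ large_mode k eps -> magnitude w <= small_base n m ^ (small_dim k m).+1)%N -> (maxn 1 (magnitude w) <= Y)%N.
Proof.
move=> h1 h2; rewrite geq_max range_gt0 /=; case: (boolP (large_mode k eps)) => [/h1|/h2] h.
  by apply: leq_trans h _; apply: large_range; lia.
apply: leq_trans h _; apply: range_pow => //; first exact: small_base_le.
exact: small_dim_lt.
Qed.

Lemma sum_trace (tr : trace) (b : nat) : (forall qc, List.In qc tr -> (qc.2 <= b)%N) ->
  (\sum_(qc <- tr) qc.2 <= size tr * b)%N.
Proof.
elim: tr => [|qc tr IH] h; first by rewrite big_nil.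
rewrite big_cons mulSn leq_add //; first by apply: h; left.
by apply: IH => q hq; apply: h; right.
Qed.

(** One factor of the range comes from the number of calls, and its power [cc] from the time of each
    call. *)
Lemma total_le (code : bitseq) cc c0 t (tr : trace) : (t <= c0 * (input_size X k eps * m) ^ 60 * (i_T K).+1)%N ->
  (forall qc, List.In qc tr -> @asked_ok F k eps code cc qc) ->
  (size tr <= n * (n.+1 * (size (i_Ll K) * i_T K)))%N ->
  (total_time t tr <= (2 * c0 + 8 * cc) * (input_size X k eps ^ 60 * m ^ 61) * (size code).+1 ^ cc * (n * n * Y ^ cc.+1))%N.
Proof.
move=> ht hq hs; rewrite /total_time.
have hsum : (\sum_(qc <- tr) qc.2 <= size tr * (cc * (size code).+1 ^ cc * Y ^ cc))%N.
  apply: sum_trace => qc /hq [w [tg [_ h1 h2 h3]]]; apply: leq_trans h3 _.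
  rewrite leq_mul2l; apply/orP; right; have [->|c0'] := posnP cc; [by rewrite !expn0 | by rewrite leq_exp2r // magnitude_range].
have Y0 := range_gt0; have hT := T_range; have hL := Ll_range.
have hs2 : (size tr <= 8 * (m * (n * n * Y)))%N.
  apply: leq_trans hs _; apply: (@leq_trans (n * (2 * n * (4 * m * Y))))%N; last first.
    by rewrite leq_eqVlt; apply/orP; left; apply/eqP; ring.
  rewrite leq_mul2l; apply/orP; right; apply: leq_mul; first by move: n0; clear; lia.
  exact: leq_mul.
have s0 := s_gt0 X k eps; have m0 := ltnW m1.
have sc0 : (0 < (size code).+1 ^ cc)%N by rewrite expn_gt0.
have hm : (m <= input_size X k eps ^ 60 * m ^ 61)%N.
  apply: leq_trans (leq_pmull _ _); last by rewrite expn_gt0 s0.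
  by rewrite expnS leq_pmulr // expn_gt0 m0.
have {}ht : (t <= 2 * c0 * (input_size X k eps ^ 60 * m ^ 61) * Y)%N.
  apply: leq_trans ht _; rewrite expnMn.
  apply: (@leq_trans (c0 * (input_size X k eps ^ 60 * m ^ 60) * (2 * Y)))%N.
    by rewrite leq_mul2l; apply/orP; right; move: hT Y0; clear; lia.
  have : (m ^ 60 <= m ^ 61)%N by rewrite (expnS _ 60) leq_pmull.
  move: (m ^ 60)%N (m ^ 61)%N (input_size X k eps ^ 60)%N => u v w uv; rewrite mulnCA !mulnA -!(mulnA _ _ Y).
  by rewrite !leq_mul2l leq_mul2r; rewrite ?uv ?orbT.
move: (input_size X k eps ^ 60 * m ^ 61)%N ((size code).+1 ^ cc)%N hm ht sc0 hsum => A B hm ht B0 hsum.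
have E : (Y ^ cc.+1 = Y * Y ^ cc)%N by rewrite expnS.
have Yc : (0 < Y ^ cc)%N by rewrite expn_gt0 Y0.
move: (Y ^ cc)%N Yc E hsum => W W0 -> hsum.
have h1 : (t <= 2 * c0 * A * B * (n * n * (Y * W)))%N.
  apply: leq_trans ht _; rewrite -!(mulnA _ B) leq_mul2l; apply/orP; right.
  rewrite -[leqLHS]mul1n; apply: leq_mul => //.
  by apply: leq_trans (leq_pmull _ _); rewrite ?muln_gt0 ?n0 // leq_pmulr.
have h2 : (\sum_(qc <- tr) qc.2 <= 8 * cc * A * B * (n * n * (Y * W)))%N.
  apply: leq_trans hsum _; apply: leq_trans (leq_mul hs2 (leqnn _)) _.
  apply: (@leq_trans (8 * (A * (n * n * Y)) * (cc * B * W)))%N.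
    by rewrite leq_mul2r leq_mul2l leq_mul2r hm !orbT.
  by rewrite leq_eqVlt; apply/orP; left; apply/eqP; ring.
by apply: leq_trans (leq_add h1 h2) _; rewrite -!mulnDl.
Qed.
End Range.

Lemma bitlen_le z : (bitlen z <= `|z|.+1)%N.
Proof.
rewrite /bitlen ltnS; case: (`|z|%N) => [|a]; first by rewrite trunc_log0.
by apply: ltnW; apply: leq_trans (ltn_expl _ (isT : (1 < 2)%N)) _; apply: trunc_logP.
Qed.

(** As [k <= 16 * m ^ 2], the encodings of k and eps have lengths bounded in terms of eps, so that
    the laws account for the rest of the input size. *)
Definition overhead (eps : rat) : nat := (16 * (precision eps * precision eps) + dsize (enc_rat eps) + 5)%N.

Lemma s_le (F : set_system) (X : 'I_(ground F) -> law) k eps : (k <= 16 * (precision eps * precision eps))%N ->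
  (input_size X k eps <= dsize (enc_laws X) * overhead eps)%N.
Proof.
have := bitlen_le k%:Z; rewrite /overhead.
have -> : input_size X k eps = (dsize (enc_laws X) + ((bitlen k).+1 + dsize (enc_rat eps)).+1).+1 by [].
rewrite absz_nat; move: (precision eps * precision eps)%N (dsize (enc_rat eps)) (bitlen k) => u v b.
move: (dsize (enc_laws X)) (dsize_gt0 (enc_laws X)) => w w0; clear -w0 => h1 h2.
have : (16 * u + v + 4 <= w * (16 * u + v + 4))%N by rewrite leq_pmull.
have -> : (w * (16 * u + v + 5) = w + w * (16 * u + v + 4))%N by ring.
by move: (w * (16 * u + v + 4))%N => z; clear -h1 h2; lia.
Qed.

(** What remains once the powers of n, of the code length and of the size of the laws are taken out;
    from the range, only the granularity stays. *)
Definition eps_factor (c0 cc : nat) (eps : rat) : nat :=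
  ((2 * c0 + 8 * cc) * (overhead eps ^ 60 * precision eps ^ 61) *
   (gran (precision eps)).+1 ^ (2 * (16 * 544 * precision eps ^ 6) * cc.+1))%N.

(** By [m <= 2 / eps], [m ^ 6] is at most [64 / eps ^ 6], and 256 is [4 * 64]. The trailing 2 on the
    left stands for the factor [n * n] from the loops over items and multiples. *)
Lemma exponent_le q cc eps : 0 < eps -> eps <= 1 ->
  (2 * (2 * (q * precision eps ^ 6)) * cc.+1 + 2 <= Num.truncn ((256 * q * cc.+1 + 62)%:R / eps ^+ 6))%N.
Proof.
move=> e0 e1; rewrite truncn_ge_nat; last by rewrite divr_ge0 // exprn_ge0 // ltW.
have h1 := m_le2 e0 e1; have h2 := inv_ge1 e0 e1.
have h3 : 1 <= eps^-1 ^+ 6 by rewrite exprn_ege1.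
have h4 : (precision eps ^ 6)%:R <= 64 * eps^-1 ^+ 6.
  rewrite natrX; apply: (@le_trans _ _ ((2 * eps^-1) ^+ 6)); first by rewrite lerXn2r ?nnegrE // (le_trans _ h1).
  by rewrite exprMn le_eqVlt; apply/orP; left; apply/eqP; congr (_ * _); ring.
rewrite -exprVn; move: (precision eps ^ 6)%N (eps^-1 ^+ 6) h3 h4 => u v v1 uv; rewrite !natrD !natrM.
have p0 : 0 <= q%:R * cc.+1%:R :> rat by rewrite mulr_ge0.
have : q%:R * cc.+1%:R * u%:R <= q%:R * cc.+1%:R * (64 * v) by rewrite ler_wpM2l.
by move: (q%:R) (cc.+1%:R) p0 => a b p0; clear -v1; nra.
Qed.

Lemma total_time_le (F : set_system) (X : 'I_(ground F) -> law) k eps (code : bitseq) c0 cc q t tr :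
  0 < eps -> eps <= 1 -> (0 < k)%N -> (k <= 16 * (precision eps * precision eps))%N ->
  q = (16 * 544)%N ->
  (t <= c0 * (input_size X k eps * precision eps) ^ 60 * (i_T (ptas_inst X k eps)).+1)%N ->
  (forall qc, List.In qc tr -> @asked_ok F k eps code cc qc) ->
  (size tr <= ground F * ((ground F).+1 * (size (i_Ll (ptas_inst X k eps)) * i_T (ptas_inst X k eps))))%N ->
  (total_time t tr <= ground F ^ Num.truncn ((256 * q * cc.+1 + 62)%:R / eps ^+ 6) * eps_factor c0 cc eps *
     ((size code).+1 ^ (256 * q * cc.+1 + 62) * dsize (enc_laws X) ^ (256 * q * cc.+1 + 62)))%N.
Proof.
move=> e0 e1 k0 km Eq ht hq hs.
apply: leq_trans (total_le e0 e1 k0 km ht hq hs) _.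
have n0 : (0 < ground F)%N := ground_gt0 F.
have q0 : (0 < q)%N by rewrite Eq.
have hE := exponent_le q cc e0 e1.
have hs2 := s_le X km.
rewrite /eps_factor /query_range -Eq.
set c := (256 * q * cc.+1 + 62)%N in hE *; set Ex := Num.truncn _ in hE *.
clearbody Ex.
have cle : (60 <= c)%N by rewrite /c; clear; lia.
have ccc : (cc <= c)%N.
  by apply: leq_trans (leqnSn cc) _; apply: leq_trans (leq_addr _ _); rewrite leq_pmull // muln_gt0.
clearbody c.
have W0 := dsize_gt0 (enc_laws X).
have H1 : (input_size X k eps ^ 60 <= dsize (enc_laws X) ^ c * overhead eps ^ 60)%N.
  apply: (@leq_trans ((dsize (enc_laws X) * overhead eps) ^ 60)%N); first by rewrite leq_exp2r.
  by rewrite expnMn leq_mul2r leq_pexp2l ?orbT.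
have H2 : ((size code).+1 ^ cc <= (size code).+1 ^ c)%N by rewrite leq_pexp2l.
move: (2 * (q * precision eps ^ 6))%N hE => de hE.
have H3 : (ground F * ground F * ((ground F * ground F * (gran (precision eps)).+1) ^ de) ^ cc.+1 <=
   ground F ^ Ex * (gran (precision eps)).+1 ^ (de * cc.+1))%N.
  rewrite -expnM expnMn mulnA leq_mul2r; apply/orP; right.
  rewrite mulnn -expnM -expnD; apply: leq_trans (leq_pexp2l n0 hE).
  by rewrite leq_pexp2l // addnC -mulnA.
move: (input_size X k eps ^ 60)%N ((size code).+1 ^ cc)%N ((size code).+1 ^ c)%N (dsize (enc_laws X) ^ c)%N
  (overhead eps ^ 60)%N (precision eps ^ 61)%N (2 * c0 + 8 * cc)%N H1 H2 H3 => u v v' w o mm cst H1 H2 H3.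
move: (ground F ^ Ex)%N (_ ^ (de * cc.+1))%N H3 => x y H3.
apply: leq_trans (leq_mul (leq_mul (leq_mul (leqnn cst) (leq_mul H1 (leqnn mm))) H2) H3) _.
by rewrite leq_eqVlt; apply/orP; left; apply/eqP; ring.
Qed.

Lemma inv_le_m eps : 0 < eps -> eps <= 1 -> eps^-1 <= (precision eps)%:R.
Proof.
move=> e0 e1; have := inv_m_le e0; rewrite -[leRHS]invrK lef_pV2 // posrE ?invr_gt0 //.
Qed.

Lemma few_k k eps : 0 < eps -> eps <= 1 -> k%:R <= 16 / eps ^+ 2 -> (k <= 16 * (precision eps * precision eps))%N.
Proof.
move=> e0 e1; have h := inv_le_m e0 e1; rewrite -exprVn => hk.
rewrite -(ler_nat rat); apply: le_trans hk _; rewrite !natrM ler_wpM2l // expr2.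
by apply: ler_pM => //; rewrite invr_ge0 ltW.
Qed.

Lemma many_k k eps : 0 < eps -> 16 / eps ^+ 2 <= k%:R -> large_mode k eps.
Proof.
move=> e0; rewrite ler_pdivrMr ?exprn_gt0 // => h.
have d0 : 0 < (denq eps)%:~R :> rat by rewrite ltr0z.
rewrite /large_mode -(ler_int rat) !intrM -!rat_num_den.
have := ler_wpM2r (ltW (mulr_gt0 d0 d0)) h.
rewrite -pmulrn; move: (denq eps)%:~R => d; congr (_ <= _); ring.
Qed.

Lemma weaken (b x : rat) (a d i : nat) : 1 <= b -> x <= a%:R * b ^+ i -> (a <= d)%N -> (i <= d)%N ->
  x <= d%:R * b ^+ d.
Proof.
move=> b1 h ad id; apply: le_trans h _; have b0 := le_trans ler01 b1.
by apply: ler_pM; rewrite ?exprn_ge0 ?ler_nat // pow_base_le.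
Qed.

Theorem corollary4p16 :
  exists (C A : rat) (d : nat),
  [/\ 0 < C, 0 <= A &
  forall (D : encoding) (Q : program), exact_sum_solver D Q ->
  exists (P : program) (c : nat) (g : rat -> nat),
  forall (code : bitseq) (F : set_system), D code = Some F ->
  forall (X : 'I_(ground F) -> law) (k : nat) (eps : rat),
    (forall i, is_law (X i)) -> (1 <= k)%N -> 0 < eps -> eps <= 1 ->
  exists (S : {set 'I_(ground F)}) (t : nat) (tr : trace),
  [/\ run P (solver_oracle Q code) (ptas_input code X k eps) (enc_set S) t tr,
      S \in feasible F,
      ETop X k S <= (1 + A * eps) * OPTmin X k,
      k%:R <= C / eps ^+ 2 ->
        (total_time t tr <=
           ground F ^ Num.truncn (c%:R / eps ^+ 6) * g eps *
           ((size code).+1 ^ c * dsize (enc_laws X) ^ c))%N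
    & C / eps ^+ 2 <= k%:R ->
        [/\ (size tr)%:R <= d%:R * ((ground F)%:R + eps^-1) ^+ d,
            forall qc, List.In qc tr ->
              exists (w : 'I_(ground F) -> int) (target : int),
                qc.1 = enc_query w target /\
                (magnitude w)%:R <= d%:R * ((ground F)%:R + eps^-1) ^+ d
          & t%:R <= d%:R * (eps^-1 + (dsize (enc_params X k eps))%:R) ^+ d]]].
Proof.
have [c0 Hc0] := steps_bound.
(* Large numerals are kept symbolic: [q] is the digit count relative to [m ^ 6], [j] the exponent of
   the step bound, [p] the constant of [steps_large]. *)
have [q Eq] : exists q, q = (16 * 544)%N by eexists; reflexivity.
have [j Ej] : exists j, j = 60%N by eexists; reflexivity.
have [p Ep] : exists p, p = (4 * c0 * 2 ^ j.+1)%N by eexists; reflexivity.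
(* 16 separates the modes, 8 comes from [1 + 8 / m] with [1 / m <= eps], and 200 exceeds the
   constants 6 and 96 and the exponents 2, 5 and 122. *)
exists 16, 8, (p + 200)%N; split=> // D Q [cc HQ].
exists prog, (256 * q * cc.+1 + 62)%N, (eps_factor c0 cc) => code F EF X k eps lawX k0 e0 e1.
have [S [t [tr [R1 SF opt ht [hq hs]]]]] := run_ptas lawX k0 e0 e1 (HQ code F EF).
have {}ht := leq_trans ht (Hc0 F X k eps).
have n1 : 1 <= (ground F)%:R :> rat by rewrite ler1n ground_gt0.
have i1 := inv_ge1 e0 e1.
have b1 : 1 <= (ground F)%:R + eps^-1 by lra.
exists S, t, tr; split=> //.
- by move=> hk; exact: (total_time_le e0 e1 k0 (few_k e0 e1 hk) Eq ht hq hs).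
move=> hk; have lg := many_k e0 hk.
split.
- by have H := trace_large e0 e1 lg hs; refine (weaken b1 H _ _); apply: leq_trans (leq_addl _ _).
- move=> qc /hq [w [tg [E h _ _]]]; exists w, tg; split=> //.
  by have H := magnitude_large e0 e1 (h lg); refine (weaken b1 H _ _); apply: leq_trans (leq_addl _ _).
rewrite -Ej in ht.
have b2 : 1 <= eps^-1 + (input_size X k eps)%:R by have := ler0n rat (input_size X k eps); lra.
have H := steps_large e0 e1 lg ht; rewrite -Ep in H.
by apply: (weaken b2 H); [exact: leq_addr | rewrite Ej; apply: leq_trans (leq_addl _ _)].
Qed.
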